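(* Let $T\in(0,\infty)$ and let $\mathcal U\colon C([-T,0])\to\mathbb R$ be twice continuously Fréchet differentiable and such that \[ D^2\mathcal U\colon C([-T,0])\to\chi_0\subset\big(C([-T,0])\hat\otimes_\pi C([-T,0])\big)^*\quad\text{continuously with respect to }\chi_0 . \] Assume that there exist continuous extensions (necessarily unique) \[ u\colon\mathscr C([-T,0])\to\mathbb R,\qquad D^2_{dx\,dy}u\colon\mathscr C([-T,0])\to\chi_0 \] of $\mathcal U$ and $D^2_{dx\,dy}\mathcal U$, respectively. Let $\eta\in C([-T,0])$ be such that the (deterministic) quadratic variation $[\eta]$ on $[-T,0]$ exists, and suppose also the following. (i) $D^{2,Diag}_x\mathcal U(\eta)$, the diagonal element of the second-order derivative at $\eta$, has a set of discontinuity which has null measure with respect to $[\eta]$ (in particular, if it is countable). (ii) The horizontal derivative $D^H\mathcal U(\eta)$ exists at $\eta$. Then \[ D^H\mathcal U(\eta)=\int_{[-T,0]}D^\perp_{dx}\mathcal U(\eta)\,d^+\eta(x)-\frac12\int_{[-T,0]}D^{2,Diag}_x\mathcal U(\eta)\,d[\eta](x). \] In particular, the backward integral on the right-hand side exists.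
   Context: **Spaces.** $C([-T,0])$ is the Banach space of real continuous functions on $[-T,0]$ with the supremum norm. $\mathscr C([-T,0])$ is the set of bounded functions $\eta\colon[-T,0]\to\mathbb R$ that are continuous on $[-T,0)$. For $M>0$, $\mathscr C_M([-T,0])$ is the subset of functions bounded by $M$, with the topology induced by the seminorms $p_K(\eta)=\sup_{x\in K}|\eta(x)|+|\eta(0)|$, $K\subset[-T,0)$ compact. $\mathscr C([-T,0])$ carries the inductive topology, i.e. the finest topology making all inclusions $\mathscr C_M([-T,0])\to\mathscr C([-T,0])$ continuous. $C([-T,0])$ is dense in $\mathscr C([-T,0])$. **Extension convention.** Functions $\eta$ on $[-T,0]$ are extended to $\mathbb R$ by $\eta(x)=0$ for $x<-T$ and $\eta(x)=\eta(0)$ for $x\ge0$. **Fréchet derivatives.** For $\eta\in C([-T,0])$, $D_{dx}\mathcal U(\eta)$ is the unique finite signed Borel measure on $[-T,0]$ with $D\mathcal U(\eta)\varphi=\int_{[-T,0]}\varphi(x)D_{dx}\mathcal U(\eta)$ for all $\varphi\in C([-T,0])$. It decomposes uniquely as $D_{dx}\mathcal U(\eta)=D^\perp_{dx}\mathcal U(\eta)+D^{\delta_0}_{dx}\mathcal U(\eta)$, where $D^\perp_{dx}\mathcal U(\eta)$ gives no mass to $\{0\}$ and $D^{\delta_0}_{dx}\mathcal U(\eta)$ is a multiple of the Dirac measure $\delta_0$. The dual of the projective tensor product $C([-T,0])\hat\otimes_\pi C([-T,0])$ is identified with the space of continuous bilinear forms on $C([-T,0])$, in which $D^2\mathcal U(\eta)$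 lies; a finite signed Borel measure $\mu$ on $[-T,0]^2$ is identified with the bilinear form $(\varphi,\psi)\mapsto\int_{[-T,0]^2}\varphi(x)\psi(y)\mu(dx,dy)$. When $D^2\mathcal U(\eta)$ is given by such a measure, that (unique) measure is denoted $D^2_{dx\,dy}\mathcal U(\eta)$. **The space $\chi_0$.** $\chi_0$ is the set of finite signed measures on $[-T,0]^2$ of the form \[ \mu(dx,dy)=g_1(x,y)dx\,dy+\lambda_1\delta_0(dx)\otimes\delta_0(dy)+g_2(x)dx\otimes\lambda_2\delta_0(dy)+\lambda_3\delta_0(dx)\otimes g_3(y)dy+g_4(x)\delta_y(dx)\otimes dy, \] with $g_1\in L^2([-T,0]^2)$, $g_2,g_3\in L^2([-T,0])$, $g_4\in L^\infty([-T,0])$, $\lambda_1,\lambda_2,\lambda_3\in\mathbb R$. It is a Banach space as the direct sum of its five components, with norm (up to equivalence) $\|g_1\|_{L^2}+|\lambda_1|+\|\lambda_2g_2\|_{L^2}+\|\lambda_3g_3\|_{L^2}+\|g_4\|_{L^\infty}$. The function $g_4$ is the diagonal element of $\mu$; the diagonal element of $D^2_{dx\,dy}\mathcal U(\eta)$ is denoted $D^{2,Diag}_x\mathcal U(\eta)$. **Quadratic variation.** The deterministic quadratic variation of $\eta\in C([-T,0])$ on $[-T,0]$ is $[\eta](x)=\lim_{\varepsilon\to0^+}\frac1\varepsilon\int_0^x(\eta(s+\varepsilon)-\eta(s))^2ds$, $x\in[-T,0]$, if the limit exists and is finite for every $x\in[-T,0]$. **Horizontal derivative.** With the extension convention above,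 \[ D^H\mathcal U(\eta)=D^Hu(\eta)=\lim_{\varepsilon\to0^+}\frac{u(\eta)-u\big(\eta(\cdot-\varepsilon)1_{[-T,0)}+\eta(0)1_{\{0\}}\big)}{\varepsilon} \] whenever this limit exists and is finite, where $u$ is the unique continuous extension of $\mathcal U$ to $\mathscr C([-T,0])$. **Backward integral against a measure integrand.** For a finite signed Borel measure $g$ on $[-T,0]$ and a càdlàg $f\colon[-T,0]\to\mathbb R$, \[ \int_{[-T,0]}g(dx)\,d^+f(x)=\lim_{\varepsilon\to0^+}\int_{[-T,0]}g(dx)\frac{f_{\overline J}(x)-f_{\overline J}(x-\varepsilon)}{\varepsilon} \] whenever this limit exists and is finite, where $f_{\overline J}=f(0)$ on $(0,\infty)$, $f_{\overline J}=f$ on $[-T,0]$, $f_{\overline J}=0$ on $(-\infty,-T)$.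
   Formalization: Existence of D^H U(η) is taken to include that the shifted paths lie in 𝒞([-T,0]), the domain of u; this forces η(-T)=0, since u is otherwise undefined there. The remark in (i), ''in particular, if it is countable'', which fails when [η] has jumps, is left out. *)

(* Defs.v *)
From HB Require Import structures.
From mathcomp Require Import all_boot all_order all_algebra.
From mathcomp Require Import all_classical all_reals all_analysis.

Set Implicit Arguments.
Unset Strict Implicit.
Unset Printing Implicit Defensive.
Import Order.TTheory GRing.Theory Num.Theory.
Import numFieldNormedType.Exports.

Local Open Scope classical_set_scope.
Local Open Scope ring_scope.

Section supnorm.
Context {R : realType} {X : Type} {W : normedModType R}.
Implicit Types (D : set X) (f g : X -> W).

Definition supnorm D f : R := sup [set `|f x| | x in D].

Definition bnd D f : Prop := exists M : R, forall x, D x -> `|f x| <= M.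

Lemma supnorm_ub D f x : bnd D f -> D x -> `|f x| <= supnorm D f.
Proof.
move=> [M fM] Dx; apply: ub_le_sup; last by exists x.
by exists M => _ [y Dy <-]; exact: fM.
Qed.

Lemma supnorm_le D f (M : R) : D !=set0 ->
  (forall x, D x -> `|f x| <= M) -> supnorm D f <= M.
Proof.
move=> [x Dx] fM; apply: ge_sup; first by exists `|f x|, x.
by move=> _ [y Dy <-]; exact: fM.
Qed.

Lemma supnormD D f g : D !=set0 -> bnd D f -> bnd D g ->
  supnorm D (fun x => f x + g x) <= supnorm D f + supnorm D g.
Proof.
move=> D0 bf bg; apply: supnorm_le => // x Dx.
by rewrite (le_trans (ler_normD _ _))// lerD// supnorm_ub.
Qed.

Lemma supnormZ D f (c : R) : D !=set0 -> bnd D f ->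
  supnorm D (fun x => c *: f x) = `|c| * supnorm D f.
Proof.
move=> D0 bf; apply/eqP; rewrite eq_le; apply/andP; split.
  by apply: supnorm_le => // x Dx; rewrite normrZ ler_wpM2l// supnorm_ub.
have bcf : bnd D (fun x => c *: f x).
  by case: bf => M fM; exists (`|c| * M) => x Dx; rewrite normrZ ler_wpM2l// fM.
have [->|c0] := eqVneq c 0.
  case: D0 => x Dx; rewrite normr0 mul0r (le_trans (normr_ge0 (0 *: f x)))//.
  by apply: (@supnorm_ub D (fun x => 0 *: f x)) => //; exists 0 => y _; rewrite scale0r normr0.
rewrite -ler_pdivlMl ?normr_gt0//; apply: supnorm_le => // x Dx.
rewrite ler_pdivlMl ?normr_gt0// -normrZ.
exact: (supnorm_ub bcf).
Qed.

Lemma supnorm0_eq0 D f x : bnd D f -> supnorm D f = 0 -> D x -> f x = 0.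
Proof.
move=> bf f0 Dx; apply/eqP; rewrite -normr_le0 -f0; exact: supnorm_ub.
Qed.

End supnorm.

Section clfun.
Context {R : realType} (V W : normedModType R).

Definition clfun_pred : {pred V -> W} :=
  mem [set L : V -> W | (forall (a : R) x y, L (a *: x + y) = a *: L x + L y)
                        /\ continuous L].

Record clfun := CLFun { clfun_val :> V -> W ; _ : clfun_val \in clfun_pred }.

HB.instance Definition _ := [isSub for clfun_val].
HB.instance Definition _ := [Choice of clfun by <:].

Lemma clfun_submod_closed : submod_closed clfun_pred.
Proof.
split.
  rewrite inE/=; split; first by move=> a x y; rewrite scaler0 addr0.
  exact: cst_continuous.
move=> a f g; rewrite !inE/= => -[fl fc] [gl gc]; split.
  move=> b x y; rewrite /= !fctE fl gl !scalerDr !scalerA addrACA.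
  by rewrite (mulrC a b).
by move=> x; apply: cvgD; [apply: cvgZr; exact: fc|exact: gc].
Qed.

HB.instance Definition _ :=
  GRing.isSubmodClosed.Build _ _ clfun_pred clfun_submod_closed.
HB.instance Definition _ := [SubChoice_isSubLmodule of clfun by <:].

Lemma clfunP (L : clfun) : (forall (a : R) x y, L (a *: x + y) = a *: L x + L y)
  /\ continuous L.
Proof. by case: L => L /=; rewrite inE. Qed.

Lemma clfunZ (L : clfun) (a : R) x : L (a *: x) = a *: L x.
Proof.
have L0 : L 0 = 0.
  by have := (clfunP L).1 (- 1) 0 0; rewrite scaler0 addr0 scaleN1r addNr.
by have := (clfunP L).1 a x 0; rewrite L0 !addr0.
Qed.

Definition unit_ball : set V := [set x | `|x| <= 1].

Lemma unit_ball0 : unit_ball !=set0.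
Proof. by exists 0; rewrite /unit_ball /= normr0. Qed.

Lemma clfun_bnd (L : clfun) : bnd unit_ball L.
Proof.
have [Ll Lc] := clfunP L.
have L0 : L 0 = 0 by rewrite -(scale0r 0) clfunZ scale0r.
have /cvgrPdist_le /(_ 1 ltr01) := Lc 0.
move=> /nbhs_ballP[e /= e0 He].
exists (e / 2)^-1 => x; rewrite /unit_ball /= => x1.
have e20 : 0 < e / 2 by rewrite divr_gt0.
have : `|L 0 - L ((e / 2) *: x)| <= 1.
  apply: He; rewrite -ball_normE/= sub0r normrN normrZ gtr0_norm//.
  rewrite (@le_lt_trans _ _ (e / 2))//.
    by rewrite -[leRHS]mulr1 ler_wpM2l// ltW.
  by rewrite ltr_pdivrMr// ltr_pMr// ltr1n.
rewrite L0 sub0r normrN clfunZ normrZ gtr0_norm// => h.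
by rewrite -[leRHS]mulr1 ler_pdivlMl.
Qed.

Definition opnorm (L : clfun) : R := supnorm unit_ball L.

Lemma opnormD (L M : clfun) : opnorm (L + M) <= opnorm L + opnorm M.
Proof. exact: (supnormD unit_ball0 (clfun_bnd L) (clfun_bnd M)). Qed.

Lemma opnormZ (a : R) (L : clfun) : opnorm (a *: L) = `|a| * opnorm L.
Proof. exact: (supnormZ a unit_ball0 (clfun_bnd L)). Qed.

Lemma opnorm0_eq0 (L : clfun) : opnorm L = 0 -> L = 0.
Proof.
move=> L0; apply/val_inj/funext => x /=.
have [->|x0] := eqVneq x 0; first by rewrite -(scale0r 0) clfunZ !scale0r.
have nx : `|x| != 0 by rewrite normr_eq0.
rewrite -[x](scalerKV nx) clfunZ (supnorm0_eq0 (clfun_bnd L) L0) ?scaler0//.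
by rewrite /unit_ball/= normrZ normfV normr_id mulVf.
Qed.

HB.instance Definition _ := Lmodule_isNormed.Build R clfun
  opnormD opnormZ opnorm0_eq0.

End clfun.

Section frechet.
Context {R : realType} {V W : normedModType R}.

(* The Fréchet derivative as a map into the continuous linear maps; 0 where F
   is not differentiable. *)
Definition frechet (F : V -> W) (x : V) : clfun V W := insubd 0 ('d F x : V -> W).

End frechet.

Definition C2 (R : realType) (V W : normedModType R) (F : V -> W) : Prop :=
  [/\ forall x, differentiable F x,
      forall x, differentiable (frechet F) x
    & continuous (frechet (frechet F))].

(* A function on [-T, 0] is represented by its extension to the whole line: 0
   on the left of -T and its value at 0 on the right of 0. *)
Section paths.
Context {R : realType} (T : {posnum R}).
Local Notation t := (T%:num).

Definition itvT : set R := `[- t, 0]%classic.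
Definition itvT_open : set R := `[- t, 0[%classic.

Definition pext (f : R -> R) (x : R) : R :=
  if x < - t then 0 else if 0 <= x then f 0 else f x.

Lemma itvT_left : itvT (- t).
Proof. by rewrite /itvT/= in_itv/= lexx/= oppr_le0. Qed.

Lemma itvT0 : itvT 0.
Proof. by rewrite /itvT/= in_itv/= lexx/= oppr_le0 ltW. Qed.

Lemma itvT_neq0 : itvT !=set0. Proof. by exists 0; exact: itvT0. Qed.

Lemma pext_itvT (f : R -> R) x : itvT x -> pext f x = f x.
Proof.
rewrite /itvT/= in_itv/= /pext => /andP[tx x0]; rewrite ltNge tx/=.
by case: ifPn => // x0'; congr f; apply/eqP; rewrite eq_le x0 x0'.
Qed.

Lemma pext0 (f : R -> R) : pext f 0 = f 0. Proof. exact/pext_itvT/itvT0. Qed.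

Lemma pextZD (a : R) (f g : R -> R) : pext (a *: f + g) = a *: pext f + pext g.
Proof.
apply/funext => x; rewrite !fctE /pext.
by case: ifP; [rewrite scaler0 addr0|case: ifP].
Qed.

(* C([-T,0]) *)
Definition cpath_pred : {pred R -> R} :=
  mem [set f : R -> R | pext f = f /\ {within itvT, continuous f}].

Record cpath := CPath { cpath_val :> R -> R ; _ : cpath_val \in cpath_pred }.

HB.instance Definition _ := [isSub for cpath_val].
HB.instance Definition _ := [Choice of cpath by <:].

Lemma cpath_submod_closed : submod_closed cpath_pred.
Proof.
split.
  rewrite inE/=; split; last exact: cst_continuous.
  by apply/funext => x; rewrite /pext; case: ifP => //; case: ifP.
move=> a f g; rewrite !inE/= => -[fe fc] [ge gc]; split; first by rewrite pextZD fe ge.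
by move=> x; apply: cvgD; [apply: cvgZr; exact: fc|exact: gc].
Qed.

HB.instance Definition _ :=
  GRing.isSubmodClosed.Build _ _ cpath_pred cpath_submod_closed.
HB.instance Definition _ := [SubChoice_isSubLmodule of cpath by <:].

Lemma cpathP (f : cpath) : pext f = f /\ {within itvT, continuous f}.
Proof. by case: f => f /=; rewrite inE. Qed.

Lemma cpath_bnd (f : cpath) : bnd itvT (f : R -> R^o).
Proof.
have [_ fc] := cpathP f.
have : compact ((f : R -> R) @` itvT) by apply: continuous_compact => //; exact: segment_compact.
move=> /compact_bounded[M [_ /(_ (M + 1))]]; rewrite ltrDl ltr01 => /(_ isT) h.
by exists (M + 1) => x Dx; apply: h; exists x.
Qed.

Definition cpath_norm (f : cpath) : R := supnorm itvT (f : R -> R^o).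

Lemma cpath_normD (f g : cpath) : cpath_norm (f + g) <= cpath_norm f + cpath_norm g.
Proof. exact: (supnormD itvT_neq0 (cpath_bnd f) (cpath_bnd g)). Qed.

Lemma cpath_normZ (a : R) (f : cpath) : cpath_norm (a *: f) = `|a| * cpath_norm f.
Proof. exact: (supnormZ a itvT_neq0 (cpath_bnd f)). Qed.

Lemma cpath_norm0_eq0 (f : cpath) : cpath_norm f = 0 -> f = 0.
Proof.
move=> f0; have fD x : itvT x -> f x = 0 by exact: (supnorm0_eq0 (cpath_bnd f)).
apply/val_inj/funext => x /=; rewrite -(cpathP f).1 /pext.
case: ifPn => // tx; case: ifPn => x0; first exact/fD/itvT0.
by apply: fD; rewrite /itvT/= in_itv/= leNgt tx/= ltW// ltNge.
Qed.

HB.instance Definition _ := Lmodule_isNormed.Build R cpath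
  cpath_normD cpath_normZ cpath_norm0_eq0.

(* bounded functions on [-T, 0] that are continuous on [-T, 0) *)
Definition bpath_pred : {pred R -> R} :=
  mem [set f : R -> R | [/\ pext f = f, bnd itvT (f : R -> R^o)
                          & {within itvT_open, continuous f}]].

Record bpath := BPath { bpath_val :> R -> R ; _ : bpath_val \in bpath_pred }.

HB.instance Definition _ := [isSub for bpath_val].
HB.instance Definition _ := [Choice of bpath by <:].

Lemma bpathP (f : bpath) : [/\ pext f = f, bnd itvT (f : R -> R^o)
  & {within itvT_open, continuous f}].
Proof. by case: f => f /=; rewrite inE. Qed.

Definition seminormK (K : set R) (f : R -> R) : R :=
  supnorm K (f : R -> R^o) + `|f 0|.

Definition bpath_le (M : R) : set bpath :=
  [set f | forall x, itvT x -> `|f x| <= M].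

(* A `&` bpath_le M is open in bpath_le M for the topology of the seminorms; they
   are directed, p_K <= p_K' when K `<=` K', so balls form a base. *)
Definition bpath_le_open (M : R) (A : set bpath) : Prop :=
  forall f, bpath_le M f -> A f -> exists K (e : R),
    [/\ compact K, K `<=` itvT_open, 0 < e
      & forall g, bpath_le M g -> seminormK K (g \- f) < e -> A g].

(* final topology of the inclusions of the bpath_le M *)
Definition bpath_open (A : set bpath) : Prop :=
  forall M : R, 0 < M -> bpath_le_open M A.

Lemma itvT_open_sub : itvT_open `<=` itvT.
Proof. by move=> x; rewrite /itvT_open/itvT/= !in_itv/= => /andP[-> /ltW]. Qed.

Lemma seminormK_le (K K' : set R) (f g : bpath) : K `<=` K' -> K' `<=` itvT_open ->
  seminormK K (g \- f) <= seminormK K' (g \- f).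
Proof.
move=> KK' K'd; rewrite lerD2r.
have bK : bnd K' ((g \- f : R -> R) : R -> R^o).
  have [_ [M fM] _] := bpathP f; have [_ [N gN] _] := bpathP g.
  exists (N + M) => x /K'd/itvT_open_sub Dx.
  by rewrite (le_trans (ler_normB _ _))// lerD// ?fM ?gN.
have [->|K0] := eqVneq K set0; last first.
  by apply: supnorm_le => [|x /KK' Kx]; [exact/set0P|exact: (supnorm_ub bK)].
rewrite {1}/supnorm image_set0 sup0.
have [->|/set0P[x K'x]] := eqVneq K' set0; first by rewrite /supnorm image_set0 sup0.
by rewrite (le_trans (normr_ge0 ((g \- f) x)))//; exact: (supnorm_ub bK).
Qed.

Lemma bpath_openT : bpath_open setT.
Proof.
move=> M _ f _ _; exists set0, 1; split => //; exact: compact0.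
Qed.

Lemma bpath_openI : setI_closed bpath_open.
Proof.
move=> A B oA oB M M0 f fM [Af Bf].
have [K [e [cK Kd e0 KA]]] := oA M M0 f fM Af.
have [L [d [cL Ld d0 LB]]] := oB M M0 f fM Bf.
exists (K `|` L), (Num.min e d); split.
- exact: compactU.
- by rewrite subUset.
- by rewrite lt_min e0.
- move=> g gM; rewrite lt_min => /andP[ge gd]; split.
    apply: KA => //; apply: le_lt_trans ge.
    by apply: seminormK_le; [exact: subsetUl|rewrite subUset].
  apply: LB => //; apply: le_lt_trans gd.
  by apply: seminormK_le; [exact: subsetUr|rewrite subUset].
Qed.

Lemma bpath_open_bigcup (I : Type) (A : I -> set bpath) :
  (forall i, bpath_open (A i)) -> bpath_open (\bigcup_i A i).
Proof.
move=> oA M M0 f fM [i _ Af]; have [K [e [cK Kd e0 KA]]] := oA i M M0 f fM Af.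
by exists K, e; split => // g gM ge; exists i => //; exact: KA.
Qed.

HB.instance Definition _ := isOpenTopological.Build bpath
  bpath_openT bpath_openI bpath_open_bigcup.

Lemma cpath_bpath (f : cpath) : (f : R -> R) \in bpath_pred.
Proof.
have [fe fc] := cpathP f; rewrite inE/=; split => //; first exact: cpath_bnd.
exact: continuous_subspaceW itvT_open_sub fc.
Qed.

Definition cpath_incl (f : cpath) : bpath := BPath (cpath_bpath f).

End paths.

Section horizontal.
Context {R : realType} (T : {posnum R}).

Definition hshift (f : R -> R) (e : R) : R -> R :=
  pext T (fun x => if x < 0 then f (x - e) else f 0).

(* D^H u(f) exists and equals l. The quotient needs u to be defined at the
   shifted paths, which therefore have to be elements s e of bpath T for small e;
   as f is continued by 0 on the left of -T, this means f (- T) = 0. *)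
Definition is_hderiv (u : bpath T -> R) (f : bpath T) (l : R) : Prop :=
  exists s : R -> bpath T,
    (\forall e \near 0^'+, bpath_val (s e) = hshift f e) /\
    (u f - u (s e)) / e @[e --> 0^'+] --> l.

End horizontal.
Arguments is_hderiv {R T} u f l.

Section cintegral.
Context d {X : measurableType d} {R : realType}.

(* integral against a signed measure, through its Jordan decomposition *)
Definition cintegral (nu : {charge set X -> \bar R}) (D : set X) (f : X -> R) : R :=
  let: exist P hP := cid (Hahn_decomposition nu) in
  let: exist N hPN := cid hP in
  \int[jordan_pos hPN]_(x in D) f x - \int[jordan_neg hPN]_(x in D) f x.

End cintegral.

Section charge_perp.
Context {R : realType}.

Lemma measurable_setC0 : measurable (~` [set (0 : measurableTypeR R)]). Proof. exact: measurableC. Qed.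

Definition charge_perp (nu : {charge set (measurableTypeR R) -> \bar R}) : {charge set (measurableTypeR R) -> \bar R} :=
  crestr0 nu measurable_setC0.

Lemma charge_perp0 (nu : {charge set (measurableTypeR R) -> \bar R}) : charge_perp nu [set (0 : measurableTypeR R)] = 0%E.
Proof.
by rewrite /charge_perp /= /crestr0 mem_set// /crestr setICr charge0.
Qed.

Lemma charge_perpE (nu : {charge set (measurableTypeR R) -> \bar R})
    (A : set (measurableTypeR R)) : measurable A ->
  nu A = (charge_perp nu A + nu [set (0 : measurableTypeR R)%R] * \d_(0 : measurableTypeR R)%R A)%E.
Proof.
move=> mA; rewrite /charge_perp /= /crestr0 mem_set// /crestr -setDE.
rewrite -{1}(setUIDK A [set (0 : measurableTypeR R)]) chargeU//; first last.
- by rewrite setDE setIACA setICr !setI0.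
- exact: measurableD.
- exact: measurableI.
rewrite addeC; congr (_ + _)%E; rewrite diracE.
have [A0|A0] := boolP (0 \in A).
  by rewrite mule1; congr (nu _); apply/setIidr => x; rewrite /= => ->; exact: set_mem.
rewrite mule0 -[RHS](charge0 nu); congr (nu _); rewrite -subset0 => x [+ x0]; rewrite x0.
by move/mem_set; rewrite (negbTE A0).
Qed.

End charge_perp.

Section backward.
Context {R : realType} (T : {posnum R}).

Definition is_backward_integral (g : {charge set (measurableTypeR R) -> \bar R}) (f : R -> R) (l : R) : Prop :=
  cintegral g (itvT T) (fun x => (pext T f x - pext T f (x - e)) / e) @[e --> 0^'+] --> l.

End backward.

Section quadratic_variation.
Context {R : realType} (T : {posnum R}).
Local Notation mu := (@lebesgue_measure R).

(* For x <= 0 the oriented integral from 0 to x is minus the integral over [x, 0]. *)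
Definition qvar_approx (f : R -> R) (x e : R) : R :=
  - (\int[mu]_(s in `[x, 0]) (f (s + e) - f s) ^+ 2) / e.

Definition has_qvar (f : R -> R) : Prop :=
  forall x, itvT T x -> cvg (qvar_approx f x e @[e --> 0^'+]).

Definition qvar (f : R -> R) (x : R) : R := lim (qvar_approx f x e @[e --> 0^'+]).

End quadratic_variation.

(* The Lebesgue-Stieltjes measure on [-T, 0] of a nondecreasing function F on
   [-T, 0], which need not be right-continuous. F is continued by constants, so
   that the measure has total mass F 0 - F (- T), and a jump of F at an end point
   of [-T, 0] is an atom there. *)
Section stieltjes.
Context {R : realType} (T : {posnum R}).

Definition clampT (F : R -> R) (x : R) : R := F (Num.max (- T%:num) (Num.min x 0)).

Definition right_reg (F : R -> R) (x : R) : R := inf [set clampT F y | y in `]x, +oo[].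

Definition nd_itvT (F : R -> R) : Prop :=
  forall x y, itvT T x -> itvT T y -> x <= y -> F x <= F y.

Section cumul.
Variable F : R -> R.
Hypothesis F_nd : nd_itvT F.

Let clamp_dom x : itvT T (Num.max (- T%:num) (Num.min x 0)).
Proof.
by rewrite /itvT/= in_itv/= le_max lexx/= ge_max oppr_le0 ltW//= ge_min lexx orbT.
Qed.

Lemma clamp_nd : {homo clampT F : x y / x <= y}.
Proof.
move=> x y xy; apply: F_nd => //.
rewrite ge_max !le_max lexx/=; apply/orP; right.
by rewrite le_min !ge_min xy lexx !orbT.
Qed.

Let img x : set R := [set clampT F y | y in `]x, +oo[].

Let has_inf_img x : has_inf (img x).
Proof.
split; first by exists (clampT F (x + 1)), (x + 1) => //; rewrite /= in_itv/= ltrDl ltr01.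
by exists (F (- T%:num)) => _ [y _ <-]; apply: F_nd; [exact: itvT_left|exact: clamp_dom|rewrite le_max lexx].
Qed.

Lemma right_reg_nd : {homo right_reg F : x y / x <= y}.
Proof.
move=> x y xy; apply: lb_le_inf; first exact: (has_inf_img y).1.
move=> _ [z yz <-]; apply: ge_inf; first exact: (has_inf_img x).2.
by exists z => //; move: yz; rewrite /= !in_itv/= !andbT; exact: le_lt_trans.
Qed.

Lemma right_reg_rc : right_continuous (right_reg F).
Proof.
move=> x; apply/cvgrPdist_lt => e e0.
have [_ [y xy <-] ye] := inf_adherent e0 (has_inf_img x).
move: xy; rewrite /= in_itv/= andbT => xy.
near=> z; have xz : x < z by near: z; exact: nbhs_right_gt.
have zy : z < y by near: z; exact: nbhs_right_lt.
rewrite distrC ger0_norm ?subr_ge0; last exact: right_reg_nd (ltW xz).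
rewrite ltrBlDl; apply: le_lt_trans ye; apply: ge_inf; first exact: (has_inf_img z).2.
by exists y => //=; rewrite in_itv/= andbT.
Unshelve. all: by end_near. Qed.

HB.instance Definition _ := isCumulative.Build R _ R (right_reg F)
  right_reg_nd right_reg_rc.

Definition cumul : cumulative R R := right_reg F.

End cumul.

Definition stieltjes (F : R -> R) : {measure set (measurableTypeR R) -> \bar R} :=
  match pselect (nd_itvT F) with
  | left F_nd => lebesgue_stieltjes_measure (cumul F_nd)
  | right _ => @mzero _ (measurableTypeR R) R
  end.

(* d[f]; by qvar_nd the default value of stieltjes is not taken *)
Definition dqvar (f : R -> R) : {measure set (measurableTypeR R) -> \bar R} := stieltjes (qvar f).

Lemma qvar_nd (f : cpath T) : has_qvar T f -> nd_itvT (qvar f).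
Proof.
move=> qf x y Dx Dy xy.
have fc z : - T%:num <= z -> {within `[z, 0], continuous f}.
  move=> tz; apply: continuous_subspaceW (cpathP f).2 => s.
  by rewrite /itvT/= !in_itv/= => /andP[zs ->]; rewrite (le_trans tz).
have fe z e : 0 < e -> - T%:num <= z ->
    {within `[z, 0], continuous (fun s => (f (s + e) - f s) ^+ 2)}.
  move=> e0 tz.
  suff H : {within `[z, 0], continuous (fun s => f (s + e))}.
    have sq : continuous (fun r : R => r ^+ 2) by move=> r; exact: exprn_continuous.
    apply: (@within_continuous_comp _ _ _ `[z, 0]%classic
      (fun s => f (s + e) - f s) (fun r => r ^+ 2)) => [r _|]; first exact: sq.
    by move=> s; apply: cvgB; [exact: H|exact: fc].
  pose h s := Num.min (s + e) 0.
  have hc : continuous h.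
    move=> s; apply: (@continuous_min _ _ (fun s => s + e) (cst 0)); last exact: cvg_cst.
    by apply: cvgD; [exact: cvg_id|exact: cvg_cst].
  have fh s : f (s + e) = f (h s).
    rewrite /h; case: (leP (s + e) 0) => // se.
    have -> : f (s + e) = pext T f (s + e) by rewrite (cpathP f).1.
    have tse : - T%:num <= s + e by rewrite (le_trans _ (ltW se))// oppr_le0 ltW.
    by rewrite /pext ltNge tse (ltW se).
  rewrite (_ : (fun s => f (s + e)) = f \o h); last exact/funext.
  apply/subspace_continuousP => s zs.
  have hd r : `[z, 0]%classic r -> itvT T (h r).
    rewrite /itvT/= !in_itv/= => /andP[zr r0]; rewrite ge_min lexx orbT andbT.
    rewrite le_min; apply/andP; split; last by rewrite oppr_le0 ltW.
    by rewrite (le_trans tz)// (le_trans zr)// lerDl ltW.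
  have /subspace_continuousP /(_ (h s) (hd s zs)) fhs := (cpathP f).2.
  apply: cvg_comp fhs => U; rewrite /within/= => domU.
  have {}domU : \forall r \near s, itvT T (h r) -> U (h r) by exact: hc domU.
  by apply: filterS domU => r + zr; apply; exact: hd.
have fi z e : 0 < e -> - T%:num <= z -> (@lebesgue_measure R).-integrable `[z, 0]
    (fun s => ((f (s + e) - f s) ^+ 2)%:E).
  move=> e0 tz; apply: continuous_compact_integrable; first exact: segment_compact.
  exact: fe.
have := Dx; rewrite /itvT/= in_itv/= => /andP[tx x0].
have := Dy; rewrite /itvT/= in_itv/= => /andP[ty y0].
apply: ler_lim; [exact: qf|exact: qf|].
near=> e; have e0 : 0 < e by near: e; exact: nbhs_right_gt.
rewrite /qvar_approx !mulNr lerN2 ler_pM2r ?invr_gt0// /Rintegral.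
apply: fine_le; [exact: integrable_fin_num (fi _ _ e0 ty)|exact: integrable_fin_num (fi _ _ e0 tx)|].
apply: ge0_subset_integral => //=.
- exact: measurable_int (fi _ _ e0 tx).
- by move=> s _; rewrite lee_fin sqr_ge0.
- by move=> s; rewrite /= !in_itv/= => /andP[ys ->]; rewrite (le_trans xy).
Unshelve. all: by end_near. Qed.

End stieltjes.

Lemma LfunType_integrable d (X : measurableType d) (R : realType)
    (mu : {finite_measure set X -> \bar R}) (p : \bar R) (p1 : (1 <= p)%E)
    (g : LfunType mu p1) : mu.-integrable setT (EFin \o g).
Proof.
apply/Lfun1_integrable.
apply: (@Lfun_subset _ _ _ mu 1 p) => //; first exact: fin_num_measure.
by rewrite inE; apply/andP; rewrite !inE/=; split; [exact: measurable_funPT|exact: Lfunction_finite].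
Qed.

Section chi0.
Context {R : realType} (T : {posnum R}).
Local Notation B := (measurableTypeR R).
Local Notation B2 := (measurableTypeR R * measurableTypeR R)%type.

Lemma measurable_itvT : measurable (itvT T : set B). Proof. exact: measurable_itv. Qed.

(* Lebesgue measure on [-T, 0] and on its square *)
Definition leb : set B -> \bar R := mrestr lebesgue_measure measurable_itvT.

HB.instance Definition _ := Measure.on leb.

Lemma leb_fin_num : fin_num_fun leb.
Proof.
apply: lty_fin_num_fun; rewrite -[X in (X < _)%E]/(leb setT).
have -> : leb setT = lebesgue_measure (itvT T : set B) by congr (lebesgue_measure _); exact: setTI.
rewrite /itvT lebesgue_measure_itv /=.
by case: ifP => _; rewrite -?EFinB ltry.
Qed.

HB.instance Definition _ := Measure_isFinite.Build _ _ _ leb leb_fin_num.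

Definition leb2 : set B2 -> \bar R := (leb \x leb)%E.

HB.instance Definition _ := Measure.on leb2.

Lemma leb2_fin_num : fin_num_fun leb2.
Proof.
apply: lty_fin_num_fun; rewrite -[X in (X < _)%E]/((leb \x leb)%E setT).
rewrite -setXTT product_measure1E//.
by rewrite lte_mul_pinfty// ?ltey_eq fin_num_measure.
Qed.

HB.instance Definition _ := Measure_isFinite.Build _ _ _ leb2 leb2_fin_num.

Definition L2 := LfunType leb (lee1n 2 : (1 <= (2%:R)%:E :> \bar R)%E).
Definition L2_square := LfunType leb2 (lee1n 2 : (1 <= (2%:R)%:E :> \bar R)%E).
Definition Linfty := LfunType leb (leey 1 : (1 <= +oo :> \bar R)%E).

(* Functions represent their almost everywhere classes: elements of chi0 are
   compared through chi0_dist, or through the measures chi0_charge. *)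
Record chi0 := Chi0 {
  chi0_g1 : L2_square ; chi0_lambda1 : R ;
  chi0_g2 : L2 ; chi0_lambda2 : R ;
  chi0_g3 : L2 ; chi0_lambda3 : R ;
  chi0_g4 : Linfty }.

Definition ac_charge d (X : measurableType d)
    (mu : {finite_measure set X -> \bar R}) (p : \bar R) (p1 : (1 <= p)%E)
    (g : LfunType mu p1) : {charge set X -> \bar R} :=
  induced_charge (LfunType_integrable g).

Definition cpush (h : B -> B2) (mh : measurable_fun setT h)
    (nu : {charge set B -> \bar R}) : {charge set B2 -> \bar R} :=
  measure_function_pushforward__canonical__charge_Charge nu mh.

Lemma measurable_pairx0 : measurable_fun setT (fun x : B => (x, 0 : B)).
Proof. by apply: measurable_fun_pair; [exact: measurable_id|exact: measurable_cst]. Qed.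

Lemma measurable_pair0y : measurable_fun setT (fun y : B => (0 : B, y)).
Proof. by apply: measurable_fun_pair; [exact: measurable_cst|exact: measurable_id]. Qed.

Lemma measurable_diag : measurable_fun setT (fun y : B => (y, y)).
Proof. by apply: measurable_fun_pair; exact: measurable_id. Qed.

(* g1(x,y)dxdy + lambda1 delta_0(dx)delta_0(dy) + g2(x)dx lambda2 delta_0(dy)
   + lambda3 delta_0(dx) g3(y)dy + g4(x) delta_y(dx)dy *)
Definition chi0_charge (c : chi0) : {charge set B2 -> \bar R} :=
  cadd (ac_charge (chi0_g1 c))
 (cadd (cscale (chi0_lambda1 c) (charge_of_finite_measure (\d_(0 : B, 0 : B))))
 (cadd (cscale (chi0_lambda2 c) (cpush measurable_pairx0 (ac_charge (chi0_g2 c))))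
 (cadd (cscale (chi0_lambda3 c) (cpush measurable_pair0y (ac_charge (chi0_g3 c))))
       (cpush measurable_diag (ac_charge (chi0_g4 c)))))).

Definition chi0_eq (c c' : chi0) : Prop :=
  forall A, measurable A -> chi0_charge c A = chi0_charge c' A.

(* the bilinear form (phi, psi) |-> int phi(x) psi(y) mu(dx, dy) *)
Definition chi0_form (c : chi0) (phi psi : R -> R) : R :=
  cintegral (chi0_charge c) (itvT T `*` itvT T) (fun z => phi z.1 * psi z.2).

(* norm of the difference, chi0 being the direct sum of its five components *)
Definition chi0_dist (c c' : chi0) : \bar R :=
  ('N[leb2]_2[EFin \o (fun z => chi0_g1 c z - chi0_g1 c' z)%R]
   + `|chi0_lambda1 c - chi0_lambda1 c'|%:E
   + 'N[leb]_2[EFin \o (fun x => chi0_lambda2 c * chi0_g2 c x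
                                 - chi0_lambda2 c' * chi0_g2 c' x)%R]
   + 'N[leb]_2[EFin \o (fun x => chi0_lambda3 c * chi0_g3 c x
                                 - chi0_lambda3 c' * chi0_g3 c' x)%R]
   + 'N[leb]_(+oo)[EFin \o (fun x => chi0_g4 c x - chi0_g4 c' x)%R])%E.

Definition chi0_continuous (X : topologicalType) (F : X -> chi0) : Prop :=
  forall x, chi0_dist (F y) (F x) @[y --> x] --> 0%E.

(* points of discontinuity of g as a function on [-T, 0] *)
Definition discontinuities (g : R -> R) : set R :=
  [set x | itvT T x /\ ~ {for x, continuous (g : subspace (itvT T) -> R)}].

End chi0.

(* Main.v *)
Require Import Defs.
From mathcomp Require Import all_boot all_order all_algebra.
From mathcomp Require Import all_classical all_reals all_analysis.
From mathcomp Require Import measurable_realfun ess_sup_inf lra ring.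

(* Existence of the horizontal derivative forces eta (- T) = 0, so eta, continued by
   0 and eta 0, is continuous on the line and the shifted path eta(. - e), with value
   eta 0 at 0, is uniformly close to eta. Multiplying eta(. - e) - eta by a cutoff that
   vanishes at 0 gives a continuous increment h_e which differs from it only on
   ]-d(e), 0], with d(e) so small that, by continuity of u and dominated convergence,
   u(shifted path) = U(eta + h_e) + O(e^2) and the integral of h_e against D^perp U
   changes by O(e^2). Taylor's formula then gives
     U(eta + h_e) - U(eta) = int h_e dD^perp U + 1/2 D^2 U(eta + theta h_e)(h_e, h_e).
   As h_e(0) = 0, only the components g1 and g4 of D^2 U act on h_e. Since h_e^2 dx / e
   has bounded mass and D^2 U is continuous into chi0, eta + theta h_e can be replaced
   by eta at the cost of o(e). The functions h_e / sqrt e are bounded in L^2 and tend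
   weakly to 0 (their integrals over intervals are O(sqrt e)), hence so do their tensor
   squares, and the g1-term is o(e). The measures h_e^2 dx / e converge weakly to
   d[eta], also against g4, which is continuous d[eta]-almost everywhere. *)

(** Two obstacles shape the proof. First, [U] is differentiable only on continuous paths. The
    shifted path jumps at 0, and there [u] is merely continuous, for a topology whose neighbourhoods
    are controlled only among paths with a common bound. The cutoff suits this: eta + h_e is
    pointwise a convex combination of eta and its shift, so it keeps the bound of eta, and it agrees
    with the shifted path at 0 and on any prescribed compact subset of [-T, 0[ once d(e) is small.
    Since h_e(0) = 0, the first-order term sees only the part of the derivative without mass at 0.
    The tolerance e^2 stands for any o(e), as everything is divided by e at the end. Secondly, [eta]
    may jump and need not be right-continuous, so its Stieltjes measure does not determine its
    values, whereas the limits of the integrals of h_e^2 / e over intervals are these values. The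
    test functions must therefore weigh atoms partially. Existence of the backward integral is a
    conclusion: its quotient is compared with a quantity already known to converge. *)

Set Implicit Arguments.
Unset Strict Implicit.
Unset Printing Implicit Defensive.
Import Order.TTheory GRing.Theory Num.Theory.
Import numFieldNormedType.Exports.
Local Open Scope classical_set_scope.
Local Open Scope ring_scope.

(** * Integration against charges *)

Section bounded_measurable.
Context d (X : measurableType d) (R : realType).
Implicit Types (f g : X -> R) (nu : {charge set X -> \bar R}).

(** Such functions are integrable for every finite measure, hence for both parts of any Jordan
    decomposition, which makes integration against a charge linear on them. *)
Definition bmeas f := measurable_fun setT f /\ exists M : R, forall x, `|f x| <= M.

Lemma bmeas_cst (c : R) : bmeas (fun=> c).
Proof. by split; [exact: measurable_cst|exists `|c|]. Qed.

Lemma bmeas_indic (A : set X) : measurable A -> bmeas (\1_A : X -> R).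
Proof.
move=> mA; split; first exact: measurable_indic.
by exists 1 => x; rewrite indicE; case: (x \in A); rewrite ?normr1 ?normr0.
Qed.

Lemma bmeasD f g : bmeas f -> bmeas g -> bmeas (fun x => f x + g x).
Proof.
move=> [mf [M fM]] [mg [N gN]]; split; first exact: measurable_funD.
by exists (M + N) => x; rewrite (le_trans (ler_normD _ _))// lerD.
Qed.

Lemma bmeasM f g : bmeas f -> bmeas g -> bmeas (fun x => f x * g x).
Proof.
move=> [mf [M fM]] [mg [N gN]]; split; first exact: measurable_funM.
by exists (M * N) => x; rewrite normrM ler_pM.
Qed.

Lemma bmeasZ (a : R) f : bmeas f -> bmeas (fun x => a * f x).
Proof. by move=> bf; exact: bmeasM (bmeas_cst a) bf. Qed.

Lemma bmeasB f g : bmeas f -> bmeas g -> bmeas (fun x => f x - g x).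
Proof.
move=> bf bg; rewrite (_ : (fun _ => _) = (fun x => f x + (-1) * g x)).
  exact: bmeasD bf (bmeasZ _ bg).
by apply/funext => x; rewrite mulN1r.
Qed.

Lemma bmeas_sum n (F : nat -> X -> R) :
  (forall k, (k < n)%N -> bmeas (F k)) -> bmeas (fun x => \sum_(k < n) F k x).
Proof.
elim: n F => [|n ih] F bF.
  rewrite (_ : (fun _ => _) = (fun=> 0)); first exact: bmeas_cst.
  by apply/funext => x; rewrite big_ord0.
under [fun x => _]eq_fun do rewrite big_ord_recr/=.
apply: bmeasD; last exact: bF.
by apply: ih => k kn; apply: bF; rewrite ltnW.
Qed.

Lemma bmeas_restrict (D : set X) f : measurable D -> bmeas f -> bmeas (f \_ D).
Proof.
move=> mD bf; rewrite (_ : f \_ D = (fun x => f x * \1_D x)).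
  exact: bmeasM bf (bmeas_indic mD).
apply/funext => x; rewrite /patch indicE.
by case: (x \in D); rewrite ?mulr1 ?mulr0.
Qed.

Lemma bmeas_integrable (m : {finite_measure set X -> \bar R}) (D : set X) f :
  measurable D -> bmeas f -> m.-integrable D (EFin \o f).
Proof.
move=> mD [mf [M fM]]; apply: measurable_bounded_integrable => //.
- by rewrite ltey_eq fin_num_measure.
- exact: measurable_funTS.
- by exists M; split; [exact: num_real|move=> y My x _ /=; rewrite (le_trans (fM x))// ltW].
Qed.

(** The sum counts the integers among 1, ..., n that do not exceed w, so it is the integer part of
    w. *)
Lemma layer_cake_dist n (w : R) : 0 <= w -> w <= n%:R ->
  `|w - \sum_(k < n) (k.+1%:R <= w)%R%:R| <= 1.
Proof.
move=> w0; elim: n => [|n ih] wn.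
  by rewrite big_ord0 subr0 (_ : w = 0) ?normr0//; apply/eqP; rewrite eq_le w0 wn.
rewrite big_ord_recr/=; have [wn'|nw] := leP w n%:R.
  rewrite (_ : (n.+1%:R <= w) = false) ?addr0 ?ih//; apply/negbTE.
  by rewrite -ltNge (le_lt_trans wn')// ltr_nat.
rewrite (eq_bigr (fun=> 1)); last first.
  by move=> k _; rewrite (_ : (_ <= w))// (le_trans _ (ltW nw))// ler_nat.
rewrite sumr_const card_ord; case: (n.+1%:R <= w).
  by rewrite natr1 distrC ger0_norm ?subr_ge0// lerBlDr -natr1 addrC lerD2l ltW.
by rewrite addr0 ger0_norm ?subr_ge0 ?(ltW nw)// lerBlDr addrC natr1.
Qed.

(* Superlevel sets approximate: a function with values in [0, 1] is within 1/n of
   n^-1 times the sum of the indicators of f >= (k + 1) / n for k < n. *)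
Lemma bmeas_ind (P : (X -> R) -> Prop) :
  (forall A, measurable A -> P \1_A) ->
  (forall (a : R) f g, bmeas f -> bmeas g -> P f -> P g -> P (fun x => a * f x + g x)) ->
  (forall f, bmeas f -> (forall e : R, 0 < e ->
     exists g, [/\ bmeas g, P g & forall x, `|f x - g x| <= e]) -> P f) ->
  forall f, bmeas f -> P f.
Proof.
move=> PI PD PL f bf.
have P0 : P (fun=> 0).
  rewrite (_ : (fun=> 0) = \1_set0 :> (X -> R)); first exact: PI.
  by apply/funext => x; rewrite indic0.
have P1 : P (fun=> 1).
  rewrite (_ : (fun=> 1) = \1_setT :> (X -> R)); first exact: PI.
  by apply/funext => x; rewrite indicT.
have H g : bmeas g -> (forall x, 0 <= g x <= 1) -> P g.
  move=> bg g01; apply: PL => // e e0.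
  pose n := (Num.truncn e^-1).+1.
  have n0 : 0 < n%:R :> R by rewrite ltr0n.
  have ne : n%:R^-1 <= e.
    by rewrite -[leRHS]invrK lef_pV2 ?posrE ?invr_gt0// ltW// truncnS_gt// invr_ge0 ltW.
  pose A k := g @^-1` `[k.+1%:R / n%:R, +oo[.
  have mA k : measurable (A k).
    by rewrite -[A k]setTI; apply: bg.1 => //; exact: measurable_itv.
  pose S (m : nat) x : R := \sum_(k < m) n%:R^-1 * \1_(A k) x.
  have bS m : bmeas (S m).
    apply: (@bmeas_sum m (fun k x => n%:R^-1 * \1_(A k) x)) => k _.
    by apply: bmeasZ; exact: bmeas_indic.
  have PS m : P (S m).
    elim: m => [|m ih].
      by rewrite (_ : S 0 = fun=> 0)//; apply/funext => x; rewrite /S big_ord0.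
    rewrite (_ : S m.+1 = (fun x => n%:R^-1 * \1_(A m) x + S m x)).
      by apply: PD => //; [exact: bmeas_indic|exact: PI].
    by apply/funext => x; rewrite /S big_ord_recr addrC.
  exists (S n); split => // x; apply: le_trans ne.
  rewrite -[leRHS]mulr1 ler_pdivlMl//.
  have /andP[g0 g1] := g01 x.
  have ng1 : n%:R * g x <= n%:R by rewrite -[leRHS]mulr1 ler_pM2l.
  have := layer_cake_dist (mulr_ge0 (ltW n0) g0) ng1.
  rewrite -{3}(gtr0_norm n0) -normrM mulrBr /S -mulr_sumr mulVKf ?gt_eqF//.
  congr (`|_ - _| <= _); apply: eq_bigr => k _.
  rewrite indicE /A; congr (_%:R); congr nat_of_bool.
  apply/idP/idP; rewrite ?inE/= in_itv/= andbT ler_pdivrMr// mulrC//.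
have [mf [M fM]] := bf.
pose N := Num.max M 1.
have N0 : 0 < N by rewrite lt_max ltr01 orbT.
have fN x : `|f x| <= N by rewrite le_max fM.
pose g x := (f x + N) / (2 * N).
have bg : bmeas g.
  rewrite (_ : g = fun x => (2 * N)^-1 * (f x + (fun=> N) x)).
    by apply: bmeasZ; apply: bmeasD => //; exact: bmeas_cst.
  by apply/funext => x; rewrite /g mulrC.
have Pg : P g.
  apply: H => // x; have := fN x; rewrite ler_norml => /andP[fN1 fN2].
  rewrite /g ler_pdivlMr ?mulr_gt0// mul0r ler_pdivrMr ?mulr_gt0// mul1r.
  by apply/andP; split; lra.
rewrite (_ : f = fun x => (2 * N) * g x + ((- N) * (fun=> 1) x + (fun=> 0) x)).
  apply: (PD) => //.
    by apply: bmeasD; [apply: bmeasZ|]; exact: bmeas_cst.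
  by apply: (PD) => //; exact: bmeas_cst.
apply/funext => x; rewrite /g mulrC divfK ?gt_eqF ?mulr_gt0//; lra.
Qed.

Definition bounded_linear (L : (X -> R) -> R) :=
  (forall (a : R) f g, bmeas f -> bmeas g ->
     L (fun x => a * f x + g x) = a * L f + L g) /\
  (exists C : R, forall f (M : R), bmeas f -> (forall x, `|f x| <= M) ->
     `|L f| <= C * M).

(* Additivity, scaling, push-forward and restriction of [cintegral] all reduce to a
   comparison on indicators, whatever Hahn decompositions are chosen. *)
Lemma bounded_linear_eq (L1 L2 : (X -> R) -> R) :
  bounded_linear L1 -> bounded_linear L2 ->
  (forall A, measurable A -> L1 \1_A = L2 \1_A) ->
  forall f, bmeas f -> L1 f = L2 f.
Proof.
move=> [L1l [C1 L1b]] [L2l [C2 L2b]] L12.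
apply: bmeas_ind => //.
  by move=> a f g bf bg fL gL; rewrite L1l// L2l// fL gL.
move=> f bf fP; apply/eqP; rewrite -subr_eq0 -normr_le0; apply/ler_addgt0Pr => e e0.
rewrite add0r.
(* The maximum with 1 gives a positive divisor, as nothing is known about the sign of C1 + C2. *)
pose C := Num.max 1 (C1 + C2).
have C0 : 0 < C by rewrite lt_max ltr01.
have [g [bg gL fg]] := fP (e / C) (divr_gt0 e0 C0).
have Lfg L : bounded_linear L -> L f = L (fun x => f x - g x) + L g.
  move=> [Ll _]; have := Ll 1 (fun x => f x - g x) g (bmeasB bf bg) bg.
  by rewrite mul1r => <-; congr (L _); apply/funext => x; rewrite mul1r subrK.
rewrite (Lfg L1)//; last by split => //; exists C1.
rewrite (Lfg L2)//; last by split => //; exists C2.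
rewrite gL opprD addrACA subrr addr0 (le_trans (ler_normB _ _))//.
rewrite (le_trans (lerD (L1b _ _ (bmeasB bf bg) fg) (L2b _ _ (bmeasB bf bg) fg)))//.
rewrite -mulrDl mulrCA -[leRHS]mulr1 ler_pM2l// ler_pdivrMr// mul1r.
by rewrite le_max lexx orbT.
Qed.

Lemma Rintegral_bounded_linear (m : {finite_measure set X -> \bar R}) (D : set X) :
  measurable D -> bounded_linear (fun f => \int[m]_(x in D) f x).
Proof.
move=> mD; split.
  move=> a f g bf bg; rewrite RintegralD//; first last.
  - exact: bmeas_integrable.
  - exact: bmeas_integrable (bmeasZ _ bf).
  by rewrite RintegralZl//; exact: bmeas_integrable.
exists (fine (m D)) => f M bf fM.
rewrite (le_trans (le_normr_Rintegral _ _))//; first exact: bmeas_integrable.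
rewrite mulrC -Rintegral_cst//; apply: le_Rintegral => //.
  by apply: (@bmeas_integrable m D (fun x => `|f x|)) => //; case: bf => mf [N fN]; split;
    [exact: measurableT_comp|exists N => x; rewrite normr_id].
by apply: (@bmeas_integrable m D (fun=> M)) => //; exact: bmeas_cst.
Qed.

Lemma bounded_linearB (L1 L2 : (X -> R) -> R) :
  bounded_linear L1 -> bounded_linear L2 -> bounded_linear (fun f => L1 f - L2 f).
Proof.
move=> [L1l [C1 L1b]] [L2l [C2 L2b]]; split.
  by move=> a f g bf bg; rewrite L1l// L2l//; lra.
exists (C1 + C2) => f M bf fM.
by rewrite (le_trans (ler_normB _ _))// mulrDl lerD ?L1b ?L2b.
Qed.

Lemma bounded_linearD (L1 L2 : (X -> R) -> R) :
  bounded_linear L1 -> bounded_linear L2 -> bounded_linear (fun f => L1 f + L2 f).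
Proof.
move=> [L1l [C1 L1b]] [L2l [C2 L2b]]; split.
  by move=> a f g bf bg; rewrite L1l// L2l//; lra.
exists (C1 + C2) => f M bf fM.
by rewrite (le_trans (ler_normD _ _))// mulrDl lerD ?L1b ?L2b.
Qed.

Lemma bounded_linearZ (c : R) (L : (X -> R) -> R) :
  bounded_linear L -> bounded_linear (fun f => c * L f).
Proof.
move=> [Ll [C Lb]]; split.
  by move=> a f g bf bg; rewrite Ll//; lra.
exists (`|c| * C) => f M bf fM.
by rewrite normrM -mulrA ler_wpM2l// Lb.
Qed.

(** This forgets the chosen Hahn decomposition: later arguments use only that the charge is a
    difference of two finite measures. *)
Lemma cintegralE nu : exists m1 m2 : {finite_measure set X -> \bar R},
  (forall A, measurable A -> nu A = m1 A - m2 A)%E /\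
  (forall (D : set X) f, cintegral nu D f = \int[m1]_(x in D) f x - \int[m2]_(x in D) f x).
Proof.
(* The equation is quantified over the proof [hP] so that the nested choice [cid hP] can be
   destructed afterwards; proof irrelevance allows it. *)
have [P hP hPc] : exists2 P, exists N, hahn_decomposition nu P N &
    forall (hP : exists N, hahn_decomposition nu P N), cid (Hahn_decomposition nu) = exist _ P hP.
  case E : (cid (Hahn_decomposition nu)) => [P hP].
  exists P => // hP'; by rewrite (Prop_irrelevance hP' hP).
case E : (cid hP) => [N hPN].
exists (jordan_pos hPN), (jordan_neg hPN); split.
  by move=> A mA; rewrite (jordan_decomp hPN mA) /cadd/= cscaleN1.
by move=> D f; rewrite /cintegral (hPc hP) E.
Qed.

Lemma cintegral_bounded_linear nu (D : set X) : measurable D ->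
  bounded_linear (cintegral nu D).
Proof.
move=> mD; have [m1 [m2 [_ E]]] := cintegralE nu.
rewrite (_ : cintegral nu D = fun f => \int[m1]_(x in D) f x - \int[m2]_(x in D) f x).
  by apply: bounded_linearB; exact: Rintegral_bounded_linear.
by apply/funext => f; rewrite E.
Qed.

Lemma cintegral_indic nu (D A : set X) : measurable D -> measurable A ->
  cintegral nu D (\1_A) = fine (nu (A `&` D)).
Proof.
move=> mD mA; have [m1 [m2 [nuE E]]] := cintegralE nu.
rewrite E nuE; last exact: measurableI.
rewrite fineB ?fin_num_measure//; try exact: measurableI.
by congr (_ - _); rewrite /Rintegral integral_indic.
Qed.

Lemma cintegral_unique nu (D : set X) (L : (X -> R) -> R) : measurable D ->
  bounded_linear L ->
  (forall A, measurable A -> L \1_A = fine (nu (A `&` D))) ->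
  forall f, bmeas f -> cintegral nu D f = L f.
Proof.
move=> mD bL LI; apply: bounded_linear_eq => //; first exact: cintegral_bounded_linear.
by move=> A mA; rewrite cintegral_indic// LI.
Qed.

Lemma cintegral_restrict nu (D : set X) f : cintegral nu D f = cintegral nu setT (f \_ D).
Proof.
have [m1 [m2 [nuE E]]] := cintegralE nu.
by rewrite !E 2!(Rintegral_mkcond _ D).
Qed.

Lemma cintegral_cadd nu1 nu2 (D : set X) f : measurable D -> bmeas f ->
  cintegral (cadd nu1 nu2) D f = cintegral nu1 D f + cintegral nu2 D f.
Proof.
move=> mD; apply: (cintegral_unique (L := fun f => cintegral nu1 D f + cintegral nu2 D f)) => //.
  by apply: bounded_linearD; exact: cintegral_bounded_linear.
move=> A mA; rewrite !cintegral_indic// /cadd/= fineD// fin_num_measure//; exact: measurableI.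
Qed.

Lemma cintegral_cscale (c : R) nu (D : set X) f : measurable D -> bmeas f ->
  cintegral (cscale c nu) D f = c * cintegral nu D f.
Proof.
move=> mD; apply: (cintegral_unique (L := fun f => c * cintegral nu D f)) => //.
  by apply: bounded_linearZ; exact: cintegral_bounded_linear.
move=> A mA; rewrite !cintegral_indic// /cscale/= fineM// fin_num_measure//; exact: measurableI.
Qed.

Lemma cintegral_setI nu (D A : set X) f : measurable D -> measurable A -> bmeas f ->
  (forall x, D x -> ~ A x -> f x = 0) ->
  cintegral nu (D `&` A) f = cintegral nu D f.
Proof.
move=> mD mA bf f0; rewrite cintegral_restrict [RHS]cintegral_restrict.
congr (cintegral nu _ _); apply/funext => x; rewrite /patch.
have [|xDA] := boolP (x \in D `&` A).
  by rewrite in_setI => /andP[-> _].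
case: ifPn => // xD; apply/esym/f0; first exact/set_mem.
by move=> Ax; move/negP: xDA; apply; rewrite in_setI xD; exact/mem_set.
Qed.

Lemma integrable_bmeasM (m : {measure set X -> \bar R}) (D : set X) (g h : X -> R) :
  measurable D -> m.-integrable D (EFin \o g) -> bmeas h ->
  m.-integrable D (EFin \o (fun x => g x * h x)).
Proof.
move=> mD ig [mh [M hM]]; have mg := measurable_int _ ig.
apply: (@le_integrable _ _ _ m _ mD _ (fun x => M%:E * (EFin \o g) x)%E).
- by apply/measurable_EFinP; apply: measurable_funM; [exact/measurable_EFinP|exact: measurable_funTS].
- move=> x _; rewrite /= lee_fin !normrM mulrC ler_wpM2r//.
  by rewrite (le_trans (hM x))// ler_norm.
- exact: integrableZl.
Qed.

Lemma cintegral_induced_charge (m : {finite_measure set X -> \bar R}) (g : X -> R)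
    (ig : m.-integrable setT (EFin \o g)) (D : set X) f :
  measurable D -> bmeas f ->
  cintegral (induced_charge ig) D f = \int[m]_(x in D) (g x * f x).
Proof.
move=> mD.
have igf (h : X -> R) : bmeas h -> m.-integrable D (EFin \o (fun x => g x * h x)).
  by apply: integrable_bmeasM => //; exact: integrableS ig.
apply: (cintegral_unique (L := fun f => \int[m]_(x in D) (g x * f x))) => //.
  split.
    move=> a k h bf bh; rewrite -RintegralZl//; last exact: igf.
    rewrite -RintegralD//; last 2 first.
    - rewrite (_ : _ \o _ = EFin \o (fun x => g x * (a * k x))).
        exact: igf (bmeasZ _ bf).
      by apply/funext => x /=; rewrite mulrCA.
    - exact: igf.
    by apply: eq_Rintegral => x _; rewrite mulrDr mulrCA.
  exists (\int[m]_(x in D) `|g x|) => k M bf fM.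
  rewrite (le_trans (le_normr_Rintegral _ _))//; first exact: igf.
  have ing : m.-integrable D (EFin \o (fun x => `|g x|)).
    by apply: (integrable_norm (f := g)); exact: integrableS ig.
  rewrite mulrC -RintegralZl//; apply: le_Rintegral => //.
  - by apply: (integrable_norm (f := fun x => g x * k x)); exact: igf.
  - exact: (integrableZl mD M ing).
  - by move=> x _; rewrite normrM mulrC ler_wpM2r.
move=> A mA; rewrite /induced_charge /Rintegral; congr fine.
rewrite [RHS]integral_mkcond [LHS]integral_mkcond; apply: eq_integral => x _.
rewrite /patch in_setI indicE.
by case: (x \in D); case: (x \in A); rewrite ?mulr1 ?mulr0.
Qed.

Lemma cintegral_finite_measure (m : {finite_measure set X -> \bar R}) (D : set X) f :
  measurable D -> bmeas f ->
  cintegral (charge_of_finite_measure m) D f = \int[m]_(x in D) f x.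
Proof.
move=> mD; apply: (cintegral_unique (L := fun f => \int[m]_(x in D) f x)) => //.
  exact: Rintegral_bounded_linear.
by move=> A mA; rewrite /Rintegral integral_indic.
Qed.

End bounded_measurable.

Lemma bmeas_comp d d' (X : measurableType d) (Y : measurableType d') (R : realType)
    (h : X -> Y) (f : Y -> R) :
  measurable_fun setT h -> bmeas f -> bmeas (f \o h).
Proof.
by move=> mh [mf [M fM]]; split; [exact: measurableT_comp|exists M => x; exact: fM].
Qed.

Section charges_on_R.
Context (R : realType).
Local Notation B := (measurableTypeR R).
Local Notation B2 := (measurableTypeR R * measurableTypeR R)%type.

Lemma cintegral_cpush (h : B -> B2) (mh : measurable_fun setT h)
    (nu : {charge set B -> \bar R}) (D : set B2) (f : B2 -> R) :
  measurable D -> bmeas f ->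
  cintegral (cpush mh nu) D f = cintegral nu (h @^-1` D) (f \o h).
Proof.
move=> mD.
have mhD : measurable (h @^-1` D) by rewrite -[X in measurable X]setTI; exact: mh.
apply: (cintegral_unique (L := fun f => cintegral nu (h @^-1` D) (f \o h))) => //.
  have [Ll [C Lb]] := cintegral_bounded_linear nu mhD; split.
    by move=> a k g bk bg; rewrite -Ll//; exact: bmeas_comp.
  exists C => k M bk kM; apply: Lb; [exact: bmeas_comp|move=> x; exact: kM].
move=> A mA; rewrite (_ : \1_A \o h = \1_(h @^-1` A))// cintegral_indic//.
by rewrite -[X in measurable X]setTI; exact: mh.
Qed.

Lemma cintegral_charge_perp (nu : {charge set B -> \bar R}) (D : set B) (f : B -> R) :
  measurable D -> bmeas f ->
  cintegral (charge_perp nu) D f = cintegral nu (D `&` ~` [set 0]) f.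
Proof.
move=> mD; have m0 := @measurable_setC0 R.
have mD0 : measurable (D `&` ~` [set (0 : B)]) by exact: measurableI.
apply: (cintegral_unique (L := cintegral nu (D `&` ~` [set 0]))) => //.
  exact: cintegral_bounded_linear.
move=> A mA; rewrite cintegral_indic//.
by rewrite /charge_perp /= /crestr0 mem_set ?setIA//; exact: measurableI.
Qed.

End charges_on_R.

(** * The bilinear form of an element of chi0 *)

Section chi0_form.
Context (R : realType) (T : {posnum R}).
Local Notation B := (measurableTypeR R).
Local Notation B2 := (measurableTypeR R * measurableTypeR R)%type.

Lemma chi0_form_diag (c : chi0 T) (h : B -> R) : bmeas h -> h 0 = 0 ->
  (forall x, ~ itvT T x -> h x = 0) ->
  chi0_form c h h = \int[leb2 T]_z (chi0_g1 c z * (h z.1 * h z.2))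
                  + \int[leb T]_x (chi0_g4 c x * h x ^+ 2).
Proof.
move=> bh h0 hT.
have mT : measurable (itvT T : set B) by exact: measurable_itvT.
have mTT : measurable (itvT T `*` itvT T : set B2) by exact: measurableX.
have bhh : bmeas (fun z : B2 => h z.1 * h z.2).
  apply: (@bmeasM _ _ _ (h \o fst) (h \o snd)); exact: bmeas_comp.
have null (D : set B) nu (f : B -> R) : (forall x, f x = 0) -> cintegral nu D f = 0.
  move=> f0; have [m1 [m2 [_ ->]]] := cintegralE nu.
  rewrite (_ : f = fun=> 0); last exact/funext.
  by rewrite /Rintegral !integral0 subrr.
rewrite /chi0_form /chi0_charge.
do 4 (rewrite cintegral_cadd//). 
rewrite !cintegral_cscale//.
rewrite !cintegral_cpush//.
(* Along either axis one of the two factors is [h 0], so the mixed terms integrate the zero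
   function. *)
rewrite [cintegral _ _ (_ \o (fun x => (x, 0)))]null; last by move=> x /=; rewrite h0 mulr0.
rewrite [cintegral _ _ (_ \o (fun y => (0, y)))]null; last by move=> x /=; rewrite h0 mul0r.
rewrite (cintegral_finite_measure \d_(0 : B, 0 : B))//.
rewrite {1}/Rintegral integral_dirac//; last first.
  by apply/measurable_EFinP; apply: measurable_funTS; exact: bhh.1.
have hh0 : h 0 * h 0 = 0 by rewrite h0 mulr0.
rewrite [X in (_ * X%:E)%E](_ : _ = 0); last exact: hh0.
rewrite mule0 /= !mulr0 !add0r.
have md := @measurable_diag R.
rewrite /ac_charge !cintegral_induced_charge//; last 2 first.
- by rewrite -[X in measurable X]setTI; exact: md.
- exact: bmeas_comp.
congr (_ + _).
  rewrite Rintegral_mkcond; apply: eq_Rintegral => z _; rewrite /patch.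
  case: ifPn => // /negP zT.
  have [z1|z1] := pselect (itvT T z.1); last by rewrite (hT z.1)// mul0r mulr0.
  have [z2|z2] := pselect (itvT T z.2); last by rewrite (hT z.2)// !mulr0.
  by exfalso; apply: zT; rewrite inE.
rewrite Rintegral_mkcond; apply: eq_Rintegral => x _; rewrite /patch.
case: ifPn => // /negP xT.
have [xd|xd] := pselect (itvT T x); last by rewrite (hT x)// expr0n mulr0.
by exfalso; apply: xT; rewrite inE.
Qed.

Lemma leb_Rintegral (f : B -> R) (D : set B) : D `<=` itvT T -> measurable D ->
  \int[leb T]_(x in D) f x = \int[@lebesgue_measure R]_(x in D) f x.
Proof.
move=> DT mD; congr fine; apply: eq_measure_integral => A mA AD.
by rewrite /leb /mrestr; congr (lebesgue_measure _); apply/setIidl; exact: subset_trans DT.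
Qed.

Lemma leb_Rintegral_itvT (f : B -> R) : measurable_fun setT f ->
  \int[leb T]_x f x = \int[leb T]_(x in itvT T) f x.
Proof.
move=> mf; rewrite [RHS]Rintegral_mkcond /Rintegral; congr fine.
have mT := @measurable_itvT R T.
apply: ae_eq_integral => //.
- exact/measurable_EFinP.
- by apply/measurable_EFinP; apply/(measurable_restrictT _ mT); exact: measurable_funTS.
exists (~` (itvT T : set B)); split; first exact: measurableC.
  by rewrite -[LHS]/(@lebesgue_measure R (~` itvT T `&` itvT T)) setICl measure0.
by move=> x /= nx xT; apply: nx => _; rewrite patchT// inE.
Qed.

End chi0_form.

(** * Weak convergence in L^2 *)

Section real_dominated_convergence.
Context d (X : measurableType d) (R : realType) (m : {measure set X -> \bar R}).

Lemma Rintegral_dominated_cvg (D : set X) (f_ : nat -> X -> R) (f g : X -> R) :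
  measurable D -> (forall n, measurable_fun D (f_ n)) -> measurable_fun D f ->
  {ae m, forall x, D x -> f_ n x @[n --> \oo] --> f x} ->
  m.-integrable D (EFin \o g) -> (forall n x, D x -> `|f_ n x| <= g x) ->
  (\int[m]_(x in D) f_ n x) @[n --> \oo] --> \int[m]_(x in D) f x.
Proof.
move=> mD mf_ mf cf ig fg.
have [] := @dominated_convergence _ _ _ m D mD (fun n => EFin \o f_ n) (EFin \o f) (EFin \o g).
- by move=> n; exact/measurable_EFinP.
- exact/measurable_EFinP.
- apply: filterS cf => x cx Dx; apply: cvg_EFin; [exact: nearW|exact: cx].
- exact: ig.
- by apply: aeW => x n Dx; rewrite /= lee_fin fg.
move=> If _ cI; rewrite /Rintegral; apply: fine_cvg.
by rewrite fineK// integrable_fin_num.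
Qed.

End real_dominated_convergence.

Section square_integrable.
Context d (X : measurableType d) (R : realType) (m : {finite_measure set X -> \bar R}).
Implicit Types (f g w : X -> R).

Definition sqint f := measurable_fun setT f /\
  m.-integrable setT (EFin \o (fun x => f x ^+ 2)).

Lemma bmeas_sqint f : bmeas f -> sqint f.
Proof.
move=> bf; split; first exact: bf.1.
by apply: bmeas_integrable => //; exact: (bmeasM bf bf).
Qed.

(** The free weight L is what turns this pointwise bound into a Cauchy-Schwarz inequality after
    integration. *)
Lemma amgm (L a b : R) : 0 < L -> `|a * b| <= L * a ^+ 2 + L^-1 * b ^+ 2.
Proof.
move=> L0; have H s : 0 <= (L * a + s * b) ^+ 2 by exact: sqr_ge0.
have Li : 0 < L^-1 by rewrite invr_gt0.
have E s : s ^+ 2 = 1 -> L * a ^+ 2 + L^-1 * b ^+ 2 + 2 * s * (a * b) = L^-1 * (L * a + s * b) ^+ 2.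
  by move=> s1; rewrite sqrrD !exprMn s1; field; rewrite gt_eqF.
have H1 : 0 <= L * a ^+ 2 + L^-1 * b ^+ 2 + 2 * 1 * (a * b).
  by rewrite E ?expr1n// mulr_ge0// ?sqr_ge0// ltW.
have H2 : 0 <= L * a ^+ 2 + L^-1 * b ^+ 2 + 2 * (-1) * (a * b).
  by rewrite E ?sqrrN ?expr1n// mulr_ge0// ?sqr_ge0// ltW.
have p1 : 0 <= L * a ^+ 2 by rewrite mulr_ge0 ?sqr_ge0 ?ltW.
have p2 : 0 <= L^-1 * b ^+ 2 by rewrite mulr_ge0 ?sqr_ge0 ?ltW.
rewrite ler_norml; apply/andP; split; lra.
Qed.

Lemma sqint_mul_integrable f g : sqint f -> sqint g ->
  m.-integrable setT (EFin \o (fun x => f x * g x)).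
Proof.
move=> [mf sf] [mg sg].
have := integrableD measurableT sf sg.
apply: le_integrable => //; first by apply/measurable_EFinP; exact: measurable_funM.
move=> x _; rewrite /= lee_fin [leRHS]ger0_norm ?addr_ge0 ?sqr_ge0//.
by have := @amgm 1 (f x) (g x) ltr01; rewrite invr1 !mul1r.
Qed.

Lemma sqintZD (a : R) f g : sqint f -> sqint g -> sqint (fun x => a * f x + g x).
Proof.
move=> sf sg; have [mf iff] := sf; have [mg ig] := sg; split.
  by apply: measurable_funD => //; exact: measurable_funM.
have ifg := sqint_mul_integrable sf sg.
have := integrableD measurableT (integrableZl measurableT (a ^+ 2) iff)
  (integrableD measurableT (integrableZl measurableT (2 * a) ifg) ig).
rewrite [X in integrable _ _ X -> _](_ : _ = EFin \o (fun x => (a * f x + g x) ^+ 2))//.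
apply/funext => x /=; rewrite -!EFinM -!EFinD; congr (_%:E); ring.
Qed.

Lemma sqintB f g : sqint f -> sqint g -> sqint (fun x => f x - g x).
Proof.
move=> sf sg; have := sqintZD (-1) sg sf.
by rewrite (_ : (fun x => -1 * g x + f x) = (fun x => f x - g x))//; apply/funext => x; ring.
Qed.

(** In [amgm] the weight L = b / a makes both integrated terms equal to a * b; the constant 2
    instead of 1 is harmless for limits. *)
Lemma cauchy_schwarz2 f w (a b : R) : sqint f -> sqint w -> 0 < a -> 0 < b ->
  \int[m]_x (f x ^+ 2) <= a ^+ 2 -> \int[m]_x (w x ^+ 2) <= b ^+ 2 ->
  `|\int[m]_x (f x * w x)| <= 2 * a * b.
Proof.
move=> sf sw a0 b0 fa wb; pose L := b / a; have L0 : 0 < L by rewrite divr_gt0.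
have ifw := sqint_mul_integrable sf sw.
have [mf iff] := sf; have [mw iww] := sw.
rewrite (le_trans (le_normr_Rintegral _ _))//.
have i1 := integrableZl measurableT L iff.
have i2 := integrableZl measurableT L^-1 iww.
rewrite (@le_trans _ _ (\int[m]_x (L * f x ^+ 2 + L^-1 * w x ^+ 2)))//.
  apply: le_Rintegral => //; first exact: (integrable_norm ifw).
    exact: (integrableD measurableT i1 i2).
  by move=> x _; exact: amgm.
rewrite RintegralD// !RintegralZl//.
rewrite (@le_trans _ _ (L * a ^+ 2 + L^-1 * b ^+ 2))//.
  by rewrite lerD// ler_wpM2l// ?invr_ge0 ltW.
by rewrite le_eqVlt; apply/orP; left; apply/eqP; rewrite /L; field; rewrite !gt_eqF.
Qed.

End square_integrable.

Section weak_convergence.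
Context d (X : measurableType d) (R : realType) (m : {finite_measure set X -> \bar R}).
Context (J : Type) (F : set_system J) {FF : ProperFilter F} (w : J -> X -> R) (C : R).
Hypothesis C0 : 0 < C.
Hypothesis bw : forall i, bmeas (w i).
Hypothesis wC : \forall i \near F, \int[m]_x (w i x ^+ 2) <= C ^+ 2.

Let good (f : X -> R) := \int[m]_x (f x * w i x) @[i --> F] --> (0 : R).

Let good_lin (a : R) f g : sqint m f -> sqint m g -> good f -> good g ->
  good (fun x => a * f x + g x).
Proof.
move=> sf sg gf gg; rewrite /good.
rewrite (_ : (fun i => _) = (fun i => a * \int[m]_x (f x * w i x) + \int[m]_x (g x * w i x))).
  by rewrite -[X in _ --> X](addr0 0) -{1}(mulr0 a); apply: cvgD => //; exact: cvgZr.
apply/funext => i; have swi := bmeas_sqint m (bw i).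
have i1 := sqint_mul_integrable sf swi; have i2 := sqint_mul_integrable sg swi.
rewrite -RintegralZl// -RintegralD//; last exact: (integrableZl measurableT a i1).
by apply: eq_Rintegral => x _; ring.
Qed.

(** Test functions are closed under L^2 limits because the norms of the [w i] are eventually bounded
    by C. *)
Let good_approx f : sqint m f -> (forall e : R, 0 < e ->
    exists g, [/\ sqint m g, good g & \int[m]_x ((f x - g x) ^+ 2) <= e ^+ 2]) ->
  good f.
Proof.
move=> sf H; apply/cvgr0Pnorm_le => e e0.
have e2 : 0 < e / 2 by rewrite divr_gt0.
(* With this tolerance [cauchy_schwarz2] bounds the contribution of f - g by 2 * (e / 2 / (2 * C)) *
   C = e / 2. *)
have [g [sg gg fg]] := H (e / 2 / (2 * C)) (divr_gt0 e2 (mulr_gt0 (ltr0n _ 2) C0)).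
have /cvgr0Pnorm_le/(_ _ e2) := gg.
apply: filterS2 wC => i wiC gi.
have swi := bmeas_sqint m (bw i).
have i1 := sqint_mul_integrable (sqintB sf sg) swi; have i2 := sqint_mul_integrable sg swi.
rewrite (_ : \int[m]_x (f x * w i x) =
    \int[m]_x ((f x - g x) * w i x) + \int[m]_x (g x * w i x)); last first.
  by rewrite -RintegralD//; apply: eq_Rintegral => x _; ring.
rewrite (le_trans (ler_normD _ _))// (splitr e) lerD//.
have a0 : 0 < e / 2 / (2 * C) by rewrite divr_gt0// mulr_gt0.
rewrite (le_trans (cauchy_schwarz2 (sqintB sf sg) swi a0 C0 fg wiC))//.
by rewrite le_eqVlt; apply/orP; left; apply/eqP; field; rewrite gt_eqF.
Qed.

Variable G : set_system X.
Hypothesis G_gen : @measurable _ X = <<s G >>.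
Hypothesis GI : setI_closed G.
Hypothesis GT : good \1_setT.
Hypothesis G_good : forall A, G A -> good \1_A.

Let s1 (A : set X) : measurable A -> sqint m \1_A.
Proof. by move=> mA; apply: bmeas_sqint; exact: bmeas_indic. Qed.

(** Complements are handled by linearity and the case of [setT]. A countable disjoint union is an
    L^2 limit of finite unions, since the tails decrease to the empty set and the measure is
    finite. *)
Let good_indic A : measurable A -> good \1_A.
Proof.
rewrite G_gen; move: A; apply: (dynkin_induction (P := fun A => good \1_A)) => //.
  move=> A mA gA; have := good_lin (-1) (s1 mA) (s1 measurableT) gA GT.
  rewrite (_ : (fun x => _) = \1_(~` A))//; apply/funext => x.
  by rewrite !indicE in_setT in_setC; case: (x \in A) => /=; lra.
move=> A mA tA gA; have mUA : measurable (\bigcup_k A k) by exact: bigcupT_measurable.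
have mbA n : measurable (\big[setU/set0]_(k < n) A k) by exact: bigsetU_measurable.
apply: good_approx => [|e e0]; first exact: s1.
pose D n := (\bigcup_k A k) `\` \big[setU/set0]_(k < n) A k.
have mD n : measurable (D n) by exact: measurableD.
have : m \o D @ \oo --> m (\bigcap_n D n).
  apply: nonincreasing_cvg_mu => //.
  - by rewrite ltey_eq fin_num_measure.
  - exact: bigcapT_measurable.
  - move=> a b ab; apply/subsetPset; apply: setDS.
    exact: subset_bigsetU.
rewrite (_ : \bigcap_n D n = set0) ?measure0; last first.
  rewrite -subset0 => x Dx; have [[k _ Akx] _] := Dx 0%N I.
  have [_ +] := Dx k.+1 I; apply; rewrite big_ord_recr/=; by right.
move=> /fine_cvgP[_]/cvgr0Pnorm_le/(_ _ (exprn_gt0 2 e0))[n _ /(_ n (leqnn n))/= De].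
exists (\1_(\big[setU/set0]_(k < n) A k)); split; first exact: s1.
  have : forall n, good \1_(\big[setU/set0]_(k < n) A k).
    elim=> [|k ih].
      rewrite big_ord0 /good indic0; apply: cvg_near_cst; apply: nearW => i /=.
      by under eq_Rintegral do rewrite mul0r; rewrite /Rintegral integral0.
    rewrite big_ord_recr/=.
    have := good_lin 1 (s1 (mbA k)) (s1 (mA k)) ih (gA k).
    rewrite (_ : (fun x => _) = \1_(\big[setU/set0]_(i < k) A i `|` A k))//.
    apply/funext => x; rewrite !indicE in_setU mul1r.
    have [xA|] := boolP (x \in A k); last by rewrite orbF addr0.
    have [xU|] := boolP (x \in \big[setU/set0]_(i < k) A i); last by rewrite add0r.
    exfalso; move: xU; rewrite inE -bigcup_mkord => -[j /= jk Ajx].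
    have jkE : j = k by apply: tA => //; exists x; split => //; exact/set_mem.
    by rewrite jkE ltnn in jk.
  exact.
(* The difference of the two indicators is the indicator of the tail [D n], hence equal to its own
   square. *)
rewrite (_ : \int[m]_x _ = fine (m (D n))); first by rewrite (le_trans (ler_norm _)).
rewrite /Rintegral -(setIT (D n)) -integral_indic//; congr fine; apply: eq_integral => x _.
rewrite /= !indicE /D in_setD; congr EFin.
have [xU|xU] := boolP (x \in \big[setU/set0]_(i < n) A i).
  rewrite (_ : x \in \bigcup_k A k) ?subrr ?expr0n//.
  by move: xU; rewrite !inE -bigcup_mkord => -[j /= _ Ajx]; exists j.
by rewrite subr0 andbT; case: (x \in \bigcup_k A k); rewrite ?expr1n ?expr0n.
Qed.

Let good_bmeas f : bmeas f -> good f.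
Proof.
move: f; apply: bmeas_ind => [A mA|a f g bf bg|f bf fP].
- exact: good_indic.
- by apply: good_lin; exact: bmeas_sqint.
- apply: good_approx => [|e e0]; first exact: bmeas_sqint.
  (* c bounds the total mass and is at least 1, so (e / c)^2 times the mass is at most e^2. *)
  pose c := fine (m setT) + 1.
  have c0 : 0 < c by rewrite /c ltr_pwDr// fine_ge0.
  pose e' := e / c; have e'0 : 0 < e' by rewrite divr_gt0.
  have [g [bg gg fg]] := fP e' e'0; exists g; split => //; first exact: bmeas_sqint.
  rewrite (@le_trans _ _ (\int[m]_x (cst (e' ^+ 2) x)))//.
    apply: le_Rintegral => //.
    - apply: (@bmeas_integrable _ _ _ _ _ (fun x => (f x - g x) ^+ 2)) => //.
      exact: (bmeasM (bmeasB bf bg) (bmeasB bf bg)).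
    - by apply: (@bmeas_integrable _ _ _ _ _ (cst _)) => //; exact: bmeas_cst.
    - by move=> x _; rewrite -real_normK ?num_real// lerXn2r ?nnegrE// ltW.
  rewrite Rintegral_cst// /e' exprMn -mulrA ler_piMr ?sqr_ge0//.
  rewrite expr2 -mulrA mulr_ile1 ?mulr_ge0 ?invr_ge0 ?(ltW c0) ?fine_ge0//.
    by rewrite invf_le1// /c lerDr fine_ge0.
  by rewrite mulrC ler_pdivrMr// mul1r /c lerDl.
Qed.

(* Dynkin's theorem for indicators, uniform approximation for bounded functions,
   truncation for square integrable ones. *)
Lemma weak_cvg0 f : sqint m f -> \int[m]_x (f x * w i x) @[i --> F] --> (0 : R).
Proof.
move=> sf; apply: (good_approx sf) => e e0; have [mf iff] := sf.
pose c n x := Num.max (- n%:R) (Num.min (f x) n%:R).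
have mc n : measurable_fun setT (c n).
  by apply: measurable_maxr => //; exact: measurable_minr.
have bc n : bmeas (c n).
  split => //; exists n%:R => x.
  rewrite ler_norml /c le_max lexx/= ge_max ge_min lexx orbT andbT.
  by rewrite (@le_trans _ _ 0)// oppr_le0.
have cE n x : `|f x| <= n%:R -> c n x = f x.
  by rewrite ler_norml /c => /andP[f1 f2]; rewrite min_l// max_r.
(* Truncation moves a value towards 0 without crossing it, so the error never exceeds [f x] in
   modulus; this is the domination used below. *)
have cle n x : (f x - c n x) ^+ 2 <= f x ^+ 2.
  have n0 : 0 <= n%:R :> R by [].
  rewrite -[leRHS]real_normK ?num_real// -[leLHS]real_normK ?num_real//.
  rewrite lerXn2r ?nnegrE// /c.
  have [h|h] := leP (f x) n%:R; last first.
    have -> : Num.max (- n%:R) n%:R = n%:R :> R by rewrite max_r//; lra.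
    by rewrite !ger0_norm; lra.
  have [h'|h'] := leP (- n%:R) (f x); first by rewrite subrr normr0.
  by rewrite !ler0_norm; lra.
have : \int[m]_x ((f x - c n x) ^+ 2) @[n --> \oo] --> \int[m]_x (cst (0 : R) x).
  apply: (Rintegral_dominated_cvg (g := fun x => f x ^+ 2)) => //.
  - by move=> n; apply: measurable_funX; exact: measurable_funB.
  - apply: aeW => x _; apply: cvg_near_cst.
    exists (Num.truncn `|f x|).+1 => // n /= nx.
    rewrite cE ?subrr ?expr0n//.
    rewrite (le_trans (ltW (truncnS_gt _)))// ler_nat//.
  - by move=> n x _; rewrite ger0_norm ?sqr_ge0.
rewrite Rintegral_cst// mul0r => /cvgr0Pnorm_le/(_ _ (exprn_gt0 2 e0))[n _ /(_ n (leqnn n))/= De].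
exists (c n); split; [exact: bmeas_sqint|exact: good_bmeas|].
by rewrite (le_trans (ler_norm _)).
Qed.

End weak_convergence.

Section Lfun_real.
Context d (X : measurableType d) (R : realType) (m : {finite_measure set X -> \bar R}).

Lemma Lfun2_sqint (p1 : (1 <= 2%:R%:E :> \bar R)%E) (f : LfunType m p1) : sqint m f.
Proof.
split; first exact: measurable_funPT.
by apply: Lfun2_integrable_sqr; exact: LfunP.
Qed.

Lemma Lnorm2_lt (f : X -> R) (r : R) : sqint m f ->
  ('N[m]_(2%:R%:E)[EFin \o f] < r%:E)%E -> \int[m]_x (f x ^+ 2) <= r ^+ 2.
Proof.
move=> [mf iff] fr.
have r0 : 0 <= r by rewrite -lee_fin (le_trans _ (ltW fr))// Lnorm_ge0.
rewrite -lee_fin /Rintegral fineK; last exact: integrable_fin_num iff.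
have := @poweR_Lnorm _ _ _ m (EFin \o f) 2.
rewrite pnatr_eq0 => /(_ isT) => E.
rewrite [X in (X <= _)%E](_ : _ = 'N[m]_(2%:R%:E)[EFin \o f] `^ 2%:R)%E; last first.
  rewrite E; apply: eq_integral => x _ /=.
  by rewrite powR_mulrn// real_normK ?num_real.
rewrite (_ : (r ^+ 2)%:E = (r%:E `^ 2%:R)%E); last by rewrite poweR_EFin powR_mulrn.
by rewrite gt0_ler_poweR// ?ltW// in_itv/= ?leey ?andbT ?lee_fin// Lnorm_ge0.
Qed.

(** The norm of index +oo is defined by cases on the total mass; its positivity selects the
    essential supremum. *)
Lemma Lnormy_lt (f : X -> R) (r : R) : (0 < m setT)%E ->
  ('N[m]_(+oo)[EFin \o f] < r%:E)%E -> {ae m, forall x, `|f x| <= r}.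
Proof.
move=> m0; rewrite unlock /= m0 => fr.
have := ess_sup_ge m (abse \o (EFin \o f)).
apply: filterS => x /= xf.
by rewrite -lee_fin; exact: le_trans xf (ltW fr).
Qed.

Lemma ae_le_normr_Rintegral (f g : X -> R) :
  m.-integrable setT (EFin \o f) -> m.-integrable setT (EFin \o g) ->
  (forall x, 0 <= g x) ->
  {ae m, forall x, `|f x| <= g x} -> `|\int[m]_x f x| <= \int[m]_x g x.
Proof.
move=> iif ig g0 fg; rewrite (le_trans (le_normr_Rintegral _ _))//.
have inf : m.-integrable setT (EFin \o (fun x => `|f x|)) by exact: (integrable_norm iif).
rewrite /Rintegral; apply: fine_le; [exact: integrable_fin_num inf|exact: integrable_fin_num ig|].
apply: ae_ge0_le_integral => //.
- exact: measurable_int inf.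
- by move=> x _; rewrite lee_fin.
- exact: measurable_int ig.
by apply: filterS fg => x fx _; rewrite lee_fin.
Qed.

End Lfun_real.

Section leb2.
Context (R : realType) (T : {posnum R}).
Local Notation B := (measurableTypeR R).
Local Notation B2 := (measurableTypeR R * measurableTypeR R)%type.

Lemma leb_setT : leb T setT = (T%:num)%:E.
Proof.
have -> : leb T setT = lebesgue_measure (itvT T : set B) by congr (lebesgue_measure _); exact: setTI.
rewrite /itvT lebesgue_measure_itv /= lte_fin oppr_lt0 (gt0 T).
by rewrite -EFinB sub0r opprK.
Qed.

Lemma bmeas_tensor (f g : B -> R) : bmeas f -> bmeas g -> bmeas (fun z : B2 => f z.1 * g z.2).
Proof. by move=> bf bg; apply: (@bmeasM _ _ _ (f \o fst) (g \o snd)); exact: bmeas_comp. Qed.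

Lemma leb2_tensor (f g : B -> R) : bmeas f -> bmeas g ->
  \int[leb2 T]_z (f z.1 * g z.2) = (\int[leb T]_x f x) * (\int[leb T]_x g x).
Proof.
move=> bf bg; have bfg := bmeas_tensor bf bg.
have ifg : (leb2 T).-integrable setT (EFin \o (fun z : B2 => f z.1 * g z.2)).
  exact: bmeas_integrable.
have ii := integral12_prod_meas1 ifg.
rewrite {1}/Rintegral /leb2 -ii.
have ig : (leb T).-integrable setT (EFin \o g) by exact: bmeas_integrable.
rewrite (mulrC (\int[leb T]_x f x)) -RintegralZl//; last exact: bmeas_integrable.
congr fine; apply: eq_integral => x _.
rewrite /fubini_F mulrC -RintegralZl// /Rintegral fineK//.
by apply: integrable_fin_num => //; exact: (integrableZl measurableT (f x) ig).
Qed.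

(** The L^2 norm of the tensor square of h is the integral of h^2. Thus the g1 components contribute
    at most 2 * r * A by [cauchy_schwarz2], and the g4 components at most r * A by the essential
    bound: hence the 3. *)
Lemma chi0_form_dist (c c' : chi0 T) (h : B -> R) (r A : R) : bmeas h -> h 0 = 0 ->
  (forall x, ~ itvT T x -> h x = 0) -> 0 < r -> 0 < A ->
  (chi0_dist c c' < r%:E)%E -> \int[leb T]_x (h x ^+ 2) <= A ->
  `|chi0_form c h h - chi0_form c' h h| <= 3 * r * A.
Proof.
move=> bh h0 hT r0 A0 cr hA; rewrite !chi0_form_diag//.
have Nge0 d (X : measurableType d) (m : {measure set X -> \bar R}) p f : (0 <= 'N[m]_p[f])%E.
  exact: Lnorm_ge0.
have d1 : ('N[leb2 T]_2[EFin \o (fun z => chi0_g1 c z - chi0_g1 c' z)%R] < r%:E)%E.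
  apply: le_lt_trans cr; rewrite /chi0_dist -!addeA leeDl// !adde_ge0// lee_fin//.
have d2 : ('N[leb T]_(+oo)[EFin \o (fun x => chi0_g4 c x - chi0_g4 c' x)%R] < r%:E)%E.
  by apply: le_lt_trans cr; rewrite /chi0_dist leeDr// !adde_ge0// lee_fin.
have s1 := Lfun2_sqint (chi0_g1 c); have s1' := Lfun2_sqint (chi0_g1 c').
have bhh := bmeas_tensor bh bh.
have shh := bmeas_sqint (leb2 T) bhh.
have sd := sqintB s1 s1'.
have bh2 : bmeas (fun x => h x ^+ 2) by exact: (bmeasM bh bh).
have i4 := LfunType_integrable (chi0_g4 c).
have i4' := LfunType_integrable (chi0_g4 c').
have -> : \int[leb2 T]_z (chi0_g1 c z * (h z.1 * h z.2)) + \int[leb T]_x (chi0_g4 c x * h x ^+ 2) -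
  (\int[leb2 T]_z (chi0_g1 c' z * (h z.1 * h z.2)) + \int[leb T]_x (chi0_g4 c' x * h x ^+ 2)) =
  \int[leb2 T]_z ((chi0_g1 c z - chi0_g1 c' z) * (h z.1 * h z.2)) +
  \int[leb T]_x ((chi0_g4 c x - chi0_g4 c' x) * h x ^+ 2).
  rewrite opprD addrACA; congr (_ + _).
    rewrite -RintegralB//; [|exact: sqint_mul_integrable|exact: sqint_mul_integrable].
    by apply: eq_Rintegral => z _; rewrite mulrBl.
  rewrite -RintegralB//; [|exact: integrable_bmeasM|exact: integrable_bmeasM].
  by apply: eq_Rintegral => z _; rewrite mulrBl.
rewrite (le_trans (ler_normD _ _))//.
rewrite (_ : 3 * r * A = 2 * r * A + r * A); last by ring.
apply: lerD.
  apply: (@cauchy_schwarz2 _ _ _ _ (fun z => chi0_g1 c z - chi0_g1 c' z) (fun z => h z.1 * h z.2)) => //.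
    exact: Lnorm2_lt.
  have -> : \int[leb2 T]_x ((h x.1 * h x.2) ^+ 2) = (\int[leb T]_x (h x ^+ 2)) ^+ 2.
    by rewrite expr2 -leb2_tensor//; apply: eq_Rintegral => z _; rewrite exprMn.
  by rewrite lerXn2r ?nnegrE ?(ltW A0)// Rintegral_ge0// => x _; rewrite sqr_ge0.
rewrite (@le_trans _ _ (\int[leb T]_x (r * h x ^+ 2)))//; last first.
  by rewrite RintegralZl//; [rewrite ler_wpM2l// ltW|exact: bmeas_integrable].
apply: ae_le_normr_Rintegral => //.
- apply: integrable_bmeasM => //.
  by have := integrableB measurableT i4 i4'.
- by apply: bmeas_integrable => //; exact: bmeasZ.
- by move=> x; rewrite mulr_ge0 ?sqr_ge0// ltW.
have m0 : (0 < leb T setT)%E by rewrite leb_setT.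
have := Lnormy_lt m0 d2; apply: filterS => x xr.
by rewrite normrM [X in _ * X]ger0_norm ?sqr_ge0// ler_wpM2r// sqr_ge0.
Qed.

Lemma weak_cvg0_leb (J : Type) (F : set_system J) {FF : ProperFilter F}
    (w : J -> B -> R) (C : R) : 0 < C -> (forall i, bmeas (w i)) ->
  (\forall i \near F, \int[leb T]_x (w i x ^+ 2) <= C ^+ 2) ->
  (forall a b : R, \int[leb T]_(x in `]a, b]) w i x @[i --> F] --> (0 : R)) ->
  forall A : set B, measurable A -> \int[leb T]_(x in A) w i x @[i --> F] --> (0 : R).
Proof.
move=> C0 bw wC w0 A mA.
have indE (D : set B) i : \int[leb T]_(x in D) w i x = \int[leb T]_x (\1_D x * w i x).
  rewrite Rintegral_mkcond; apply: eq_Rintegral => x _; rewrite /patch indicE.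
  by case: ifP => _; rewrite ?mul1r ?mul0r.
rewrite (eq_cvg _ _ (indE A)).
apply: (@weak_cvg0 _ B R (leb T) _ _ _ _ C C0 bw wC (@ocitv R)) => //.
- exact: ocitvI.
(* The whole space is replaced by a half-open interval that contains [-T, 0], where [leb] is
   carried; the shift by 1 keeps - T inside. *)
- rewrite (_ : (fun i => _) = (fun i => \int[leb T]_(x in `](- T%:num - 1), 0]) w i x)).
    exact: w0.
  apply/funext => i.
  have mI : measurable (`](- T%:num - 1), 0]%classic : set B) by exact: measurable_itv.
  rewrite -indE -{1}(setUv (`](- T%:num - 1), 0]%classic : set B)).
  have iw := bmeas_integrable (leb T) measurableT (bw i).
  rewrite Rintegral_setU//; first last.
  - by apply/disj_setPS; rewrite setICr.
  - by rewrite setUv.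
  - exact: measurableC.
  rewrite [X in _ + X](_ : _ = 0) ?addr0//.
  rewrite /Rintegral null_set_integral//.
  - exact: measurableC.
  - by apply/measurable_EFinP; apply: measurable_funTS; exact: (bw i).1.
  rewrite -[LHS]/(@lebesgue_measure R (~` `](- T%:num - 1), 0] `&` itvT T)).
  rewrite (_ : _ `&` _ = set0) ?measure0// -subset0 => x [].
  rewrite /itvT /= !in_itv/= => /negP; rewrite negb_and -!leNgt => /orP[h1 /andP[h2 _]|h1 /andP[_ h2]].
    by have := le_trans h2 h1; rewrite lerDl ler0N1.
  by move: h1; rewrite -ltNge; lra.
- by move=> _ [[a b] _ <-]; have := w0 a b; rewrite (eq_cvg _ _ (indE _)).
- by apply: bmeas_sqint; exact: bmeas_indic.
Qed.

(** On a rectangle the integral factors into two integrals that tend to 0, and rectangles generate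
    the product sigma-algebra. *)
Lemma weak_cvg0_tensor (J : Type) (F : set_system J) {FF : ProperFilter F}
    (k : J -> B -> R) (C : R) : 0 < C -> (forall i, bmeas (k i)) ->
  (\forall i \near F, \int[leb T]_x (k i x ^+ 2) <= C ^+ 2) ->
  (forall a b : R, \int[leb T]_(x in `]a, b]) k i x @[i --> F] --> (0 : R)) ->
  forall g, sqint (leb2 T) g ->
  \int[leb2 T]_z (g z * (k i z.1 * k i z.2)) @[i --> F] --> (0 : R).
Proof.
move=> C0 bk kC k0 g sg.
have kA := weak_cvg0_leb C0 bk kC k0.
have rect (A1 A2 : set B) : measurable A1 -> measurable A2 ->
    \int[leb2 T]_z (\1_(A1 `*` A2) z * (k i z.1 * k i z.2)) @[i --> F] --> (0 : R).
  move=> m1 m2.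
  rewrite (_ : (fun i => _) = (fun i => (\int[leb T]_(x in A1) k i x) * (\int[leb T]_(x in A2) k i x))).
    by rewrite -[X in _ --> X](mul0r 0); apply: cvgM; exact: kA.
  apply/funext => i; rewrite !(Rintegral_mkcond _ A1) (Rintegral_mkcond _ A2) -leb2_tensor.
  - apply: eq_Rintegral => -[x y] _; rewrite /= indicE /patch in_setX/=.
    by case: (x \in A1); case: (y \in A2); rewrite /= ?mul0r ?mulr0 ?mul1r.
  - exact: bmeas_restrict.
  - exact: bmeas_restrict.
apply: (@weak_cvg0 _ B2 R (leb2 T) _ _ _ (fun i z => k i z.1 * k i z.2) (C ^+ 2) (exprn_gt0 2 C0) _ _
  [set A `*` B0 | A in measurable & B0 in measurable]) => //.
- by move=> i; exact: bmeas_tensor.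
- apply: filterS kC => i ki.
  rewrite (_ : \int[leb2 T]_x _ = (\int[leb T]_x (k i x ^+ 2)) ^+ 2); last first.
    have bk2 : bmeas (fun x => k i x ^+ 2) by exact: (bmeasM (bk i) (bk i)).
    by rewrite expr2 -leb2_tensor//; apply: eq_Rintegral => z _; rewrite exprMn.
  by rewrite lerXn2r ?nnegrE ?sqr_ge0// Rintegral_ge0// => x _; rewrite sqr_ge0.
- exact: measurable_prod_measurableType.
- move=> _ _ [A1 m1 [A2 m2 <-]] [A3 m3 [A4 m4 <-]]; exists (A1 `&` A3); first exact: measurableI.
  exists (A2 `&` A4); first exact: measurableI.
  by rewrite setXI.
- by have := rect setT setT measurableT measurableT; rewrite setXTT.
- by move=> _ [A1 m1 [A2 m2 <-]]; exact: rect.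
Qed.

End leb2.

(** * Increments and the quadratic variation *)

Section continuous_integrals.
Context (R : realType).
Local Notation mu := (@lebesgue_measure R).
Implicit Types f : R -> R.

(** Only x is confined to the compact interval: y may leave it, as happens when a path is shifted
    past an end point. *)
Lemma uniform_modulus f (a b r : R) : continuous f -> 0 < r ->
  \forall e \near 0^'+, forall x y, a <= x <= b -> `|x - y| <= e -> `|f x - f y| <= r.
Proof.
move=> fc r0.
have /compact_near_coveringP nc := @segment_compact R a b.
suff H : forall x : R, `[a, b]%classic x -> \forall x' \near x & e \near 0^'+,
    forall y, `|x' - y| <= e -> `|f x' - f y| <= r.
  have := nc R 0^'+ (fun e x => forall y, `|x - y| <= e -> `|f x - f y| <= r).
  move=> /(_ _ H); apply: filterS => e He x y xab.
  by apply: He; rewrite /= in_itv.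
move=> x _; have /cvgrPdist_le/(_ _ (divr_gt0 r0 (ltr0n R 2))) := fc x.
move=> /nbhs_ballP[d /= d0 fd].
have d20 : 0 < d / 2 by rewrite divr_gt0.
exists (ball x (d / 2), [set e | e < d / 2]).
  split => /=; first exact: nbhsx_ballx.
  exact: nbhs_right_lt.
move=> -[x' e] /= [xx' ed] y x'y.
have h1 : `|f x - f x'| <= r / 2.
  by apply: fd; apply: le_ball xx'; rewrite ler_pdivrMr// ler_pMr// ler1n.
have h2 : `|f x - f y| <= r / 2.
  apply: fd; rewrite -ball_normE/= in xx' *.
  rewrite (_ : x - y = (x - x') + (x' - y)); last by ring.
  by rewrite (le_lt_trans (ler_normD _ _))// (splitr d) ltrD// (le_lt_trans x'y).
rewrite (_ : f x' - f y = (f x - f y) - (f x - f x')); last by ring.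
by rewrite (le_trans (ler_normB _ _))// (splitr r) lerD.
Qed.

Lemma Rintegral_shift f (a b e : R) : continuous f -> a <= b ->
  \int[mu]_(x in `[a, b]) f (x - e) = \int[mu]_(x in `[a - e, b - e]) f x.
Proof.
move=> fc ab; rewrite /Rintegral; congr fine.
pose F x : R := x - e.
have Fd (x : R) : is_derive x (1 : R) F (1 : R).
  by rewrite -[X in is_derive _ _ _ X]subr0; apply: is_deriveB.
have F1 : derive1 F = cst 1 by apply/funext => x; rewrite derive1E; exact: derive_val.
have Fc : continuous F by move=> x; apply: differentiable_continuous; apply/derivable1_diffP; exact: ex_derive.
rewrite -/(F a) -/(F b) (@integration_by_substitution_increasing _ F f)//.
- by apply: eq_integral => x _; rewrite /= F1 /= mulr1.
- by move=> x y _ _ xy; rewrite /F ltrD2r.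
- by rewrite F1 => x _; exact: cst_continuous.
- by rewrite F1; exact: is_cvg_cst.
- by rewrite F1; exact: is_cvg_cst.
- split.
  + by move=> x _; exact: ex_derive.
  + by apply: cvg_at_right_filter; exact: Fc.
  + by apply: cvg_at_left_filter; exact: Fc.
- exact: continuous_subspaceT.
Qed.

Lemma continuous_itv_integrable f (a b : R) : continuous f ->
  mu.-integrable `[a, b] (EFin \o f).
Proof.
move=> fc; apply: continuous_compact_integrable; first exact: segment_compact.
exact: continuous_subspaceT.
Qed.

Lemma le_normr_itv_Rintegral f (a b W : R) : continuous f -> a <= b ->
  (forall x, a <= x <= b -> `|f x| <= W) ->
  `|\int[mu]_(x in `[a, b]) f x| <= W * (b - a).
Proof.
move=> fc ab fW; have fi := continuous_itv_integrable a b fc.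
rewrite (le_trans (le_normr_Rintegral _ _))//.
rewrite (@le_trans _ _ (\int[mu]_(x in `[a, b]) (cst W x)))//.
  apply: le_Rintegral => //.
  - exact: (integrable_norm fi).
  - by apply: continuous_itv_integrable; exact: cst_continuous.
have muab : lebesgue_measure (`[a, b]%classic : set R) = (b - a)%:E.
  rewrite lebesgue_measure_itv/= lte_fin; case: ltP => [_|ba]; first by rewrite EFinB.
  by rewrite (_ : a = b) ?subrr//; apply/eqP; rewrite eq_le ab ba.
rewrite Rintegral_cst//.
by rewrite [X in fine X]muab.
Qed.

Lemma Rintegral_itv_split f (a c b : R) : continuous f -> a <= c <= b ->
  \int[mu]_(x in `[a, b]) f x = \int[mu]_(x in `[a, c]) f x + \int[mu]_(x in `[c, b]) f x.
Proof.
move=> fc /andP[ac cb]; have fi := continuous_itv_integrable a b fc.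
rewrite -(@Rintegral_itv_obnd_cbnd _ c); last first.
  by apply: integrableS fi => //; apply: subset_itv; rewrite ?bnd_simp.
by rewrite -(@Rintegral_itvB _ f (BLeft a) (BRight b) c)// ?bnd_simp// addrC subrK.
Qed.

(** A shift alters the domain of integration only by two end intervals of length e. *)
Lemma Rintegral_shift_dist f (a b e W : R) : continuous f -> a <= b -> 0 <= e ->
  (forall x, a - e <= x <= b -> `|f x| <= W) ->
  `|\int[mu]_(x in `[a, b]) f (x - e) - \int[mu]_(x in `[a, b]) f x| <= 2 * W * e.
Proof.
move=> fc ab e0 fW; rewrite Rintegral_shift//.
have W0 : 0 <= W by rewrite (le_trans (normr_ge0 (f b)))// fW// lexx andbT; lra.
have aea : a - e <= a by lra.
have beb : b - e <= b by lra.
have E : \int[mu]_(x in `[a - e, b - e]) f x - \int[mu]_(x in `[a, b]) f x =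
    \int[mu]_(x in `[a - e, a]) f x - \int[mu]_(x in `[b - e, b]) f x.
  have h1 := @Rintegral_itv_split f (a - e) a b fc (introT andP (conj aea ab)).
  have aebe : a - e <= b - e by lra.
  have h2 := @Rintegral_itv_split f (a - e) (b - e) b fc (introT andP (conj aebe beb)).
  lra.
rewrite E (le_trans (ler_normB _ _))//.
have h1 := @le_normr_itv_Rintegral f (a - e) a W fc aea.
have h2 := @le_normr_itv_Rintegral f (b - e) b W fc beb.
have h1' : `|\int[mu]_(x in `[a - e, a]) f x| <= W * (a - (a - e)).
  by apply: h1 => x /andP[xa xb]; apply: fW; rewrite xa (le_trans xb).
have h2' : `|\int[mu]_(x in `[b - e, b]) f x| <= W * (b - (b - e)).
  by apply: h2 => x /andP[xa xb]; apply: fW; rewrite xb andbT (le_trans _ xa)// lerD2r.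
rewrite (le_trans (lerD h1' h2'))//; lra.
Qed.

End continuous_integrals.

Section quadratic_variation.
Context (R : realType) (T : {posnum R}) (f : R -> R).
Hypothesis fc : continuous f.
Local Notation t := (T%:num).

Lemma continuous_incr2 (e : R) : continuous (fun s => (f (s + e) - f s) ^+ 2).
Proof.
move=> s; apply: (@cvg_comp _ _ _ (fun s => f (s + e) - f s) (fun r : R => r ^+ 2));
  last exact: exprn_continuous.
apply: cvgB; last exact: fc.
apply: (@cvg_comp _ _ _ (fun s => s + e) f); last exact: fc.
by apply: cvgD; [exact: cvg_id|exact: cvg_cst].
Qed.

(** [qvar_approx] uses forward increments on [x, 0], while the shifted path produces backward
    increments on [-T, a]. A translation by e relates them, and its two end intervals cost o(e)
    because increments are uniformly small. *)
Lemma cvg_incr2 (a : R) : has_qvar T f -> itvT T a ->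
  (\int[leb T]_(x in `[- t, a]) ((f (x - e) - f x) ^+ 2)) / e @[e --> 0^'+] -->
  qvar f a - qvar f (- t).
Proof.
move=> fq ia; have /andP[ta a0] : - t <= a <= 0 by move: ia; rewrite /itvT/= in_itv.
have fqa : (qvar_approx f a e - qvar_approx f (- t) e) @[e --> 0^'+] -->
    qvar f a - qvar f (- t).
  by apply: cvgB; apply: fq => //; exact: itvT_left.
apply: (cvg_sub0 _ fqa).
apply/cvgr0Pnorm_le => r r0.
(* The end intervals cost 2 * s^2, which is at most r because s <= 1 and s <= r / 2. *)
pose s := Num.min 1 (r / 2).
have s0 : 0 < s by rewrite lt_min ltr01 divr_gt0.
(* The window starts at - t - 1 because backward increments at - t look left by e <= 1. *)
have fu := @uniform_modulus R f (- t - 1) 0 s fc s0.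
near=> e.
have e0 : 0 < e by near: e; exact: nbhs_right_gt.
have e1 : e <= 1 by near: e; exact: nbhs_right_le.
have fe : forall x y, - t - 1 <= x <= 0 -> `|x - y| <= e -> `|f x - f y| <= s.
  by near: e; exact: fu.
pose q z := (f (z + e) - f z) ^+ 2.
have qc : continuous q by exact: continuous_incr2.
have qW x : - t - e <= x <= a -> `|q x| <= s ^+ 2.
  move=> /andP[x1 x2]; rewrite /q normrX lerXn2r ?nnegrE// ?(ltW s0)//.
  rewrite distrC fe//; last by rewrite opprD addrA subrr add0r normrN ger0_norm// ltW.
  by rewrite (le_trans _ x1) ?lerD2l ?lerN2//= (le_trans x2).
have := Rintegral_shift_dist qc ta (ltW e0) qW.
rewrite !fctE leb_Rintegral; last 2 first.
- by move=> x /=; rewrite /itvT/= !in_itv/= => /andP[-> /= xa]; rewrite (le_trans xa).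
- exact: measurable_itv.
have -> : \int[lebesgue_measure]_(x in `[- t, a]) ((f (x - e) - f x) ^+ 2) =
    \int[lebesgue_measure]_(x in `[- t, a]) q (x - e).
  by apply: eq_Rintegral => x _; rewrite /q subrK -sqrrN opprB.
have := @Rintegral_itv_split R q (- t) a 0 qc (introT andP (conj ta a0)).
rewrite /= /qvar_approx -/q => E1 E2.
rewrite !mulNr opprK.
set C := (X in - (X / _)); set D := (X in _ + X / _); set A := (X in `|X / _ - _|).
pose B := \int[@lebesgue_measure R]_(x in `[- t, a]) q x.
have {}E1 : D = B + C by exact: E1.
rewrite E1 (_ : _ - _ = (A - B) / e); last by field; rewrite gt_eqF.
rewrite normrM [X in _ * X]gtr0_norm ?invr_gt0// ler_pdivrMr// (le_trans E2)//.
rewrite ler_pM2r// mulrC -ler_pdivlMr// (@le_trans _ _ s)//.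
  rewrite expr2 ler_piMr ?(ltW s0)// /s ge_min lexx//.
by rewrite /s ge_min lexx orbT.
Unshelve. all: by end_near. Qed.

End quadratic_variation.

(** * Weak convergence to a Stieltjes measure *)

Section stieltjes_mass.
Context (R : realType) (T : {posnum R}) (F : R -> R).
Hypothesis F_nd : nd_itvT T F.
Local Notation t := (T%:num).
Local Notation m := (stieltjes T F).
Local Notation rr := (right_reg T F).

Lemma stieltjes_ocitv (a b : R) : a <= b -> m `]a, b]%classic = (rr b - rr a)%:E.
Proof.
move=> ab; rewrite /stieltjes; case: pselect => [nd|//].
rewrite /= /lebesgue_stieltjes_measure /= /measure_extension /= measurable_mu_extE /=; last exact: is_ocitv.
by rewrite wlength_itv_bnd.
Qed.

Lemma clampT_itvT (x : R) : itvT T x -> clampT T F x = F x.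
Proof.
rewrite /itvT/= in_itv/= /clampT => /andP[tx x0].
by rewrite min_l// max_r.
Qed.

Lemma le_clampT (y : R) : F (- t) <= clampT T F y.
Proof.
rewrite /clampT; apply: F_nd.
- exact: itvT_left.
- by rewrite /itvT/= in_itv/= le_max lexx/= ge_max oppr_le0 ltW//= ge_min lexx orbT.
- by rewrite le_max lexx.
Qed.

Lemma right_reg_le (x a : R) : itvT T a -> x < a -> rr x <= F a.
Proof.
move=> ia xa; apply: ge_inf.
  exists (F (- t)) => _ [y _ <-]; exact: le_clampT.
by exists a; [rewrite /= in_itv/= xa|exact: clampT_itvT].
Qed.

Lemma le_right_reg (a : R) : itvT T a -> F a <= rr a.
Proof.
move=> ia; apply: lb_le_inf.
  by exists (clampT T F (a + 1)), (a + 1) => //; rewrite /= in_itv/= ltrDl ltr01.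
move=> _ [y /= + <-]; rewrite in_itv/= andbT => ay.
by rewrite -(clampT_itvT ia); apply: clamp_nd => //; exact: ltW.
Qed.

Lemma right_reg_left (x : R) : x < - t -> rr x = F (- t).
Proof.
move=> xt; apply/eqP; rewrite eq_le; apply/andP; split.
  by apply: right_reg_le => //; exact: itvT_left.
apply: lb_le_inf.
  by exists (clampT T F (x + 1)), (x + 1) => //; rewrite /= in_itv/= ltrDl ltr01.
by move=> _ [y _ <-]; exact: le_clampT.
Qed.

Lemma right_reg_right (x : R) : 0 <= x -> rr x = F 0.
Proof.
move=> x0; rewrite /right_reg (_ : [set _ | _ in _] = [set F 0]) ?inf1//.
have cl y : x < y -> clampT T F y = F 0.
  move=> xy; rewrite /clampT min_r ?max_r//; last by rewrite (le_trans x0)// ltW.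
apply/seteqP; split => [_ [y /= + <-]|_ ->]/=.
  by rewrite in_itv/= andbT => /cl.
by exists (x + 1); [rewrite in_itv/= ltrDl ltr01|apply: cl; rewrite ltrDl].
Qed.

(** The interval is exhausted by half-open ones ending before a, where [right_reg] is at most F a.
    Starting at - t - 1, where the continued F is constant, includes a possible atom at - t. *)
Lemma stieltjes_oo_le (a : R) : itvT T a ->
  (m `](- t - 1)%R, a[%classic <= (F a - F (- t))%:E)%E.
Proof.
move=> ia; have ta : - t <= a by move: ia; rewrite /itvT/= in_itv => /andP[].
rewrite itv_bnd_open_bigcup.
pose G n := `](- t - 1), (a - n.+1%:R^-1)]%classic : set (measurableTypeR R).
have cG : m \o G @ \oo --> m (\bigcup_n G n).
  apply: nondecreasing_cvg_mu.
  - by move=> n; exact: measurable_itv.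
  - by apply: bigcupT_measurable => n; exact: measurable_itv.
  - move=> i j ij; apply/subsetPset => x; rewrite /G /= !in_itv/= => /andP[-> /le_trans]; apply.
    by rewrite lerB// lef_pV2 ?ler_nat ?posrE.
rewrite -(cvg_lim _ cG)//; apply: lime_le; first by apply/cvg_ex; eexists; exact: cG.
apply: nearW => n /=.
have n1 : n.+1%:R^-1 <= 1 :> R by rewrite invf_le1// ler1n.
rewrite stieltjes_ocitv; last by rewrite lerB.
rewrite lee_fin (right_reg_left (x := - t - 1)); last by rewrite ltrBlDr ltrDl.
by rewrite lerB// right_reg_le// ltrBlDr ltrDl invr_gt0.
Qed.

Lemma stieltjes_left0 : m `](- t - 1), (- t)[%classic = 0.
Proof.
apply/eqP; rewrite eq_le measure_ge0 andbT.
by have := stieltjes_oo_le (itvT_left T); rewrite subrr.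
Qed.

Lemma stieltjes_itv_left (a : R) (b : bool) : itvT T a ->
  m [set` Interval (BLeft (- t)) (BSide b a)] = m [set` Interval (BRight (- t - 1)) (BSide b a)].
Proof.
move=> ia; have ta : - t <= a by move: ia; rewrite /itvT/= in_itv => /andP[].
rewrite [in RHS](@itv_bndbnd_setU _ _ _ (BLeft (- t))); last 2 first.
- by rewrite bnd_simp ltrBlDr ltrDl.
- by case: b; rewrite bnd_simp.
have mI (i : interval R) : measurable ([set` i] : set (measurableTypeR R)) by exact: measurable_itv.
rewrite measureU//; first by rewrite [X in (X + _)%E](_ : _ = 0%E) ?add0e//; exact: stieltjes_left0.
rewrite -subset0 => x [] /=; rewrite !in_itv/= => /andP[_ xt] /andP[tx _].
by move: xt; rewrite ltNge tx.
Qed.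

Lemma stieltjes_itvT : m (itvT T) = (F 0 - F (- t))%:E.
Proof.
rewrite /itvT stieltjes_itv_left; last exact: itvT0.
have t1 : - t - 1 < - t by rewrite ltrBlDr ltrDl.
have t0 : - t <= 0 by rewrite oppr_le0 ltW.
rewrite stieltjes_ocitv; last by rewrite (le_trans (ltW t1)).
by rewrite right_reg_right// right_reg_left.
Qed.

Lemma stieltjes_bmeas_integrable (f : measurableTypeR R -> R) : bmeas f -> m.-integrable (itvT T) (EFin \o f).
Proof.
move=> [mf [M fM]]; apply: measurable_bounded_integrable.
- exact: measurable_itvT.
- by rewrite stieltjes_itvT ltry.
- exact: measurable_funTS.
- by exists M; split; [exact: num_real|move=> y My x _ /=; rewrite (le_trans (fM x))// ltW].
Qed.

(* [right_reg] forgets the value of F at a jump: the indicator of [-T, a] may have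
   integral F(a+) - F(-T) instead of F a - F (- T). The weight scut_theta a of the
   atom at a corrects this; if there is no atom the quotient is 0, which is harmless,
   and at a = 0 the weight is 1 by the choice of the total mass. *)
Definition scut_theta (a : R) : R := if a == 0 then 1 else
  (F a - F (- t) - fine (m `[(- t), a[%classic)) / fine (m [set a]).

Definition scut (a x : R) : R := \1_`]-oo, a[%classic x + scut_theta a * \1_[set a] x.

Lemma scut_lt (a x : R) : x < a -> scut a x = 1.
Proof.
move=> xa; rewrite /scut !indicE mem_set ?memNset ?mulr0 ?addr0//=.
by move=> E; rewrite E ltxx in xa.
Qed.

Lemma scut_gt (a x : R) : a < x -> scut a x = 0.
Proof.
move=> ax; rewrite /scut !indicE !memNset ?mulr0 ?addr0//=.
  by move=> E; rewrite E ltxx in ax.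
by rewrite in_itv/= => xa; have := lt_trans ax xa; rewrite ltxx.
Qed.

Lemma scut_eq (a : R) : scut a a = scut_theta a.
Proof.
rewrite /scut !indicE memNset/=; first by rewrite mem_set// mulr1 add0r.
by rewrite in_itv/= ltxx.
Qed.

Let fin_sub (A : set (measurableTypeR R)) : measurable A -> A `<=` itvT T -> m A \is a fin_num.
Proof.
move=> mA AT; rewrite ge0_fin_numE//.
apply: (@le_lt_trans _ _ (m (itvT T))); last by rewrite stieltjes_itvT ltry.
by apply: le_measure; rewrite ?inE//; exact: measurable_itvT.
Qed.

(** F a lies between its one-sided limits, which differ by the mass of the atom at a; this is what
    puts the weight [scut_theta a] in [0, 1]. *)
Let mass_bounds (a : R) : itvT T a ->
  fine (m `[(- t), a[%classic) <= F a - F (- t) <= fine (m `[(- t), a[%classic) + fine (m [set a]).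
Proof.
move=> ia; have /andP[ta a0] : - t <= a <= 0 by move: ia; rewrite /itvT/= in_itv.
have mI (i : interval R) : measurable ([set` i] : set (measurableTypeR R)) by exact: measurable_itv.
have sub : `[(- t), a[ `<=` itvT T.
  by move=> x; rewrite /itvT/= !in_itv/= => /andP[-> /ltW xa]; exact: le_trans xa a0.
have sub1 : [set a] `<=` itvT T by move=> x ->.
have f1 := fin_sub (mI _) sub.
have f2 := fin_sub (measurable_set1 a) sub1.
apply/andP; split.
  by rewrite -lee_fin fineK// stieltjes_itv_left//; exact: stieltjes_oo_le.
rewrite -(fineD f1 f2) -lee_fin fineK ?fin_numD ?f1 ?f2//.
rewrite -measureU//; last first.
  by rewrite -subset0 => x [] /=; rewrite in_itv/= => /andP[_ xa] E; rewrite E ltxx in xa.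
rewrite setUitv1; last by rewrite bnd_simp.
rewrite [X in (_ <= X)%E](stieltjes_itv_left false ia) stieltjes_ocitv; last first.
  by rewrite (le_trans _ ta)// lerBlDr lerDl.
rewrite lee_fin (right_reg_left (x := - t - 1)); last by rewrite ltrBlDr ltrDl.
by rewrite lerB// le_right_reg.
Qed.

Lemma scut_theta01 (a : R) : itvT T a -> 0 <= scut_theta a <= 1.
Proof.
move=> ia; rewrite /scut_theta; case: eqP => _; first by rewrite ler01 lexx.
have /andP[h1 h2] := mass_bounds ia.
have p0 : 0 <= fine (m [set a]) by rewrite fine_ge0.
rewrite mulr_ge0 ?invr_ge0 ?subr_ge0//=.
have [->|n0] := eqVneq (fine (m [set a])) 0; first by rewrite invr0 mulr0.
by rewrite ler_pdivrMr ?mul1r ?lt_neqAle ?p0 ?andbT 1?eq_sym// lerBlDl.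
Qed.

Lemma scut01 (a x : R) : itvT T a -> 0 <= scut a x <= 1.
Proof.
move=> ia; have [xa|ax|->] := ltgtP x a.
- by rewrite scut_lt// ler01 lexx.
- by rewrite scut_gt// ler01 lexx.
- by rewrite scut_eq scut_theta01.
Qed.

(** Since the weights lie in [0, 1], the cuts are ordered also at their jump points, so increments
    of cuts are nonnegative. *)
Lemma scut_le (a b x : R) : itvT T a -> itvT T b -> a <= b -> scut a x <= scut b x.
Proof.
move=> ia ib; rewrite le_eqVlt => /predU1P[->//|ab].
have /andP[_ a1] := scut01 x ia; have /andP[b0 _] := scut01 x ib.
have [xb|bx] := ltP x b; first by rewrite (scut_lt xb).
by rewrite (scut_gt (lt_le_trans ab bx)).
Qed.

(** At - t the numerator of the weight is F (- t) - F (- t) minus the mass of an empty interval.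
    With [scut_right], the increments of cuts over a partition then sum to 1 on all of [-T, 0], end
    points included. *)
Lemma scut_left (x : R) : itvT T x -> scut (- t) x = 0.
Proof.
rewrite /itvT/= in_itv/= le_eqVlt => /andP[/predU1P[<- _|tx _]]; last exact: scut_gt.
rewrite scut_eq /scut_theta eqr_oppLR oppr0 gt_eqF// subrr set_itvco0 measure0 subrr mul0r//.
Qed.

Lemma scut_right (x : R) : itvT T x -> scut 0 x = 1.
Proof.
rewrite /itvT/= in_itv/= (le_eqVlt x) => /andP[_ /predU1P[->|x0]]; last exact: scut_lt.
by rewrite scut_eq /scut_theta eqxx.
Qed.

Lemma bmeas_scut (a : R) : bmeas (scut a : measurableTypeR R -> R).
Proof.
apply: bmeasD; first by apply: bmeas_indic; exact: measurable_itv.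
by apply: bmeasZ; apply: bmeas_indic; exact: measurable_set1.
Qed.

Lemma integral_scut (a : R) : itvT T a -> \int[m]_(x in itvT T) scut a x = F a - F (- t).
Proof.
move=> ia; have /andP[ta a0] : - t <= a <= 0 by move: ia; rewrite /itvT/= in_itv.
have mI (i : interval R) : measurable ([set` i] : set (measurableTypeR R)) by exact: measurable_itv.
have mT : measurable (itvT T : set (measurableTypeR R)) by exact: measurable_itvT.
have [->|an0] := eqVneq a 0.
  rewrite (_ : \int[m]_(x in itvT T) _ = \int[m]_(x in itvT T) 1); last first.
    by apply: eq_Rintegral => x /set_mem xT; exact: scut_right.
  by rewrite Rintegral_cst// mul1r stieltjes_itvT.
have b1 : bmeas (\1_`]-oo, a[%classic : measurableTypeR R -> R) by exact: bmeas_indic.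
have b2 : bmeas (\1_[set a] : measurableTypeR R -> R) by apply: bmeas_indic; exact: measurable_set1.
rewrite RintegralD//; [|exact: stieltjes_bmeas_integrable|exact: stieltjes_bmeas_integrable (bmeasZ _ b2)].
rewrite RintegralZl//; last exact: stieltjes_bmeas_integrable.
rewrite {1 2}/Rintegral !integral_indic//.
rewrite (_ : `]-oo, a[ `&` itvT T = `[(- t), a[%classic); last first.
  apply/seteqP; split => x; rewrite /itvT /= !in_itv/=.
    by move=> [-> /andP[-> _]].
  by move=> /andP[-> xa]; rewrite xa (le_trans (ltW xa)).
rewrite (_ : [set a] `&` itvT T = [set a]); last by apply/setIidl => x ->.
rewrite /scut_theta (negbTE an0).
have /andP[h1 h2] := mass_bounds ia.
(* Without an atom at a, the two bounds of [mass_bounds] coincide and give the value whatever the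
   weight. *)
have [E|n0] := eqVneq (fine (m [set a])) 0; last by rewrite divfK// addrC subrK.
by rewrite E mulr0 addr0; apply/eqP; rewrite eq_le h1/= (le_trans h2)// E addr0.
Qed.

End stieltjes_mass.

Lemma sup_dist (R : realType) (A : set R) (y r : R) : A !=set0 ->
  (forall z, A z -> `|z - y| <= r) -> `|sup A - y| <= r.
Proof.
move=> [z Az] Ar.
have ub : ubound A (y + r).
  by move=> w Aw; have := Ar w Aw; rewrite ler_norml => /andP[_]; rewrite lerBlDl.
have h1 : sup A <= y + r by apply: ge_sup => //; exists z.
have h2 : z <= sup A by apply: ub_le_sup => //; exists (y + r).
have := Ar z Az; rewrite !ler_norml => /andP[h3 _]; apply/andP; split; lra.
Qed.

Lemma maxr_dist (R : realType) (a y z : R) : `|Num.max a y - Num.max a z| <= `|y - z|.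
Proof.
have h1 := ler_norm (y - z); have h2 := ler_norm (z - y); rewrite (distrC z y) in h2.
by case: (leP a y) => ?; case: (leP a z) => ?; rewrite ler_norml; apply/andP; split; lra.
Qed.

Lemma minr_dist (R : realType) (a y z : R) : `|Num.min y a - Num.min z a| <= `|y - z|.
Proof.
have h1 := ler_norm (y - z); have h2 := ler_norm (z - y); rewrite (distrC z y) in h2.
by case: (leP y a) => ?; case: (leP z a) => ?; rewrite ler_norml; apply/andP; split; lra.
Qed.

Section stieltjes_weak_convergence.
Context (R : realType) (T : {posnum R}) (F : R -> R).
Hypothesis F_nd : nd_itvT T F.
Local Notation t := (T%:num).
Local Notation B := (measurableTypeR R).
Local Notation m := (stieltjes T F).
Context (J : Type) (Fi : set_system J) {FF : ProperFilter Fi} (v : J -> B -> R).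
Hypothesis bv : forall i, bmeas (v i).
Hypothesis v0 : forall i x, 0 <= v i x.
Hypothesis v_cvg : forall a, itvT T a ->
  \int[leb T]_(x in `[(- t), a]) v i x @[i --> Fi] --> F a - F (- t).

Let mI (i : interval R) : measurable ([set` i] : set B).
Proof. exact: measurable_itv. Qed.

Definition continuous_itvT_at (g : R -> R) (x : R) := forall r : R, 0 < r ->
  exists2 d : R, 0 < d & forall y, itvT T y -> `|x - y| < d -> `|g x - g y| <= r.

(* Testing against [- g] as well, an upper bound for every [g] suffices. It comes
   from the step functions S n, whose coefficients M n k are the suprema of [g] over
   the cells of the uniform partition p n and whose integrals involve only the
   values of F at the partition points. *)
Section upper_bound.
Variables (g : B -> R) (L : R).
Hypothesis mg : measurable_fun setT g.
Hypothesis gL : forall x, `|g x| <= L.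
Hypothesis gc : {ae m, forall x, itvT T x -> continuous_itvT_at g x}.

Let p n k : R := - t + k%:R * (t / n.+1%:R).

Let p0 n : p n 0 = - t. Proof. by rewrite /p mul0r addr0. Qed.

Let pn n : p n n.+1 = 0.
Proof. by rewrite /p mulrC divfK ?pnatr_eq0// addNr. Qed.

Let pS n k : p n k.+1 = p n k + t / n.+1%:R.
Proof. by rewrite /p -natr1 mulrDl mul1r addrA. Qed.

Let p_nd n k l : (k <= l)%N -> p n k <= p n l.
Proof. by move=> kl; rewrite /p lerD2l ler_wpM2r ?ler_nat// divr_ge0. Qed.

Let p_itvT n k : (k <= n.+1)%N -> itvT T (p n k).
Proof.
by move=> kn; rewrite /itvT/= in_itv/= -{1}(p0 n) -{1}(pn n) !p_nd.
Qed.

Let M n k := sup [set g x | x in `[p n k, p n k.+1]].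

Let M_dist n k (y r : R) : (forall x, p n k <= x <= p n k.+1 -> `|g x - y| <= r) -> `|M n k - y| <= r.
Proof.
move=> H; apply: sup_dist.
  by exists (g (p n k)), (p n k) => //; rewrite /= in_itv/= lexx p_nd.
by move=> _ [x + <-]; rewrite /= in_itv/=; exact: H.
Qed.

Let M_ub n k x : p n k <= x <= p n k.+1 -> g x <= M n k.
Proof.
move=> xp; apply: ub_le_sup; last by exists x => //; rewrite /= in_itv.
by exists L => _ [y _ <-]; rewrite (le_trans (ler_norm _)).
Qed.

Let S n x := \sum_(k < n.+1) M n k * (scut T F (p n k.+1) x - scut T F (p n k) x).

(** The increments of cuts are nonnegative, telescope to 1 and vanish outside the closed cell, so
    [S n x] is an average of the [M n k] whose cells contain x. *)
Let S_dist n x (y r : R) : itvT T x -> (forall k, (k < n.+1)%N ->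
    p n k <= x <= p n k.+1 -> `|M n k - y| <= r) -> `|S n x - y| <= r.
Proof.
move=> xT H.
pose w k := scut T F (p n k.+1) x - scut T F (p n k) x.
have wsum : \sum_(k < n.+1) w k = 1.
  rewrite -(big_mkord xpredT w) telescope_sumr// p0 pn scut_left// scut_right// subr0//.
have -> : S n x - y = \sum_(k < n.+1) w k * (M n k - y).
  rewrite -[X in _ - X]mul1r -wsum mulr_suml -sumrB; apply: eq_bigr => k _.
  by rewrite /w; ring.
rewrite (le_trans (ler_norm_sum _ _ _))//.
rewrite -[leRHS]mul1r -wsum mulr_suml; apply: ler_sum => k _.
have w0 : 0 <= w k.
  by rewrite subr_ge0; apply: scut_le => //; [apply: p_itvT; exact: ltnW|exact: p_itvT|exact: p_nd].
rewrite normrM ger0_norm//.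
have [xp|px] := ltP x (p n k).
  by rewrite /w !scut_lt ?subrr ?mul0r// (lt_le_trans xp)// p_nd.
have [xp|px'] := ltP (p n k.+1) x.
  by rewrite /w !scut_gt ?subrr ?mul0r// (le_lt_trans _ xp)// p_nd.
by rewrite ler_wpM2l// H// px px'.
Qed.

Let bS n : bmeas (S n : B -> R).
Proof.
apply: (@bmeas_sum _ B R n.+1 (fun k x => M n k * (scut T F (p n k.+1) x - scut T F (p n k) x))) => k _.
by apply: bmeasZ; apply: bmeasB; exact: bmeas_scut.
Qed.

Let integral_S n : \int[m]_(x in itvT T) S n x = \sum_(k < n.+1) M n k * (F (p n k.+1) - F (p n k)).
Proof.
have H j : (j <= n.+1)%N ->
    \int[m]_(x in itvT T) (\sum_(k < j) M n k * (scut T F (p n k.+1) x - scut T F (p n k) x)) =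
    \sum_(k < j) M n k * (F (p n k.+1) - F (p n k)).
  elim: j => [|j ih] jn.
    rewrite big_ord0; under eq_Rintegral do rewrite big_ord0.
    by rewrite /Rintegral integral0.
  rewrite big_ord_recr/= -ih ?(ltnW jn)//.
  transitivity (\int[m]_(x in itvT T)
      (\sum_(k < j) M n k * (scut T F (p n k.+1) x - scut T F (p n k) x) +
       M n j * (scut T F (p n j.+1) x - scut T F (p n j) x))).
    by apply: eq_Rintegral => x _; rewrite big_ord_recr.
  have bd : bmeas (fun x : B => scut T F (p n j.+1) x - scut T F (p n j) x).
    by apply: bmeasB; exact: bmeas_scut.
  have mT := @measurable_itvT R T.
  rewrite RintegralD//; last 2 first.
  - apply: stieltjes_bmeas_integrable => //.
    apply: (@bmeas_sum _ B R j (fun k x => M n k * (scut T F (p n k.+1) x - scut T F (p n k) x))) => k _.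
    by apply: bmeasZ; apply: bmeasB; exact: bmeas_scut.
  - by apply: stieltjes_bmeas_integrable => //; exact: bmeasZ.
  congr (_ + _); rewrite RintegralZl//; last exact: stieltjes_bmeas_integrable.
  congr (_ * _); rewrite RintegralB//; [|apply: stieltjes_bmeas_integrable => //; exact: bmeas_scut..].
  rewrite !integral_scut//; [|by apply: p_itvT; rewrite ltnW|exact: p_itvT].
  by ring.
exact: H.
Qed.

Let V i a := \int[leb T]_(x in `[(- t), a]) v i x.

Let bgv i : bmeas (fun x => g x * v i x).
Proof. by apply: bmeasM => //; split => //; exists L. Qed.

(** On each cell g <= M n k, and v i is nonnegative. Half-open cells suffice because [leb] does not
    charge the left end point - t. *)
Let upper n i : \int[leb T]_x (g x * v i x) <= \sum_(k < n.+1) M n k * (V i (p n k.+1) - V i (p n k)).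
Proof.
have split_itv (f : B -> R) j : bmeas f -> \int[leb T]_(x in `[(- t), p n j.+1]) f x =
    \int[leb T]_(x in `[(- t), p n j]) f x + \int[leb T]_(x in `]p n j, p n j.+1]) f x.
  move=> bf; rewrite -Rintegral_setU//; first last.
  - apply/disj_setPS => x [] /=; rewrite !in_itv/= => /andP[_ x1] /andP[x2 _].
    by move: x2; rewrite ltNge x1.
  - by apply: bmeas_integrable => //; exact: measurableU.
  rewrite -itv_bndbnd_setU// bnd_simp.
    by rewrite -(p0 n) p_nd.
  by rewrite p_nd.
have H j : \int[leb T]_(x in `[(- t), p n j]) (g x * v i x) <=
    \sum_(k < j) M n k * (V i (p n k.+1) - V i (p n k)).
  elim: j => [|j ih].
    rewrite big_ord0 p0 /Rintegral null_set_integral//.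
      by apply/measurable_EFinP; apply: measurable_funTS; exact: (bgv i).1.
    have := @lebesgue_measure_set1 R (- t).
    move=> <-; rewrite set_itv1 -[LHS]/(@lebesgue_measure R ([set - t] `&` itvT T)).
    by congr (lebesgue_measure _); apply/setIidl => x ->; exact: itvT_left.
  rewrite big_ord_recr/= split_itv// lerD// /V (split_itv (v i))// addrC addKr.
  rewrite -RintegralZl//; last exact: bmeas_integrable.
  apply: le_Rintegral => //.
  - by apply: bmeas_integrable.
  - by apply: bmeas_integrable => //; exact: bmeasZ.
  - move=> x /=; rewrite in_itv/= => /andP[/ltW x1 x2].
    by rewrite ler_wpM2r// M_ub// x1 x2.
apply: le_trans (H n.+1); rewrite pn.
rewrite le_eqVlt; apply/orP; left; apply/eqP.
rewrite [RHS]Rintegral_mkcond /Rintegral; congr fine.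
apply: ae_eq_integral => //.
- by apply/measurable_EFinP; exact: (bgv i).1.
- by apply/measurable_EFinP; apply: (bmeas_restrict (mI _) (bgv i)).1.
exists (~` (itvT T : set B)); split.
- by apply: measurableC; exact: measurable_itvT.
- by rewrite -[LHS]/(@lebesgue_measure R (~` itvT T `&` itvT T)) setICl measure0.
- move=> x /= nx xT; apply: nx => _; rewrite patchT// inE//.
Qed.

Lemma stieltjes_upper (e : R) : 0 < e -> \forall i \near Fi,
  \int[leb T]_x (g x * v i x) <= \int[m]_(x in itvT T) g x + e.
Proof.
move=> e0; have e20 : 0 < e / 2 by rewrite divr_gt0.
have L0 : 0 <= L by rewrite (le_trans (normr_ge0 (g 0))).
have mT := @measurable_itvT R T.
(* Dominated convergence: at a continuity point of g, the suprema over the cells around it tend to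
   the value of g. *)
have : \int[m]_(x in itvT T) S n x @[n --> \oo] --> \int[m]_(x in itvT T) g x.
  apply: (Rintegral_dominated_cvg (g := cst L)) => //.
  - by move=> n; apply: measurable_funTS; exact: (bS n).1.
  - exact: measurable_funTS.
  - have [A [mA A0 gA]] := gc; exists A; split => // x nx; apply: gA => xc; apply: nx => xT.
    apply/cvgrPdist_le => r r0; have [d d0 dr] := xc xT r r0.
    exists (Num.truncn (t / d)).+1 => // n /= nd.
    rewrite distrC; apply: S_dist => // k kn /andP[x1 x2].
    apply: M_dist => y /andP[y1 y2]; rewrite distrC; apply: dr.
      have : itvT T (p n k) by apply: p_itvT; exact: ltnW.
      have : itvT T (p n k.+1) by exact: p_itvT.
      rewrite /itvT/= !in_itv/= => /andP[_ q2] /andP[q1 _].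
      by rewrite (le_trans q1)// (le_trans y2).
    have : t / n.+1%:R < d.
      rewrite ltr_pdivrMr// mulrC -ltr_pdivrMr//.
      by rewrite (lt_le_trans (truncnS_gt _))// ler_nat leqW.
    have aux (a q u w : R) : a <= u -> u <= a + q -> a <= w -> w <= a + q -> q < d -> `|u - w| < d.
      by move=> *; rewrite ltr_norml; apply/andP; split; lra.
    by move: x2 y2; rewrite pS => x2 y2; apply: aux x1 x2 y1 y2.
  - by apply: stieltjes_bmeas_integrable => //; exact: bmeas_cst.
  - move=> n x xT; rewrite -(subr0 (S n x)); apply: S_dist => // k _ _.
    by apply: M_dist => y _; rewrite subr0.
(* The partition is fixed before i varies, so that only finitely many limits [v_cvg] are used. *)
move=> /cvgrPdist_le/(_ _ e20)[n _ /(_ n (leqnn n))/= Sn].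
have : \sum_(k < n.+1) M n k * (V i (p n k.+1) - V i (p n k)) @[i --> Fi] -->
    \sum_(k < n.+1) M n k * ((F (p n k.+1) - F (- t)) - (F (p n k) - F (- t))).
  apply: cvg_big => [|k _]; first exact: add_continuous.
  apply: cvgZr; apply: cvgB; apply: v_cvg; apply: p_itvT => //.
  exact: ltnW.
move=> /cvgrPdist_le/(_ _ e20); apply: filterS => i Hi.
rewrite (le_trans (upper n i))//.
have E : \sum_(k < n.+1) M n k * ((F (p n k.+1) - F (- t)) - (F (p n k) - F (- t))) = \int[m]_(x in itvT T) S n x.
  by rewrite integral_S; apply: eq_bigr => k _; ring.
rewrite E in Hi.
move: Hi Sn; rewrite !ler_norml => /andP[h1 h2] /andP[h3 h4].
rewrite (splitr e); lra.
Qed.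

End upper_bound.

Lemma stieltjes_weak_cvg_bounded (g : B -> R) (L : R) : measurable_fun setT g ->
  (forall x, `|g x| <= L) ->
  {ae m, forall x, itvT T x -> continuous_itvT_at g x} ->
  \int[leb T]_x (g x * v i x) @[i --> Fi] --> \int[m]_(x in itvT T) g x.
Proof.
move=> mg gL gc; apply/cvgrPdist_le => e e0.
have bg : bmeas g by split => //; exists L.
have mT := @measurable_itvT R T.
have h1 := stieltjes_upper mg gL gc e0.
have mNg : measurable_fun setT (\- g) by exact: measurableT_comp.
have NgL x : `|(\- g) x| <= L by rewrite /= normrN.
have Ngc : {ae m, forall x, itvT T x -> continuous_itvT_at (\- g) x}.
  have [A [mA A0 gA]] := gc; exists A; split => // x nx; apply: gA => xc; apply: nx => xT r r0.
  have [d d0 H] := xc xT r r0.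
  by exists d => // y yT xy; rewrite (_ : _ - _ = - (g x - g y)) ?normrN ?H//= opprD.
have h2 := stieltjes_upper mNg NgL Ngc e0.
apply: filterS2 h1 h2 => i h1.
rewrite (_ : \int[leb T]_x _ = - \int[leb T]_x (g x * v i x)); last first.
  rewrite -mulN1r -RintegralZl//; last by apply: bmeas_integrable => //; exact: bmeasM.
  by apply: eq_Rintegral => x _; rewrite mulNr mulN1r.
rewrite (_ : \int[m]_(x in itvT T) (\- g) x = - \int[m]_(x in itvT T) g x); last first.
  rewrite -[RHS]mulN1r -RintegralZl//; last exact: stieltjes_bmeas_integrable.
  by apply: eq_Rintegral => x _; rewrite mulN1r.
by move=> h2; rewrite ler_norml; apply/andP; split; lra.
Qed.

(* Relatively open subsets of [-T, 0] have positive Lebesgue measure. *)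
Lemma ae_le_continuous_le (g : B -> R) (L x : R) :
  {ae leb T, forall x, `|g x| <= L} -> itvT T x -> continuous_itvT_at g x -> `|g x| <= L.
Proof.
move=> [N [mN N0 gN]] xT gx; rewrite leNgt; apply/negP => Lx.
(* Half of the excess: near x the modulus of g stays at least L + r, above the almost everywhere
   bound. *)
pose r := (`|g x| - L) / 2.
have r0 : 0 < r by rewrite divr_gt0// subr_gt0.
have [d d0 dr] := gx r r0.
have /andP[tx x0] : - t <= x <= 0 by move: xT; rewrite /itvT/= in_itv.
pose a := Num.max (- t) (x - d); pose b := Num.min 0 (x + d).
have t0 : - t < 0 by rewrite oppr_lt0.
have ab : a < b by rewrite gt_max !lt_min t0; apply/andP; split; [|apply/andP; split]; lra.
have Iab : `]a, b[ `<=` itvT T.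
  move=> y; rewrite /itvT/= !in_itv/= /a /b gt_max lt_min => /andP[/andP[y1 _] /andP[y2 _]].
  by rewrite !ltW.
have IN : `]a, b[ `<=` N.
  move=> y yI; apply: gN => /= gy.
  have yd : `|x - y| < d.
    move: yI; rewrite /= in_itv/= /a /b gt_max lt_min => /andP[/andP[_ y1] /andP[_ y2]].
    by rewrite ltr_norml; apply/andP; split; lra.
  have := dr y (Iab y yI) yd; rewrite /r => h.
  have : `|g x| <= `|g x - g y| + `|g y| by rewrite -{1}(subrK (g y) (g x)) ler_normD.
  lra.
have : (leb T `]a, b[%classic <= leb T N)%E by apply: le_measure; rewrite ?inE.
rewrite N0 -[X in (X <= _)%E]/(@lebesgue_measure R (`]a, b[ `&` itvT T)) (setIidl Iab).
by rewrite lebesgue_measure_itv/= lte_fin ab -EFinB lee_fin; lra.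
Qed.

(** The essential bound is for Lebesgue measure, to which the Stieltjes measure may be singular.
    Clipping g at K changes it on a Lebesgue-null set only, and at no continuity point in [-T, 0] by
    [ae_le_continuous_le], so neither side changes. *)
Lemma stieltjes_weak_cvg (g : B -> R) (L : R) : measurable_fun setT g ->
  {ae leb T, forall x, `|g x| <= L} ->
  {ae m, forall x, itvT T x -> continuous_itvT_at g x} ->
  \int[leb T]_x (g x * v i x) @[i --> Fi] --> \int[m]_(x in itvT T) g x.
Proof.
move=> mg gL [A [mA A0 gA]]; pose K := `|L|; have K0 : 0 <= K by exact: normr_ge0.
pose h x := Num.max (- K) (Num.min (g x) K).
have mh : measurable_fun setT h by apply: measurable_maxr => //; exact: measurable_minr.
have hK x : `|h x| <= K.
  rewrite ler_norml /h le_max lexx/= ge_max ge_min lexx orbT andbT.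
  by rewrite (@le_trans _ _ 0)// oppr_le0.
have hE x : `|g x| <= L -> h x = g x.
  move=> /le_trans/(_ (ler_norm L)); rewrite ler_norml /h => /andP[g1 g2].
  by rewrite min_l// max_r.
have clip (y z : R) : `|Num.max (- K) (Num.min y K) - Num.max (- K) (Num.min z K)| <= `|y - z|.
  exact: le_trans (maxr_dist _ _ _) (minr_dist _ _ _).
have ch x : continuous_itvT_at g x -> continuous_itvT_at h x.
  move=> gx r r0; have [d d0 H] := gx r r0; exists d => // y yT xy.
  by rewrite (le_trans (clip _ _))// H.
have mT := @measurable_itvT R T.
have hc : {ae m, forall x, itvT T x -> continuous_itvT_at h x}.
  by exists A; split => // x nx; apply: gA => gx; apply: nx => xT; apply: ch; exact: gx.
have := stieltjes_weak_cvg_bounded mh hK hc.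
rewrite (_ : \int[m]_(x in itvT T) h x = \int[m]_(x in itvT T) g x); last first.
  rewrite /Rintegral; congr fine; apply: ae_eq_integral => //.
  - by apply/measurable_EFinP; exact: measurable_funTS.
  - by apply/measurable_EFinP; exact: measurable_funTS.
  - exists A; split => // x nx; apply: gA => gx; apply: nx => xT.
    by congr EFin; apply: hE; apply: ae_le_continuous_le => //; exact: gx.
rewrite (_ : (fun i => \int[leb T]_x (h x * v i x)) = (fun i => \int[leb T]_x (g x * v i x)))//.
apply/funext => i; rewrite /Rintegral; congr fine; have [mv _] := bv i.
apply: ae_eq_integral => //.
- by apply/measurable_EFinP; exact: measurable_funM.
- by apply/measurable_EFinP; exact: measurable_funM.
- have [N [mN N0 gN]] := gL; exists N; split => // x nx; apply: gN => gx; apply: nx => _.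
  by rewrite hE.
Qed.

End stieltjes_weak_convergence.

(** * Taylor's formula *)

Section taylor.
Context (R : realType).

Lemma frechetE (V W : normedModType R) (F : V -> W) (x v : V) :
  differentiable F x -> frechet F x v = 'd F x v.
Proof.
move=> dF; rewrite /frechet; have := @val_insubd _ _ (clfun V W) 0 ('d F x).
rewrite ifT /=; last first.
  rewrite inE/=; split; first exact: linearP.
  exact: diff_continuous.
by move=> H; have := congr1 (fun f => f v) H.
Qed.

Lemma is_derive_line (V W : normedModType R) (F : V -> W) (x h : V) (t : R) :
  differentiable F (x + t *: h) ->
  is_derive t (1 : R) (fun s : R => F (x + s *: h)) (frechet F (x + t *: h) h).
Proof.
move=> dF; rewrite frechetE//.
have dd := @diff_derivable _ _ _ _ _ h dF.
have E : (fun s : R => s^-1 *: (((fun s : R => F (x + s *: h)) \o shift t) (s *: (1 : R)) - F (x + t *: h))) =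
  (fun s : R => s^-1 *: ((F \o shift (x + t *: h)) (s *: h) - F (x + t *: h))).
  apply/funext => s /=; congr (_ *: (F _ - _)).
  by rewrite [s%:A]mulr1 scalerDl addrCA.
apply: DeriveDef; first by rewrite /derivable E.
by rewrite -deriveE// /derive E.
Qed.

Lemma clfun_norm_le (V W : normedModType R) (L : clfun V W) (h : V) : `|L h| <= `|L| * `|h|.
Proof.
have [->|h0] := eqVneq h 0.
  by rewrite normr0 mulr0 -{1}(scale0r 0) clfunZ scale0r normr0.
have nh : 0 < `|h| by rewrite normr_gt0.
have : `|L (`|h|^-1 *: h)| <= `|L|.
  apply: (supnorm_ub (clfun_bnd L)); rewrite /unit_ball/= normrZ normfV normr_id mulVf//.
  by rewrite gt_eqF.
by rewrite clfunZ normrZ normfV normr_id ler_pdivrMl// mulrC.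
Qed.

(** Evaluation at h is a continuous linear map on the space of continuous linear maps, so it
    commutes with the derivative. *)
Lemma is_derive_clfun_eval (V W : normedModType R) (G : R -> clfun V W) (t : R) (D : clfun V W) (h : V) :
  is_derive t (1 : R) G D -> is_derive t (1 : R) (fun s => G s h) (D h).
Proof.
move=> [dG DG].
have cG : s^-1 *: ((G \o shift t) (s *: (1 : R)) - G t) @[s --> (0 : R)^'] --> D.
  by rewrite -DG; exact: dG.
have cGh : s^-1 *: (((fun s => G s h) \o shift t) (s *: (1 : R)) - G t h) @[s --> (0 : R)^'] --> D h.
  apply/cvgrPdist_le => e e0.
  have e1 : 0 < e / (`|h| + 1) by rewrite divr_gt0// ltr_pwDr.
  move/cvgrPdist_le : cG => /(_ _ e1); apply: filterS => s sD.
  have -> : D h - s^-1 *: (((fun s => G s h) \o shift t) (s *: (1 : R)) - G t h) =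
      (D - s^-1 *: ((G \o shift t) (s *: (1 : R)) - G t)) h by [].
  rewrite (le_trans (clfun_norm_le _ _))// (le_trans (ler_wpM2r _ sD))//.
  by rewrite mulrAC -mulrA ler_piMr ?(ltW e0)// ler_pdivrMr ?ltr_pwDr// mul1r lerDl.
apply: DeriveDef; first by apply/cvg_ex; eexists; exact: cGh.
by apply/cvg_lim.
Qed.

(** The quadratic term of [f] is chosen so that f 1 = f 0, and the linear one so that f1 0 = 0; the
    mean value theorem, applied to [f] and then to [f1], gives the point. *)
Lemma taylor2_lagrange (g g1 g2 : R -> R) :
  (forall t : R, is_derive t (1 : R) g (g1 t)) -> (forall t : R, is_derive t (1 : R) g1 (g2 t)) ->
  exists2 th : R, 0 < th < 1 & g 1 - g 0 - g1 0 = 2^-1 * g2 th.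
Proof.
move=> dg dg1; pose c := g 1 - g 0 - g1 0.
pose f t := g t - g1 0 * t - c * t ^+ 2.
pose f1 t := g1 t - g1 0 - c * (2 * t).
have df (t : R) : is_derive t (1 : R) f (f1 t).
  by rewrite /f /f1; apply: is_derive_eq; rewrite /GRing.scale /=; ring.
have df1 (t : R) : is_derive t (1 : R) f1 (g2 t - c * 2).
  by rewrite /f1; apply: is_derive_eq; rewrite /GRing.scale /=; ring.
have cont (k k' : R -> R) (a b : R) : (forall t : R, is_derive t (1 : R) k (k' t)) -> {within `[a, b], continuous k}.
  move=> dk; apply: continuous_subspaceT => t; apply: differentiable_continuous.
  by apply/derivable1_diffP; exact: (@ex_derive _ _ _ _ _ _ _ (dk t)).
have [a a01 fa] := MVT ltr01 (fun t _ => df t) (cont f f1 0 1 df).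
have {}fa : f1 a = 0.
  by move: fa; rewrite subr0 mulr1 => <-; rewrite /f /c; ring.
move: a01; rewrite in_itv/= => /andP[a0 a1].
have [b b0a fb] := MVT a0 (fun t _ => df1 t) (cont f1 _ 0 a df1).
move: b0a; rewrite in_itv/= => /andP[b0 ba].
exists b; first by rewrite b0 (lt_trans ba).
have f10 : f1 0 = 0 by rewrite /f1; ring.
move: fb; rewrite fa f10 subrr subr0 => /esym/eqP; rewrite mulf_eq0 (gt_eqF a0) orbF subr_eq0.
by move=> /eqP ->; rewrite mulrCA mulVf ?mulr1// pnatr_eq0.
Qed.

(** Lagrange's form keeps the second derivative at a single path, where the distance in chi0 applies
    directly. *)
Lemma frechet_taylor2 (V : normedModType R) (U : V -> R^o) (x h : V) : C2 U ->
  exists2 th : R, 0 < th < 1 &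
    U (x + h) - U x - frechet U x h = 2^-1 * frechet (frechet U) (x + th *: h) h h.
Proof.
move=> [dU ddU _].
have dg (t : R) := is_derive_line (dU (x + t *: h)).
have dg1 (t : R) := is_derive_clfun_eval h (is_derive_line (ddU (x + t *: h))).
have [th th01 E] := taylor2_lagrange dg dg1.
have x0 : x + 0 *: h = x by rewrite scale0r addr0.
have x1 : x + 1 *: h = x + h by rewrite scale1r.
rewrite x0 x1 in E.
exists th; [exact: th01|exact: E].
Qed.

End taylor.

(** * Continuous approximation of the shifted path *)

Section paths.
Context (R : realType) (T : {posnum R}).
Local Notation t := (T%:num).
Local Notation B := (measurableTypeR R).

Lemma cpath_left (f : cpath T) (x : R) : x < - t -> f x = 0.
Proof. by move=> xt; rewrite -(cpathP f).1 /pext xt. Qed.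

Lemma cpath_right (f : cpath T) (x : R) : 0 <= x -> f x = f 0.
Proof.
move=> x0; rewrite -(cpathP f).1 /pext x0 lexx.
have -> : (x < - t) = false by apply/negbTE; rewrite -leNgt (le_trans _ x0)// oppr_le0 ltW.
by have -> : (0 < - t) = false by apply/negbTE; rewrite -leNgt oppr_le0 ltW.
Qed.

Lemma hshift_neg (f : R -> R) (e x : R) : - t <= x -> x < 0 -> hshift T f e x = f (x - e).
Proof. by move=> tx x0; rewrite /hshift /pext ltNge tx/= leNgt x0/=. Qed.

Lemma hshift0 (f : R -> R) (e : R) : hshift T f e 0 = f 0.
Proof. by rewrite /hshift pext0 ltxx. Qed.

(* A shifted path with f (- T) <> 0 would jump at - T + e. *)
Lemma is_hderiv_left0 (u : bpath T -> R) (f : cpath T) (l : R) :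
  is_hderiv u (cpath_incl f) l -> f (- t) = 0.
Proof.
move=> [s [sE _]].
near (0 : R)^'+ => e.
have e0 : 0 < e by near: e; exact: nbhs_right_gt.
have et : e < t by near: e; exact: nbhs_right_lt.
have se : bpath_val (s e) = hshift T f e by near: e; exact: sE.
have [_ _ sc] := bpathP (s e).
pose x0 := - t + e.
have x0T : itvT_open T x0 by rewrite /itvT_open/= in_itv/= /x0 lerDl ltW//=; lra.
apply/eqP; rewrite -normr_le0; apply/ler_addgt0Pr => r r0; rewrite add0r.
have /subspace_continuousP/(_ x0 x0T)/cvgrPdist_le/(_ r r0) := sc.
rewrite /within /= => /nbhs_ballP[d /= d0 H].
pose x := Num.max (- t) (x0 - d / 2).
have d20 : 0 < d / 2 by rewrite divr_gt0.
have xx0 : x < x0 by rewrite gt_max /x0; apply/andP; split; lra.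
have tx : - t <= x by rewrite le_max lexx.
have x0d : x0 - d / 2 <= x by rewrite le_max lexx orbT.
have xn : x < 0 by rewrite (lt_trans xx0)// /x0; lra.
have := H x; rewrite -ball_normE/= ger0_norm ?subr_ge0 ?(ltW xx0)//.
have -> : x0 - x < d by lra.
move=> /(_ isT); rewrite /itvT_open/= in_itv/= tx xn => /(_ isT).
move=> sr; have {sr} : `|s e x0 - s e x| <= r by exact: sr.
have x0n : x0 < 0 by rewrite /x0; lra.
have tx0 : - t <= x0 by rewrite /x0; lra.
rewrite se !hshift_neg//.
rewrite [f (x - e)]cpath_left; last by move: xx0; rewrite /x0; lra.
by rewrite subr0 /x0 addrK.
Unshelve. all: by end_near. Qed.

(** When f (- t) = 0, the continuation by 0 on the left is also the continuation by a constant, that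
    is, the composition of f with the clamp onto [-T, 0]. *)
Lemma cpath_continuous (f : cpath T) : f (- t) = 0 -> continuous f.
Proof.
move=> f0; pose c (x : R) : R := Num.max (- t) (Num.min x 0).
have t0 : - t <= 0 by rewrite oppr_le0 ltW.
have cc : continuous c.
  move=> x; apply: (@continuous_max R _ (cst (- t)) (fun x : R => Num.min x 0)); first exact: cvg_cst.
  by apply: (@continuous_min _ _ id (cst 0)); [exact: cvg_id|exact: cvg_cst].
have cT x : itvT T (c x).
  by rewrite /itvT/= in_itv/= le_max lexx/= ge_max t0 ge_min lexx orbT.
have fE : f = f \o c :> (R -> R).
  apply/funext => x /=; rewrite /c; have [x0|x0] := leP x 0; last first.
    by rewrite (cpath_right f (ltW x0)) max_r.
  by have [tx|xt] := leP (- t) x; [|rewrite cpath_left// f0].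
rewrite fE => x.
have /subspace_continuousP/(_ (c x) (cT x)) := (cpathP f).2.
apply: cvg_comp => U; rewrite /within/= => domU.
have {}domU : \forall r \near x, itvT T (c r) -> U (c r) by exact: cc domU.
by apply: filterS domU => r; apply.
Qed.

Lemma cpath_bounded (f : cpath T) : exists2 M : R, 0 < M & forall x, `|f x| <= M.
Proof.
have [M fM] := cpath_bnd f; exists (Num.max 1 M); first by rewrite lt_max ltr01.
move=> x; rewrite -(cpathP f).1 /pext.
case: ifPn => [_|]; first by rewrite normr0 le_max ler01.
rewrite -leNgt => tx; case: ifPn => [_|]; first by rewrite le_max fM ?orbT//; exact: itvT0.
by rewrite -ltNge => x0; rewrite le_max fM ?orbT// /itvT/= in_itv/= tx ltW.
Qed.

Lemma continuous_bmeas (f : R -> R) (M : R) : continuous f -> (forall x, `|f x| <= M) -> bmeas (f : B -> R).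
Proof. by move=> fc fM; split; [exact: continuous_measurable_fun|exists M]. Qed.

End paths.

Section cutoff_increment.
Context (R : realType) (T : {posnum R}) (eta : cpath T) (M : R).
Local Notation t := (T%:num).
Local Notation B := (measurableTypeR R).
Hypothesis eta0 : eta (- t) = 0.
Hypothesis M0 : 0 < M.
Hypothesis etaM : forall x, `|eta x| <= M.

(** Piecewise linear: 1 up to - d, then decreasing to 0 at 0. *)
Definition cutoff (d x : R) : R := Num.min 1 (Num.max 0 (- x / d)).

(** The sign is that of the shifted path minus eta, opposite to the increment in the backward
    integral. *)
Definition incr (e x : R) : R := eta (x - e) - eta x.

Definition cut_incr (d e x : R) : R := cutoff d x * incr e x.

Lemma cutoff01 (d x : R) : 0 <= cutoff d x <= 1.
Proof. by rewrite /cutoff le_min ler01 le_max lexx/= ge_min lexx. Qed.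

Lemma cutoff1 (d x : R) : 0 < d -> x <= - d -> cutoff d x = 1.
Proof.
move=> d0 xd; have h : 1 <= - x / d by rewrite ler_pdivlMr// mul1r; lra.
by rewrite /cutoff max_r ?min_l// (le_trans ler01).
Qed.

Lemma cutoff0 (d x : R) : 0 < d -> 0 <= x -> cutoff d x = 0.
Proof.
move=> d0 x0; have h : - x / d <= 0 by rewrite ler_pdivrMr// mul0r oppr_le0.
by rewrite /cutoff max_l// min_r.
Qed.

Lemma cutoff_continuous (d : R) : continuous (cutoff d).
Proof.
move=> x; apply: (@continuous_min R _ (cst 1) (fun x : R => Num.max 0 (- x / d))); first exact: cvg_cst.
apply: (@continuous_max R _ (cst 0) (fun x : R => - x / d)); first exact: cvg_cst.
by apply: cvgM; [apply: cvgN; exact: cvg_id|exact: cvg_cst].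
Qed.

Lemma incr_continuous (e : R) : continuous (incr e).
Proof.
have ec := cpath_continuous eta0.
move=> x; apply: cvgB; last exact: ec.
apply: (@cvg_comp _ _ _ (fun s => s - e) eta); last exact: ec.
by apply: cvgB; [exact: cvg_id|exact: cvg_cst].
Qed.

Lemma cut_incr_continuous (d e : R) : continuous (cut_incr d e).
Proof. by move=> x; apply: cvgM; [exact: cutoff_continuous|exact: incr_continuous]. Qed.

Lemma incr_le (e x : R) : `|incr e x| <= 2 * M.
Proof. by rewrite (le_trans (ler_normB _ _))// mulr_natl mulr2n lerD. Qed.

Lemma cut_incr_le (d e x : R) : `|cut_incr d e x| <= `|incr e x|.
Proof.
have /andP[c0 c1] := cutoff01 d x.
by rewrite /cut_incr normrM ger0_norm// ler_piMl.
Qed.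

Lemma bmeas_incr (e : R) : bmeas (incr e : B -> R).
Proof. exact: (continuous_bmeas (@incr_continuous e) (incr_le e)). Qed.

Lemma bmeas_cut_incr (d e : R) : bmeas (cut_incr d e : B -> R).
Proof.
apply: (continuous_bmeas (M := 2 * M) (@cut_incr_continuous d e)) => x.
by rewrite (le_trans (cut_incr_le _ _ _))// incr_le.
Qed.

Lemma cut_incr_ge0 (d e x : R) : 0 < d -> 0 <= x -> cut_incr d e x = 0.
Proof. by move=> d0 x0; rewrite /cut_incr cutoff0// mul0r. Qed.

Lemma cut_incr_left (d e x : R) : 0 < e -> x < - t -> cut_incr d e x = 0.
Proof.
move=> e0 xt; rewrite /cut_incr /incr !cpath_left ?subrr ?mulr0//.
by rewrite (lt_trans _ xt)// ltrBlDr ltrDl.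
Qed.

Lemma cut_incr_eq (d e x : R) : 0 < d -> x <= - d -> cut_incr d e x = incr e x.
Proof. by move=> d0 xd; rewrite /cut_incr cutoff1// mul1r. Qed.

Lemma cut_incr_cpath (d e : R) : 0 < d -> 0 < e -> cut_incr d e \in cpath_pred T.
Proof.
move=> d0 e0; rewrite inE/=; split; last exact/continuous_subspaceT/cut_incr_continuous.
apply/funext => x; rewrite /pext; case: ifPn => [xt|_]; first by rewrite cut_incr_left.
by case: ifPn => // x0; rewrite !cut_incr_ge0.
Qed.

End cutoff_increment.

Section approximation.
Context (R : realType) (T : {posnum R}) (eta : cpath T) (M : R).
Local Notation t := (T%:num).
Local Notation B := (measurableTypeR R).
Hypothesis eta0 : eta (- t) = 0.
Hypothesis M0 : 0 < M.
Hypothesis etaM : forall x, `|eta x| <= M.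

(** A neighbourhood in the inductive topology, read among paths bounded by M, looks only at a
    compact K of [-T, 0[ and at 0. There the shifted path and eta + h coincide as soon as the cutoff
    acts to the right of K. *)
Lemma hshift_approx (u : bpath T -> R^o) (e r : R) (f : bpath T) :
  continuous u -> 0 < e -> 0 < r -> bpath_val f = hshift T eta e ->
  exists2 d0 : R, 0 < d0 & forall d (h : cpath T), 0 < d <= d0 ->
    h = cut_incr eta d e :> (R -> R) -> `|u f - u (cpath_incl (eta + h))| <= r.
Proof.
move=> uc e0 r0 fE.
have fM : bpath_le M f.
  move=> x; rewrite /itvT/= in_itv/= fE => /andP[tx x0].
  have [xn|xp] := ltP x 0; first by rewrite hshift_neg.
  by rewrite (_ : x = 0) ?hshift0//; apply/eqP; rewrite eq_le x0 xp.
have /cvgrPdist_le/(_ r r0) := uc f.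
rewrite nearE nbhsE => -[A [oA Af] AB].
have [K [s [cK Kd s0 KA]]] : exists K (s : R), [/\ compact K, K `<=` itvT_open T, 0 < s
      & forall g, bpath_le M g -> seminormK K (g \- f) < s -> A g].
  have oA' : bpath_open A by exact: oA.
  exact: oA' M0 f fM Af.
(* K is closed and avoids 0, so it stays at a positive distance from 0. *)
have [d0 d00 Kd0] : exists2 d0 : R, 0 < d0 & forall x, K x -> x <= - d0.
  have : nbhs (0 : R) (~` K).
    apply: open_nbhs_nbhs; split; last by move=> /Kd; rewrite /itvT_open/= in_itv/= ltxx andbF.
    by rewrite openC; apply: compact_closed => //; exact: Rhausdorff.
  move=> /nbhs_ballP[d /= d0 dK]; exists d => // x Kx; rewrite leNgt; apply/negP => dx.
  have /andP[_ x0] : - t <= x < 0 by have := Kd x Kx; rewrite /itvT_open/= in_itv.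
  apply: (dK x) => //; rewrite -ball_normE/= sub0r normrN ltr0_norm//; lra.
exists d0 => // d h /andP[dp dd0] hE; apply: AB; apply: KA => [x xT|].
  have -> : cpath_incl (eta + h) x = eta x + cut_incr eta d e x by rewrite -hE.
  have /andP[c0 c1] := cutoff01 d x.
  (* Written as a convex combination, the path inherits the bound M, so it is admissible for the
     chosen neighbourhood. *)
  rewrite /cut_incr /incr (_ : _ + _ = (1 - cutoff d x) * eta x + cutoff d x * eta (x - e)); last by ring.
  rewrite (le_trans (ler_normD _ _))// !normrM (ger0_norm c0) ger0_norm ?subr_ge0//.
  rewrite (@le_trans _ _ ((1 - cutoff d x) * M + cutoff d x * M))//; last by rewrite -mulrDl subrK mul1r.
  by rewrite lerD// ler_wpM2l// subr_ge0.
have hK x : K x -> (cpath_incl (eta + h) \- f) x = 0.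
  move=> Kx; have /andP[tx x0] : - t <= x < 0 by have := Kd x Kx; rewrite /itvT_open/= in_itv.
  have -> : (cpath_incl (eta + h) \- f) x = eta x + cut_incr eta d e x - hshift T eta e x.
    by rewrite -hE -fE.
  rewrite hshift_neg// cut_incr_eq//; last by rewrite (le_trans (Kd0 x Kx))// lerN2.
  by rewrite /incr subrKC subrr.
have h0 : (cpath_incl (eta + h) \- f) 0 = 0.
  have -> : (cpath_incl (eta + h) \- f) 0 = eta 0 + cut_incr eta d e 0 - hshift T eta e 0.
    by rewrite -hE -fE.
  by rewrite hshift0 cut_incr_ge0// addr0 subrr.
apply: le_lt_trans s0; rewrite /seminormK h0 normr0 addr0.
have [->|/set0P K0] := eqVneq K set0; first by rewrite /supnorm image_set0 sup0.
by apply: supnorm_le => // x Kx; rewrite hK// normr0.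
Qed.

(** At each x < 0 the cutoff is eventually 1. The point 0 must be excluded: the cut increment
    vanishes there, the full one need not. *)
Lemma Rintegral_cut_incr_cvg (m : {finite_measure set B -> \bar R}) (D : set B) (e : R) :
  measurable D -> (forall x, D x -> x < 0) ->
  \int[m]_(x in D) cut_incr eta n.+1%:R^-1 e x @[n --> \oo] --> \int[m]_(x in D) incr eta e x.
Proof.
move=> mD D0; apply: (Rintegral_dominated_cvg (g := cst (2 * M))) => //.
- by move=> n; apply: measurable_funTS; exact: (bmeas_cut_incr eta0 etaM _ _).1.
- by apply: measurable_funTS; exact: (bmeas_incr eta0 etaM _).1.
- apply: aeW => x Dx; have x0 := D0 x Dx; apply: cvg_near_cst.
  exists (Num.truncn (- x)^-1).+1 => // n /= nx.
  apply: cut_incr_eq; first by rewrite invr_gt0.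
  have xp : 0 < - x by rewrite oppr_gt0.
  rewrite lerNr -[leRHS]invrK lef_pV2 ?posrE ?invr_gt0//.
  by rewrite (le_trans (ltW (truncnS_gt _)))// ler_nat ltnW.
- by apply: bmeas_integrable => //; exact: bmeas_cst.
- by move=> n x _; rewrite (le_trans (cut_incr_le _ _ _ _))// incr_le.
Qed.

Lemma cintegral_cut_incr_cvg (nu : {charge set B -> \bar R}) (e : R) :
  cintegral (charge_perp nu) (itvT T) (cut_incr eta n.+1%:R^-1 e) @[n --> \oo] -->
  cintegral (charge_perp nu) (itvT T) (incr eta e).
Proof.
have mT := @measurable_itvT R T.
pose D : set B := itvT T `&` ~` [set 0].
have mD : measurable D by apply: measurableI => //; exact: measurable_setC0.
have D0 x : D x -> x < 0.
  by move=> [+ /eqP x0]; rewrite /itvT/= in_itv/= => /andP[_]; rewrite lt_neqAle x0.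
rewrite cintegral_charge_perp//; last exact: (bmeas_incr eta0 etaM).
have [m1 [m2 [_ E]]] := cintegralE nu.
rewrite E (_ : (fun n => _) = (fun n => \int[m1]_(x in D) cut_incr eta n.+1%:R^-1 e x -
    \int[m2]_(x in D) cut_incr eta n.+1%:R^-1 e x)).
  by apply: cvgB; exact: Rintegral_cut_incr_cvg.
apply/funext => n; rewrite -E cintegral_charge_perp//.
exact: (bmeas_cut_incr eta0 etaM).
Qed.

End approximation.

(** * Estimates for the normalized increments *)

Section leb_estimates.
Context (R : realType) (T : {posnum R}).
Local Notation t := (T%:num).
Local Notation B := (measurableTypeR R).

Lemma leb_tail_le (d : R) : 0 < d -> (leb T `](- d)%R, +oo[%classic <= d%:E)%E.
Proof.
move=> d0; rewrite -[X in (X <= _)%E]/(@lebesgue_measure R (`](- d)%R, +oo[ `&` itvT T)).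
apply: (@le_trans _ _ (@lebesgue_measure R `](- d)%R, 0%R]%classic)).
  apply: le_measure; rewrite ?inE.
  - by apply: measurableI; [exact: measurable_itv|exact: measurable_itvT].
  - exact: measurable_itv.
  - by move=> x []; rewrite /itvT/= !in_itv/= andbT => -> /andP[_ ->].
by rewrite lebesgue_measure_itv/= lte_fin oppr_lt0 d0 -EFinB lee_fin sub0r opprK.
Qed.

Lemma leb_Rintegral_dist (A : set B) (f g : B -> R) (K d : R) :
  measurable A -> bmeas f -> bmeas g -> 0 < d -> 0 <= K ->
  (forall x, `|f x - g x| <= K) -> (forall x : R, x <= - d -> f x = g x) ->
  `|\int[leb T]_(x in A) f x - \int[leb T]_(x in A) g x| <= K * d.
Proof.
move=> mA bf bg d0 K0 fgK fg.
have mI : measurable (`](- d), +oo[%classic : set B) by exact: measurable_itv.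
have bfg := bmeasB bf bg.
have bI : bmeas (\1_`](- d), +oo[%classic : B -> R) by exact: bmeas_indic.
rewrite -RintegralB//; [|exact: bmeas_integrable|exact: bmeas_integrable].
rewrite (le_trans (le_normr_Rintegral _ _))//; first exact: bmeas_integrable.
rewrite (@le_trans _ _ (\int[leb T]_(x in A) (K * \1_`](- d), +oo[%classic x)))//.
  apply: le_Rintegral => //.
  - by apply: (integrable_norm (f := fun x => f x - g x)); exact: bmeas_integrable.
  - by apply: bmeas_integrable => //; exact: bmeasZ.
  - move=> x _; have [xd|dx] := leP x (- d).
      by rewrite fg// subrr normr0 mulr_ge0// indicE.
    by rewrite indicE mem_set ?mulr1//= in_itv/= dx.
rewrite RintegralZl//; last exact: bmeas_integrable.
rewrite ler_wpM2l// /Rintegral integral_indic//.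
rewrite -lee_fin fineK ?fin_num_measure//; last exact: measurableI.
apply: le_trans (leb_tail_le d0).
by apply: le_measure; rewrite ?inE//; exact: measurableI.
Qed.

End leb_estimates.

Section incr_estimates.
Context (R : realType) (T : {posnum R}) (eta : cpath T) (M : R).
Local Notation t := (T%:num).
Local Notation B := (measurableTypeR R).
Hypothesis eta0 : eta (- t) = 0.
Hypothesis M0 : 0 < M.
Hypothesis etaM : forall x, `|eta x| <= M.

(** The integral of eta(. - e) - eta reduces to integrals over two end intervals of length e.
    Division by sqrt e still leaves a null limit, which is the source of the weak convergence to
    0. *)
Lemma leb_incr_le (a b e : R) : 0 <= e ->
  `|\int[leb T]_(x in `]a, b]) incr eta e x| <= 2 * M * e.
Proof.
move=> e0; have ec := cpath_continuous eta0.
have bi := bmeas_incr eta0 etaM e.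
have mab : measurable (`]a, b]%classic : set B) by exact: measurable_itv.
have mT := @measurable_itvT R T.
have M20 : 0 <= 2 * M * e by rewrite !mulr_ge0// ltW.
have -> : \int[leb T]_(x in `]a, b]) incr eta e x =
    \int[@lebesgue_measure R]_(x in itvT T `&` `]a, b]) incr eta e x.
  rewrite Rintegral_mkcond leb_Rintegral_itvT; last exact: (bmeas_restrict mab bi).1.
  by rewrite leb_Rintegral// -Rintegral_mkcondr.
(* Clipping ]a, b] to [-T, 0] gives an interval closed on the left exactly when a < - t, hence the
   two cases below. *)
pose a' := Num.max a (- t); pose b' := Num.min b 0.
have [ab|ba] := leP a' b'; last first.
  rewrite (_ : _ `&` _ = set0) ?Rintegral_set0 ?normr0// -subset0 => x [].
  rewrite /itvT/= !in_itv/= => /andP[tx x0] /andP[ax xb].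
  have h1 : a' <= x by rewrite ge_max tx ltW.
  have h2 : x <= b' by rewrite le_min xb x0.
  by have := lt_le_trans ba (le_trans h1 h2); rewrite ltxx.
have ic := incr_continuous eta0 (e := e).
have -> : \int[@lebesgue_measure R]_(x in itvT T `&` `]a, b]) incr eta e x =
    \int[@lebesgue_measure R]_(x in `[a', b']) incr eta e x.
  have [at'|ta] := ltP a (- t).
    congr (Rintegral _ _ _); apply/seteqP; split => x; rewrite /itvT/= !in_itv/= /a' max_r ?(ltW at')// /b'.
      by move=> [/andP[-> x0] /andP[_ xb]]; rewrite le_min xb x0.
    rewrite le_min => /andP[tx /andP[xb x0]]; rewrite tx x0 xb andbT; split => //.
    by rewrite andbT; exact: lt_le_trans tx.
  rewrite /a' max_l// -Rintegral_itv_obnd_cbnd; last first.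
    by apply: integrableS (continuous_itv_integrable a b' ic) => //; apply: subset_itv; rewrite ?bnd_simp.
  congr (Rintegral _ _ _); apply/seteqP; split => x; rewrite /itvT/= !in_itv/= /b'.
    by move=> [/andP[_ x0] /andP[-> xb]]; rewrite le_min xb x0.
  by rewrite le_min => /andP[ax /andP[-> ->]]; rewrite ax (le_trans ta)// ltW.
rewrite RintegralB//; last 2 first.
- apply: (continuous_itv_integrable (f := fun x => eta (x - e))) => x.
  apply: (@cvg_comp _ _ _ (fun s => s - e) eta); last exact: ec.
  by apply: cvgB; [exact: cvg_id|exact: cvg_cst].
- exact: continuous_itv_integrable.
exact: Rintegral_shift_dist.
Qed.

Variable h : R -> B -> R.
Hypothesis bh : forall e, bmeas (h e).
Hypothesis hE : \forall e \near 0^'+, exists2 d : R, 0 < d <= e ^+ 2 & h e = cut_incr eta d e.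

(* Normalized so that the squares are the densities defining the quadratic variation. *)
Definition scaled (e : R) (x : B) : R := (Num.sqrt e)^-1 * h e x.

Lemma bmeas_scaled (e : R) : bmeas (scaled e).
Proof. exact: bmeasZ. Qed.

Lemma sqr_scaled (e : R) (x : B) : 0 < e -> scaled e x ^+ 2 = e^-1 * h e x ^+ 2.
Proof. by move=> e0; rewrite /scaled exprMn exprVn sqr_sqrtr// ltW. Qed.

Lemma cvg_sqr_scaled (a : R) : has_qvar T eta -> itvT T a ->
  \int[leb T]_(x in `[(- t), a]) (scaled e x ^+ 2) @[e --> 0^'+] --> qvar eta a - qvar eta (- t).
Proof.
move=> eq ia; apply: (cvg_sub0 _ (cvg_incr2 (cpath_continuous eta0) eq ia)).
apply/cvgr0Pnorm_le => r r0.
have mI : measurable (`[(- t), a]%classic : set B) by exact: measurable_itv.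
pose K := (2 * M) ^+ 2; have K0 : 0 < K by rewrite exprn_gt0// mulr_gt0.
near=> e; have e0 : 0 < e by near: e; exact: nbhs_right_gt.
(* The cutoff error is at most K * d / e, and d <= e ^+ 2 makes it at most K * e. *)
have eK : e <= r / K by near: e; apply: nbhs_right_le; rewrite divr_gt0.
have [d /andP[d0 de] hd] : exists2 d : R, 0 < d <= e ^+ 2 & h e = cut_incr eta d e by near: e.
rewrite !fctE.
have bi := bmeas_incr eta0 etaM e; have bi2 := bmeasM bi bi; have bh2 := bmeasM (bh e) (bh e).
rewrite (_ : \int[leb T]_(x in `[(- t), a]) (scaled e x ^+ 2) =
    e^-1 * \int[leb T]_(x in `[(- t), a]) (h e x * h e x)); last first.
  rewrite -RintegralZl//; last exact: bmeas_integrable.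
  by apply: eq_Rintegral => x _; rewrite sqr_scaled.
rewrite [X in _ - X]mulrC -mulrBr normrM gtr0_norm ?invr_gt0// ler_pdivrMl//.
have : `|\int[leb T]_(x in `[(- t), a]) (h e x * h e x) -
    \int[leb T]_(x in `[(- t), a]) (incr eta e x * incr eta e x)| <= K * d.
  apply: leb_Rintegral_dist => //; first exact: ltW.
    move=> x; have hx : `|h e x| <= `|incr eta e x| by rewrite hd cut_incr_le.
    have ix := incr_le etaM e x.
    rewrite distrC ger0_norm.
      rewrite lerBlDr (le_trans (_ : _ <= K)) ?lerDl -?expr2 ?sqr_ge0//.
      by rewrite -real_normK ?num_real// /K lerXn2r ?nnegrE// mulr_ge0// ltW.
    by rewrite subr_ge0 -!expr2 -real_normK ?num_real// -[leRHS]real_normK ?num_real// lerXn2r ?nnegrE.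
  by move=> x xd; rewrite hd cut_incr_eq.
move=> /le_trans; apply; rewrite (le_trans (ler_wpM2l (ltW K0) de))// expr2 mulrCA.
by rewrite ler_pM2l// mulrC -ler_pdivlMr.
Unshelve. all: by end_near. Qed.

Lemma cvg_scaled0 (a b : R) : \int[leb T]_(x in `]a, b]) scaled e x @[e --> 0^'+] --> (0 : R).
Proof.
apply/cvgr0Pnorm_le => r r0.
have mI : measurable (`]a, b]%classic : set B) by exact: measurable_itv.
have M40 : 0 < 4 * M by rewrite mulr_gt0.
near=> e; have e0 : 0 < e by near: e; exact: nbhs_right_gt.
have e1 : e <= 1 by near: e; exact: nbhs_right_le.
(* The integral of the full increment and the effect of the cutoff are each at most 2 * M * e;
   divided by sqrt e, their sum is at most 4 * M * sqrt e. *)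
have er : e <= (r / (4 * M)) ^+ 2 by near: e; apply: nbhs_right_le; rewrite exprn_gt0// divr_gt0.
have [d /andP[d0 de] hd] : exists2 d : R, 0 < d <= e ^+ 2 & h e = cut_incr eta d e by near: e.
have bi := bmeas_incr eta0 etaM e.
rewrite RintegralZl//; last exact: bmeas_integrable.
have h1 := leb_incr_le a b (ltW e0).
have h2 : `|\int[leb T]_(x in `]a, b]) h e x - \int[leb T]_(x in `]a, b]) incr eta e x| <= 2 * M * d.
  apply: leb_Rintegral_dist => //.
  - by rewrite mulr_ge0// ltW.
  - move=> x; have /andP[c0 c1] := cutoff01 d x.
    rewrite hd /cut_incr -[X in _ - X]mul1r -mulrBl normrM distrC [X in X * _]ger0_norm ?subr_ge0//.
    by rewrite (le_trans _ (incr_le etaM e x))// ler_piMl// gerBl.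
  - by move=> x xd; rewrite hd cut_incr_eq.
have de' : d <= e by rewrite (le_trans de)// expr2 ler_piMr// ltW.
have h3 : `|\int[leb T]_(x in `]a, b]) h e x| <= 4 * M * e.
  rewrite -(subrK (\int[leb T]_(x in `]a, b]) incr eta e x) (\int[leb T]_(x in `]a, b]) h e x)).
  rewrite (le_trans (ler_normD _ _))// (le_trans (lerD h2 h1))//.
  have : 2 * M * d <= 2 * M * e by rewrite ler_wpM2l// mulr_ge0// ltW.
  lra.
have s0 : 0 < Num.sqrt e by rewrite sqrtr_gt0.
rewrite normrM gtr0_norm ?invr_gt0// ler_pdivrMl// (le_trans h3)//.
rewrite -{1}(sqr_sqrtr (ltW e0)) expr2 mulrCA ler_pM2l// mulrC -ler_pdivlMr//.
have rM : 0 <= r / (4 * M) by rewrite divr_ge0// ltW.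
by rewrite -(ger0_norm rM) -sqrtr_sqr ler_sqrt// sqr_ge0.
Unshelve. all: by end_near. Qed.

(** The squared norms converge, to the total mass of the quadratic variation, so they are eventually
    bounded. *)
Lemma scaled_bounded : has_qvar T eta ->
  exists2 C : R, 0 < C & \forall e \near 0^'+, \int[leb T]_x (scaled e x ^+ 2) <= C ^+ 2.
Proof.
move=> eq; have := cvg_sqr_scaled eq (itvT0 T).
set q := qvar eta 0 - _ => /cvgrPdist_le/(_ 1 ltr01) H.
have q1 : 0 < `|q| + 1 by rewrite ltr_pwDr.
exists (Num.sqrt (`|q| + 1)); first by rewrite sqrtr_gt0.
apply: filterS H => e He; rewrite sqr_sqrtr; last exact: ltW.
rewrite leb_Rintegral_itvT; last first.
  by apply: measurable_funX; exact: (bmeas_scaled e).1.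
have := ler_norm q; move: He; rewrite ler_norml => /andP[H1 _] H2.
rewrite -/(itvT T) in H1; lra.
Qed.

Lemma increments_small (r : R) : 0 < r -> \forall e \near 0^'+, forall x, itvT T x -> `|h e x| <= r.
Proof.
move=> r0; have ec := cpath_continuous eta0.
have := @uniform_modulus R eta (- t) 0 r ec r0.
move=> H; near=> e; move=> x; have e0 : 0 < e by near: e; exact: nbhs_right_gt.
rewrite /itvT/= in_itv/= => xT.
have [d _ ->] : exists2 d : R, 0 < d <= e ^+ 2 & h e = cut_incr eta d e by near: e.
rewrite (le_trans (cut_incr_le _ _ _ _))// distrC.
have He : forall x y : R, - t <= x <= 0 -> `|x - y| <= e -> `|eta x - eta y| <= r by near: e.
by apply: He => //; rewrite opprB addrC subrK gtr0_norm.
Unshelve. all: by end_near. Qed.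

End incr_estimates.

Section paths_choice.
Context (R : realType) (T : {posnum R}) (eta : cpath T) (M : R).
Local Notation t := (T%:num).
Local Notation B := (measurableTypeR R).
Hypothesis eta0 : eta (- t) = 0.
Hypothesis M0 : 0 < M.
Hypothesis etaM : forall x, `|eta x| <= M.

(** f stands for the shifted path. The two tolerances make the replacement of the shift by a
    continuous path invisible after division by e. *)
Definition good_increment (u : bpath T -> R^o) (nu : {charge set B -> \bar R}) (f : bpath T)
    (e : R) (h : cpath T) : Prop :=
  exists2 d : R, 0 < d <= e ^+ 2 & [/\ h = cut_incr eta d e :> (R -> R),
    `|u f - u (cpath_incl (eta + h))| <= e ^+ 2 &
    `|cintegral (charge_perp nu) (itvT T) h - cintegral (charge_perp nu) (itvT T) (incr eta e)|
      <= e ^+ 2].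

Lemma exists_good_increment u nu f (e : R) : continuous u -> 0 < e ->
  bpath_val f = hshift T eta e -> exists h, good_increment u nu f e h.
Proof.
move=> uc e0 fE; have e20 : 0 < e ^+ 2 by rewrite exprn_gt0.
have [d0 d00 Hu] := hshift_approx M0 etaM uc e0 e20 fE.
have := @cintegral_cut_incr_cvg _ _ _ _ eta0 etaM nu e.
move=> /cvgrPdist_le/(_ _ e20)[N _ HN].
pose c := Num.min d0 (e ^+ 2); have c0 : 0 < c by rewrite lt_min d00 e20.
(* The width d is taken of the form 1 / (n + 1) because dominated convergence was applied along this
   sequence; n is large enough for both tolerances and for d <= e ^+ 2. *)
pose n := maxn N (Num.truncn c^-1).+1.
pose d : R := n.+1%:R^-1.
have dp : 0 < d by rewrite invr_gt0.
have dc : d <= c.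
  rewrite -[leRHS]invrK lef_pV2 ?posrE ?invr_gt0//.
  by rewrite (le_trans (ltW (truncnS_gt _)))// ler_nat /n leqW// leq_maxr.
move: (dc); rewrite le_min => /andP[dd0 de].
exists (CPath (cut_incr_cpath eta0 dp e0)); exists d; first by rewrite dp de.
split => //.
- by apply: (Hu d) => //; rewrite dp dd0.
- by rewrite distrC; apply: HN; rewrite /= leq_maxl.
Qed.

Lemma increments_choice u nu (s : R -> bpath T) : continuous u ->
  exists h : R -> cpath T,
  [/\ forall e, bmeas (h e : B -> R), forall e, h e 0 = 0,
    forall e x, ~ itvT T x -> h e x = 0 &
    forall e, 0 < e -> bpath_val (s e) = hshift T eta e -> good_increment u nu (s e) e (h e)].
Proof.
move=> uc.
have H e : exists h : cpath T, [/\ bmeas (h : B -> R), h 0 = 0, forall x, ~ itvT T x -> h x = 0 &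
    0 < e -> bpath_val (s e) = hshift T eta e -> good_increment u nu (s e) e h].
  have [[e0 sE]|ne] := pselect (0 < e /\ bpath_val (s e) = hshift T eta e); last first.
    exists 0; split => //; first exact: bmeas_cst.
    by move=> e0 sE; exfalso; apply: ne.
  have [h gh] := exists_good_increment nu uc e0 sE.
  have [d /andP[d0 _] [hE _ _]] := gh.
  exists h; split => //; rewrite hE.
  - exact: (bmeas_cut_incr eta0 etaM).
  - by rewrite cut_incr_ge0.
  - move=> x; rewrite /itvT/= in_itv/= => /negP; rewrite negb_and -!ltNge => /orP[xt|x0].
      exact: cut_incr_left.
    by rewrite cut_incr_ge0// ltW.
have [h Hh] := choice H.
by exists h; split => e; have [] := Hh e.
Qed.

End paths_choice.

Lemma cpath_norm_le (R : realType) (T : {posnum R}) (h : cpath T) (r : R) :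
  (forall x, itvT T x -> `|h x| <= r) -> `|h| <= r.
Proof. by move=> hr; apply: supnorm_le => //; exact: itvT_neq0. Qed.

Lemma continuous_itvT_atP (R : realType) (T : {posnum R}) (g : R -> R) (x : R) :
  itvT T x -> {for x, continuous (g : subspace (itvT T) -> R)} -> continuous_itvT_at T g x.
Proof.
move=> xT gx r r0; move: gx => /cvgrPdist_le/(_ r r0).
move=> gx; have : within (itvT T) (nbhs x) (fun y => `|g x - g y| <= r).
  by rewrite nbhs_subspace_in.
move=> /nbhs_ballP[d /= d0 H]; exists d => // y yT xy.
exact: H.
Qed.

(** * The limit of the backward quotient *)

Theorem proposition2p40 (R : realType) (T : {posnum R})
    (U : cpath T -> R^o) (D2U : cpath T -> chi0 T)
    (u : bpath T -> R^o) (D2u : bpath T -> chi0 T)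
    (eta : cpath T) (DU : {charge set (measurableTypeR R) -> \bar R})
    (DHU : R)
    (U_C2 : C2 U)
    (D2U_chi0 : forall f phi psi : cpath T,
       frechet (frechet U) f phi psi = chi0_form (D2U f) phi psi)
    (D2U_cont : chi0_continuous D2U)
    (u_cont : continuous u)
    (u_ext : forall f : cpath T, u (cpath_incl f) = U f)
    (D2u_cont : chi0_continuous D2u)
    (D2u_ext : forall f : cpath T, chi0_eq (D2u (cpath_incl f)) (D2U f))
    (eta_qvar : has_qvar T eta)
    (DU_eta : forall phi : cpath T, frechet U eta phi = cintegral DU (itvT T) phi)
    (diag_disc :
       (dqvar T eta).-negligible (discontinuities T (chi0_g4 (D2U eta))))
    (DHU_eta : is_hderiv u (cpath_incl eta) DHU) :
  exists2 I : R, is_backward_integral T (charge_perp DU) eta I &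
    DHU = I - 2^-1 * \int[dqvar T eta]_(x in itvT T) chi0_g4 (D2U eta) x.
Proof.
have eta0 := is_hderiv_left0 DHU_eta.
have [M M0 etaM] := cpath_bounded eta.
have [s [sE Hs]] := DHU_eta.
have [h [bh h0 hT Hh]] := increments_choice eta0 M0 etaM DU s u_cont.
have mT := @measurable_itvT R T.
set g4 := chi0_g4 (D2U eta).
set J := \int[dqvar T eta]_(x in itvT T) g4 x.
(* The formula dictates the value of the integral; what remains is convergence to it. *)
exists (DHU + 2^-1 * J); last by rewrite addrK.
have good : \forall e \near 0^'+, good_increment eta u DU (s e) e (h e).
  by near=> e; apply: Hh; [near: e; exact: nbhs_right_gt|near: e; exact: sE].
have hE : \forall e \near 0^'+, exists2 d : R, 0 < d <= e ^+ 2 & h e = cut_incr eta d e :> (R -> R).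
  by apply: filterS good => e [d de [hd _ _]]; exists d.
pose w := scaled (fun e => h e).
have bw e : bmeas (w e) by exact: bmeas_scaled.
have [C C0 wC] := scaled_bounded eta0 M0 etaM bh hE eta_qvar.
pose form e := chi0_form (D2U eta) (h e) (h e) / e.
have form_cvg : form e @[e --> 0^'+] --> J.
  have c1 : \int[leb2 T]_z (chi0_g1 (D2U eta) z * (w e z.1 * w e z.2)) @[e --> 0^'+] --> (0 : R).
    apply: (weak_cvg0_tensor C0) => //; last exact: Lfun2_sqint.
    exact: (cvg_scaled0 eta0 M0 etaM bh hE).
  have nd := qvar_nd eta_qvar.
  have c4 : \int[leb T]_x (g4 x * w e x ^+ 2) @[e --> 0^'+] --> J.
    have [L g4L] : exists L : R, {ae leb T, forall x, `|g4 x| <= L}.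
      have fin : ('N[leb T]_(+oo)[EFin \o g4] < +oo)%E by exact: Lfunction_finite.
      (* Adding 1 gives the strict inequality required by [Lnormy_lt]. *)
      exists (fine 'N[leb T]_(+oo)[EFin \o g4] + 1).
      have m0 : (0 < leb T setT)%E by rewrite leb_setT.
      apply: (Lnormy_lt m0).
      rewrite EFinD fineK; first by rewrite lteDl ?lte01// ge0_fin_numE ?Lnorm_ge0.
      by rewrite ge0_fin_numE ?Lnorm_ge0.
    have bw2 e : bmeas (fun x => w e x ^+ 2) by exact: (bmeasM (bw e) (bw e)).
    have w20 e x : 0 <= w e x ^+ 2 by exact: sqr_ge0.
    have w2c a : itvT T a -> \int[leb T]_(x in `[(- T%:num), a]) (w e x ^+ 2) @[e --> 0^'+] -->
        qvar eta a - qvar eta (- T%:num).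
      by move=> aT; exact: (cvg_sqr_scaled eta0 M0 etaM bh hE).
    have g4c : {ae stieltjes T (qvar eta), forall x, itvT T x -> continuous_itvT_at T g4 x}.
      have [A [mA A0 dA]] := diag_disc; exists A; split => // x nx; apply: dA.
      split; first by apply: contrapT => xT; apply: nx.
      by move=> cx; apply: nx => xT; exact: continuous_itvT_atP.
    have mg4 : measurable_fun setT (g4 : measurableTypeR R -> R) by exact: measurable_funPT.
    exact: (stieltjes_weak_cvg nd bw2 w20 w2c mg4 g4L g4c).
  rewrite -[J]add0r; apply: cvg_trans (cvgD c1 c4); apply: near_eq_cvg.
  near=> e; have e0 : 0 < e by near: e; exact: nbhs_right_gt.
  rewrite fctE /form.
  rewrite chi0_form_diag//; last exact: hT.
  rewrite mulrDl ![_ / e]mulrC.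
  have bhh := bmeas_tensor (bh e) (bh e).
  have sg1 := Lfun2_sqint (chi0_g1 (D2U eta)).
  have i1 := sqint_mul_integrable sg1 (bmeas_sqint (leb2 T) bhh).
  have bh2 := bmeasM (bh e) (bh e).
  have i4 := integrable_bmeasM measurableT (LfunType_integrable g4) bh2.
  have wE x : w e x = (Num.sqrt e)^-1 * h e x by [].
  (* The factor 1 / e splits into one factor 1 / sqrt e for each argument of the bilinear form. *)
  have ee : (Num.sqrt e)^-1 * (Num.sqrt e)^-1 = e^-1 by rewrite -invfM -expr2 sqr_sqrtr// ltW.
  rewrite -RintegralZl// -RintegralZl//; congr (_ + _).
    by apply: eq_Rintegral => z _; rewrite !wE -ee; ring.
  by apply: eq_Rintegral => x _; rewrite wE -ee; ring.
(* By Taylor's formula the backward quotient should equal [A e] up to o(1), and [A e] has the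
   desired limit. *)
pose A e : R := (u (cpath_incl eta) - u (s e)) / e + 2^-1 * form e.
have A_cvg : A e @[e --> 0^'+] --> DHU + 2^-1 * J.
  by apply: cvgD; [exact: Hs|apply: cvgM; [exact: cvg_cst|exact: form_cvg]].
apply: (cvg_sub0 _ A_cvg); apply/cvgr0Pnorm_le => r r0.
(* With the integral of h_e^2 at most e * C ^+ 2, [chi0_form_dist] then bounds the change of the
   form by r * e. Its half and the two errors e ^+ 2, with e <= r / 4, add up to r * e. *)
pose rho : R := r / (3 * C ^+ 2).
have rho0 : 0 < rho by rewrite divr_gt0// mulr_gt0// exprn_gt0.
have [d d0 Hd] : exists2 d : R, 0 < d & forall y : cpath T, `|y| < d ->
    (chi0_dist (D2U (eta + y)%R) (D2U eta) < rho%:E)%E.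
  have : nbhs (0%E : \bar R) [set x | (x < rho%:E)%E].
    by apply: open_ereal_lt'; rewrite lte_fin.
  move=> /(D2U_cont eta) /nbhs_ballP[d /= d0 H]; exists d => // y yd.
  by apply: H; rewrite -ball_normE/= opprD addrA subrr add0r normrN.
have d20 : 0 < d / 2 by rewrite divr_gt0.
have hsmall := increments_small eta0 hE d20.
near=> e.
have e0 : 0 < e by near: e; exact: nbhs_right_gt.
have er : e <= r / 4 by near: e; apply: nbhs_right_le; rewrite divr_gt0.
have hd : `|h e| <= d / 2.
  by apply: cpath_norm_le; near: e; exact: hsmall.
have we : \int[leb T]_x (w e x ^+ 2) <= C ^+ 2 by near: e; exact: wC.
have [d' _ [hE' uE IE]] : good_increment eta u DU (s e) e (h e) by near: e.
have [th /andP[th0 th1] tay] := frechet_taylor2 eta (h e) U_C2.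
have C20 : 0 < C ^+ 2 by rewrite exprn_gt0.
have hC : \int[leb T]_x (h e x ^+ 2) <= e * C ^+ 2.
  rewrite -ler_pdivrMl//.
  rewrite -RintegralZl//; last first.
    by apply: bmeas_integrable => //; exact: (bmeasM (bh e) (bh e)).
  apply: le_trans we; rewrite le_eqVlt; apply/orP; left; apply/eqP.
  by apply: eq_Rintegral => x _; rewrite /w sqr_scaled.
have thd : `|th *: h e| < d.
  rewrite normrZ gtr0_norm//; apply: (@le_lt_trans _ _ (d / 2)).
    by rewrite (le_trans _ hd)// ler_piMl// ltW.
  by rewrite ltr_pdivrMr// ltr_pMr// ltr1n.
have QF := chi0_form_dist (bh e) (h0 e) (hT e) rho0 (mulr_gt0 e0 C20) (Hd _ thd) hC.
(* The mass of the derivative at 0 is not seen by h e, which vanishes there. *)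
have Bp : frechet U eta (h e) = cintegral (charge_perp DU) (itvT T) (h e).
  rewrite DU_eta cintegral_charge_perp// cintegral_setI//; first exact: measurable_setC0.
  by move=> x _ /= /contrapT ->.
have bi := bmeas_incr eta0 etaM e.
have Ip : cintegral (charge_perp DU) (itvT T) (fun x => (pext T eta x - pext T eta (x - e)) / e) =
    - (cintegral (charge_perp DU) (itvT T) (incr eta e)) / e.
  have [lin _] := cintegral_bounded_linear (charge_perp DU) mT.
  have := lin (- e^-1) (incr eta e) (fun=> 0) bi (bmeas_cst _ _).
  (* Linearity gives the value 0 on the zero function, which serves as the second summand in the
     scaling above. *)
  have := lin (-1) (fun=> 0) (fun=> 0) (bmeas_cst _ _) (bmeas_cst _ _).
  rewrite (_ : (fun _ => _ + _) = (fun=> 0)); last by apply/funext => x; rewrite mulr0 addr0.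
  rewrite mulN1r addNr => z0; rewrite z0 addr0 mulNr mulrC -mulNr => <-.
  congr (cintegral _ _ _); apply/funext => x.
  by rewrite (cpathP eta).1 /incr addr0 mulNr mulrC -mulrN opprB.
rewrite fctE /A Ip /form.
rewrite D2U_chi0 in tay; rewrite Bp in tay.
rewrite u_ext in uE; rewrite u_ext.
set Q := chi0_form (D2U (eta + th *: h e)) _ _ in tay QF.
set F0 := chi0_form (D2U eta) _ _ in QF *.
pose I0 := cintegral (charge_perp DU) (itvT T) (incr eta e).
pose B0 := cintegral (charge_perp DU) (itvT T) (h e).
rewrite -/I0 -/B0 in IE; rewrite -/B0 in tay.
rewrite [X in `|X|](_ : _ = - I0 / e - ((U eta - u (s e)) / e + 2^-1 * (F0 / e)))//.
(* Eliminating [U eta] by Taylor's formula leaves three errors: the cutoff in the first-order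
   integral, the replacement of the shifted path, and the second derivative at the intermediate
   path. *)
rewrite (_ : _ - _ = ((B0 - I0) + (u (s e) - U (eta + h e)) + 2^-1 * (Q - F0)) / e); last first.
  have -> : B0 = U (eta + h e) - U eta - 2^-1 * Q by rewrite -tay; ring.
  by field; rewrite gt_eqF.
rewrite normrM [X in _ * X]gtr0_norm ?invr_gt0// ler_pdivrMr//.
rewrite (le_trans (ler_normD _ _))// normrM ger0_norm ?invr_ge0//.
have n1 := ler_normD (B0 - I0) (u (s e) - U (eta + h e)).
have e2 : e ^+ 2 <= r / 4 * e by rewrite expr2 ler_pM2r.
have rC : 3 * rho * (e * C ^+ 2) = r * e.
  by rewrite /rho; field; rewrite !gt_eqF.
rewrite rC in QF; lra.
Unshelve. all: by end_near. Qed.
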